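(* Consider the Cauchy problem for the $(3+1)$-dimensional relativistic Euler equations with $P(\rho)=k^2\rho^\gamma$ ($k>0$, $\gamma\ge1$, $c>0$): $$\Big(\frac{\rho+P|u|^2/c^4}{1-|u|^2/c^2}\Big)_t+\mathrm{div}\Big(\frac{(\rho+P/c^2)u}{1-|u|^2/c^2}\Big)=0,\qquad \Big(\frac{(\rho+P/c^2)u}{1-|u|^2/c^2}\Big)_t+\mathrm{div}\Big(\frac{\rho+P/c^2}{1-|u|^2/c^2}\,u\otimes u\Big)+\nabla P=0,$$ with $(\rho,u)|_{t=0}=(\rho_0,u_0)$ on $\mathbb{R}^3$. If the initial data $(\rho_0,u_0)$ have an isolated mass group $(A_0,B_0)$, then the regular solution $(\rho,u)$ on $[0,T_m]\times\mathbb{R}^3$ of this Cauchy problem with maximal existence time $T_m$ blows up in finite time, i.e. $T_m<+\infty$.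
   Context: Regular solution: for $T>0$, $(\rho,u)$ is a regular solution on $[0,T]\times\mathbb{R}^3$ if it satisfies the Cauchy problem in the sense of distributions and (A) $\rho\ge0$, $(\rho,u)\in C^1([0,T]\times\mathbb{R}^3)$; (B) $|u|<c$ and $\sqrt{P'(\rho)}<c$; (C) $u_t+u\cdot\nabla u=0$ whenever $\rho(t,x)=0$. The maximal existence time $T_m\in(0,\infty]$ is the supremum of times up to which the regular solution exists. Isolated mass group: $(\rho_0,u_0)$ has an isolated mass group $(A_0,B_0)$ if $A_0,B_0\subset\mathbb{R}^3$ are smooth, bounded, connected open sets such that, for some constant $R_0>0$ and some constant vector $\bar u_0\in\mathbb{R}^3$, (i) $\overline{A}_0\subset B_0\subseteq B_{R_0}$, where $B_{R_0}$ is the ball of radius $R_0$ centered at the origin; (ii) $\rho_0(x)=0$ for all $x\in B_0\setminus A_0$, and $\int_{A_0}\rho_0\,dx>0$; (iii) $u_0|_{\partial A_0}=\bar u_0$ and $\int_{A_0}\tilde\rho(0,x)\,u_0(x)\,dx=0$, where $\tilde\rho=\dfrac{\rho+P/c^2}{1-|u|^2/c^2}$. *)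

(* Defs.v *)
From HB Require Import structures.
From mathcomp Require Import all_boot all_order all_algebra.
From mathcomp Require Import all_classical all_reals all_analysis.

Set Implicit Arguments.
Unset Strict Implicit.
Unset Printing Implicit Defensive.

Import Order.TTheory GRing.Theory Num.Theory.
Import numFieldNormedType.Exports.

Local Open Scope classical_set_scope.
Local Open Scope ring_scope.

Notation space R := ('rV[R]_3).
Notation spacetime R := (R * 'rV[R]_3)%type.

Section Calculus.
Context {R : realType}.

(* The library norm on ['rV[R]_3] is the sup norm; the problem uses the
   Euclidean one. *)
Definition sqnorm (v : space R) : R := \sum_(i < 3) v 0 i ^+ 2.
Definition enorm (v : space R) : R := Num.sqrt (sqnorm v).

(* Lebesgue measure lives on [R * R * R]; [vec3] identifies it with
   ['rV[R]_3]. *)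
Definition vec3 (x : R * R * R) : space R :=
  \row_j [:: x.1.1; x.1.2; x.2]`_j.

Definition lebesgue3 := (@lebesgue_measure R \x @lebesgue_measure R
                           \x @lebesgue_measure R)%E.
Definition lebesgue13 := (@lebesgue_measure R \x lebesgue3)%E.

Definition integral_space (A : set (space R)) (f : space R -> R) : \bar R :=
  (\int[lebesgue3]_(x in vec3 @^-1` A) (f (vec3 x))%:E)%E.

Definition integral_spacetime (A : set (spacetime R)) (f : spacetime R -> R)
    : \bar R :=
  (\int[lebesgue13]_(p in [set p | A (p.1, vec3 p.2)])
     (f (p.1, vec3 p.2))%:E)%E.

(* Derivative relative to a set of parameters [D]: one-sided at the endpoints
   of an interval, so that values of [f] outside [D] are irrelevant. *)
Definition quotient (f : R -> R) (t s : R) : R := (f s - f t) / (s - t).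
Definition derivable_in (D : set R) (f : R -> R) (t : R) : Prop :=
  cvg (quotient f t @ within D t^').
Definition derive_in (D : set R) (f : R -> R) (t : R) : R :=
  lim (quotient f t @ within D t^').

Definition basis (i : 'I_3) : space R := delta_mx 0 i.
Definition dir_t : spacetime R := (1, 0).
Definition dir_x (i : 'I_3) : spacetime R := (0, basis i).

Definition slab (T : R) : set (spacetime R) := [set p | 0 <= p.1 <= T].
Definition open_slab (T : R) : set (spacetime R) := [set p | 0 < p.1 < T].

Definition dt (T : R) (f : spacetime R -> R) (p : spacetime R) : R :=
  derive_in `[0, T] (fun s => f (s, p.2)) p.1.
Definition dx (i : 'I_3) (f : spacetime R -> R) (p : spacetime R) : R :=
  'D_(dir_x i) f p.

Definition C1_slab (T : R) (f : spacetime R -> R) : Prop :=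
  [/\ {within slab T, continuous f},
      (forall p, slab T p -> derivable_in `[0, T] (fun s => f (s, p.2)) p.1),
      {within slab T, continuous (dt T f)},
      (forall i p, slab T p -> derivable f p (dir_x i)) &
      (forall i, {within slab T, continuous (dx i f)})].

(* All iterated directional derivatives exist and are continuous. *)
Definition smooth (V : normedModType R) (f : V -> R) : Prop :=
  forall s : seq V,
    let g := foldr (fun v (h : V -> R) => 'D_v h) f s in
    continuous g /\ forall x v, derivable g x v.

Definition test_function (T : R) (phi : spacetime R -> R) : Prop :=
  let supp := closure [set p | phi p != 0] in
  [/\ smooth phi, compact supp & supp `<=` open_slab T].

Definition boundary (A : set (space R)) : set (space R) :=
  closure A `\` interior A.

(* Smooth open set: near each boundary point it is the sublevel set of a
   smooth function with nonzero gradient there. *)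
Definition smooth_open (A : set (space R)) : Prop :=
  open A /\
  forall x, boundary A x ->
    exists g : space R -> R,
      [/\ smooth g, (exists i, 'D_(basis i) g x != 0) &
          \forall y \near x, A y <-> g y < 0].

End Calculus.

Section RelativisticEuler.
Context {R : realType}.
Variables (k gamma c : R).

Definition pressure (r : R) : R := k ^+ 2 * r `^ gamma.

(* The pressure law is only meaningful for [0 <= r]. *)
Definition dpressure (r : R) : R := derive_in `[0, +oo[ pressure r.

Definition rho_tilde (r : R) (v : space R) : R :=
  (r + pressure r / c ^+ 2) / (1 - sqnorm v / c ^+ 2).

Definition mass_energy (r : R) (v : space R) : R :=
  (r + pressure r * sqnorm v / c ^+ 4) / (1 - sqnorm v / c ^+ 2).

Definition euler_mass_weak (T : R) (rho : spacetime R -> R)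
    (u : spacetime R -> space R) : Prop :=
  forall phi, test_function T phi ->
    integral_spacetime (open_slab T) (fun p =>
      mass_energy (rho p) (u p) * 'D_dir_t phi p
      + \sum_(j < 3) rho_tilde (rho p) (u p) * u p 0 j * dx j phi p) = 0%E.

Definition euler_momentum_weak (T : R) (rho : spacetime R -> R)
    (u : spacetime R -> space R) : Prop :=
  forall (i : 'I_3) phi, test_function T phi ->
    integral_spacetime (open_slab T) (fun p =>
      rho_tilde (rho p) (u p) * u p 0 i * 'D_dir_t phi p
      + \sum_(j < 3)
          rho_tilde (rho p) (u p) * u p 0 i * u p 0 j * dx j phi p
      + pressure (rho p) * dx i phi p) = 0%E.

Record regular_solution (rho0 : space R -> R) (u0 : space R -> space R)
    (T : R) (rho : spacetime R -> R) (u : spacetime R -> space R) : Prop := {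
  rs_mass : euler_mass_weak T rho u;
  rs_momentum : euler_momentum_weak T rho u;
  rs_initial : forall x, rho (0, x) = rho0 x /\ u (0, x) = u0 x;
  rs_rho_ge0 : forall p, slab T p -> 0 <= rho p;
  rs_rho_C1 : C1_slab T rho;
  rs_u_C1 : forall i, C1_slab T (fun p => u p 0 i);
  rs_subluminal : forall p, slab T p ->
    enorm (u p) < c /\ Num.sqrt (dpressure (rho p)) < c;
  rs_vacuum : forall p, slab T p -> rho p = 0 -> forall i,
    dt T (fun q => u q 0 i) p
    + \sum_(j < 3) u p 0 j * dx j (fun q => u q 0 i) p = 0
}.

(* Supremum over the times [T] up to which some regular solution with the given
   data exists; it is [-oo] if there is none. *)
Definition max_existence_time (rho0 : space R -> R) (u0 : space R -> space R)
    : \bar R :=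
  ereal_sup [set T%:E | T in [set T | 0 < T /\
    exists rho u, regular_solution rho0 u0 T rho u]].

Record isolated_mass_group (rho0 : space R -> R) (u0 : space R -> space R)
    (A B : set (space R)) : Prop := {
  img_A : [/\ smooth_open A, bounded_set A & connected A];
  img_B : [/\ smooth_open B, bounded_set B & connected B];
  img_nested : closure A `<=` B;
  img_ball : exists2 R0 : R, 0 < R0 & B `<=` [set x | enorm x < R0];
  img_vacuum : forall x, (B `\` A) x -> rho0 x = 0;
  img_mass : (0 < integral_space A rho0)%E;
  img_boundary : exists ubar, forall x, boundary A x -> u0 x = ubar;
  img_momentum : forall i, integral_space A
    (fun x => rho_tilde (rho0 x) (u0 x) * u0 x 0 i) = 0%E
}.

End RelativisticEuler.

(* Main.v *)
(* On [A0] moved rigidly with the boundary velocity [v], every conserved field and its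
   first derivatives vanish on the moving boundary: a particle path that starts in the
   vacuum stays there by the transport equation for [rho], and is a straight line because
   the acceleration vanishes in the vacuum.  Hence the conservation laws can be paired
   on the moving region with test functions that are not compactly supported.  With
   [y = x - t v], [e] the energy density, [S] the enthalpy density and
   [chi = t^2 (T - t)^2], the second moment of [e] gives
     iint chi'' e |y|^2 / 2 = iint chi (|v|^2 e + S |u|^2 + 3 P),
   since the total momentum vanishes.  The left side is at most [T^3 R0^2 E0] and the
   right side is at least a multiple of [T^5 E0], so [T] is bounded by the data: if
   [v <> 0] use [|v|^2 e], otherwise [S |u|^2 + 3 P >= kap (e - eps)]. *)
From HB Require Import structures.
From mathcomp Require Import all_boot all_order all_algebra.
From mathcomp Require Import all_classical all_reals all_analysis.
From mathcomp Require Import measurable_realfun ring lra.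
Require Import Defs.

Set Implicit Arguments.
Unset Strict Implicit.
Unset Printing Implicit Defensive.

Import Order.TTheory GRing.Theory Num.Theory.
Import numFieldNormedType.Exports.

Local Open Scope classical_set_scope.
Local Open Scope ring_scope.

(** The moment is paired with the weight [chi] rather than differentiated twice in time: the fields
    are only of class C^1, and nothing is known about the group at the final time. Since [chi] and
    [chi'] vanish at both ends, the only data that enter are the energy [E0] and the zero initial
    momentum. The two sizes behind the bound are [chi'' <= 2 T^2] and the integral of [chi], which
    is [T^5 / 30].

    The obstacle is to test with [|y|^2] on a moving region, while the equations hold only in the
    sense of distributions. They are made pointwise by localization, cut off by the indicator of the
    moving region and integrated by parts again. The cut-off fields must be of class C^1 across the
    moving boundary, which is why the derivatives of the density have to vanish there too. That the
    vacuum persists rests on [rho] being a factor of the right side of its transport equation, with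
    a continuous cofactor because [gamma >= 1].

    For [v = 0] the trace [S |u|^2 + 3 P] does not control energy at low density. The threshold
    [eps] is small enough that the loss over a cube of side [2 R0] is at most half of the main term;
    this turns 30 into 60. *)

Lemma ord3_cases (i : 'I_3) : [\/ i = 0, i = 1 | i = 2].
Proof.
by case: i => -[|[|[|//]]] hi; [constructor 1|constructor 2|constructor 3]; exact: val_inj.
Qed.

Lemma sum3E (V : nmodType) (f : 'I_3 -> V) : \sum_(i < 3) f i = f 0 + f 1 + f 2.
Proof.
rewrite !big_ord_recl big_ord0 addr0 addrA.
have -> : lift ord0 (lift ord0 ord0) = 2 :> 'I_3 by exact: val_inj.
by have -> : lift ord0 ord0 = 1 :> 'I_3 by exact: val_inj.
Qed.

(** Contraction with the four-velocity: the energy equation minus [ci] times [u] contracted with the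
    momentum equations. Here [s] is the enthalpy density, [ci] is [c^-2], and the last hypothesis is
    the differentiated relation [q * s = r + P * ci], whose derivative along [(1, u)] removes the
    remaining pressure terms. *)
Lemma transport_elimination (F : fieldType) (s q ci : F) (u : 'I_3 -> F)
    (dr dP dS : option 'I_3 -> F) (du : 'I_3 -> option 'I_3 -> F) :
  q = 1 - (\sum_(i < 3) u i ^+ 2) * ci ->
  (dS None - dP None * ci) + \sum_(j < 3) (dS (Some j) * u j + s * du j (Some j)) = 0 ->
  (forall i, (dS None * u i + s * du i None)
    + \sum_(j < 3) ((dS (Some j) * u i + s * du i (Some j)) * u j
     + s * u i * du j (Some j) + (i == j)%:R * dP (Some j)) = 0) ->
  (forall o, q * dS o - (dr o + dP o * ci + s * (2 * (\sum_(i < 3) u i * du i o)) * ci) = 0) ->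
  dr None + \sum_(j < 3) u j * dr (Some j) =
  - (s * (\sum_(i < 3) u i * (du i None + \sum_(j < 3) u j * du i (Some j))) * ci
    + s * q * \sum_(j < 3) du j (Some j)).
Proof.
move=> qE E M X; apply/eqP; rewrite -subr_eq0 opprK; apply/eqP.
have := M 0; have := M 1; have := M 2.
have := X None; have := X (Some 0); have := X (Some 1); have := X (Some 2).
move: E; rewrite qE !sum3E /=.
set L1 := (X in X = 0); move=> E.
set X2 := (X in X = 0 -> _); move=> hX2.
set X1 := (X in X = 0 -> _); move=> hX1.
set X0 := (X in X = 0 -> _); move=> hX0.
set Xt := (X in X = 0 -> _); move=> hXt.
set M2 := (X in X = 0 -> _); move=> hM2.
set M1 := (X in X = 0 -> _); move=> hM1.
set M0 := (X in X = 0 -> _); move=> hM0.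
(* The coefficients of [L1] add up to [q + |u|^2 ci = 1]; the momentum equations enter in the form
   from which [u i] times the energy equation is subtracted. *)
transitivity (q * L1 - ci * (u 0 * (M0 - u 0 * L1) + u 1 * (M1 - u 1 * L1) + u 2 * (M2 - u 2 * L1))
  - (Xt + u 0 * X0 + u 1 * X1 + u 2 * X2)); last first.
  by rewrite E hX2 hX1 hX0 hXt hM2 hM1 hM0; ring.
rewrite qE sum3E /L1 /X2 /X1 /X0 /Xt /M2 /M1 /M0.
ring.
Qed.

(** * Measurability and integration on space and spacetime *)

(** Open sets of a product topology have to be measurable for the product sigma-algebra. A countable
    base of measurable sets yields this and passes to products. The neighbourhoods are a parameter,
    so that no topology has to be bundled with [T]. *)
Definition measurable_base d (T : measurableType d) (nb : T -> set_system T) :=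
  exists (I : countType) (B : I -> set T), (forall i, measurable (B i)) /\
    forall x U, nb x U -> exists i, B i x /\ B i `<=` U.

Lemma measurable_base_R (R : realType) : @measurable_base _ R nbhs.
Proof.
exists (rat * rat)%type, (fun q => `]ratr q.1, ratr q.2[%classic : set R).
split=> [i|x U /nbhs_ballP[e /= e0 xU]]; first exact: measurable_itv.
have [q1 /andP[a b]] := @rat_in_itvoo R (x - e) x ltac:(by rewrite ltrBlDr ltrDl).
have [q2 /andP[c d]] := @rat_in_itvoo R x (x + e) ltac:(by rewrite ltrDl).
exists (q1, q2); split => /=; first by rewrite in_itv/=; apply/andP; split; rewrite -?bnd_simp.
move=> y /=; rewrite in_itv/= => /andP[y1 y2]; apply: xU.
by rewrite -ball_normE /= ltr_distlC; apply/andP; split; [exact: lt_trans y1|exact: lt_trans d].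
Qed.

Lemma measurable_base_prod d1 d2 (T1 : measurableType d1) (T2 : measurableType d2)
    (nb1 : T1 -> set_system T1) (nb2 : T2 -> set_system T2) :
  measurable_base nb1 -> measurable_base nb2 ->
  @measurable_base _ (T1 * T2)%type (fun x => filter_prod (nb1 x.1) (nb2 x.2)).
Proof.
move=> [I1 [B1 [m1 b1]]] [I2 [B2 [m2 b2]]].
exists (I1 * I2)%type, (fun i => B1 i.1 `*` B2 i.2); split=> [i|x U].
  exact: measurableX.
move=> [[U1 U2] /= [n1 n2] sU].
have [i1 [h1 s1]] := b1 _ _ n1; have [i2 [h2 s2]] := b2 _ _ n2.
exists (i1, i2); split=> //= y [/= y1 y2]; apply: sU; split => /=; [exact: s1|exact: s2].
Qed.

Lemma measurable_base_open d (T : measurableType d) (nb : T -> set_system T) (U : set T) :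
  measurable_base nb -> (forall x, U x -> nb x U) -> measurable U.
Proof.
move=> [I [B [mB bB]]] oU.
have -> : U = \bigcup_i (if `[< B i `<=` U >] then B i else set0).
  apply/seteqP; split=> [x Ux|x [i _]].
    by have [i [Bx Bi]] := bB _ _ (oU _ Ux); exists i => //; case: asboolP.
  by case: asboolP => // s /s.
apply: countable_bigcupT_measurable => // i; by case: ifP.
Qed.

Section continuous_measurable_prod.
Context {R : realType}.
Notation X3 := (R * R * R)%type.
Notation X4 := (R * (R * R * R))%type.

Lemma measurable_base_X3 : @measurable_base _ X3 nbhs.
Proof.
apply: measurable_base_prod; last exact: measurable_base_R.
by apply: measurable_base_prod; exact: measurable_base_R.
Qed.

Lemma measurable_base_X4 : @measurable_base _ X4 nbhs.
Proof.
exact: measurable_base_prod (measurable_base_R R) measurable_base_X3.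
Qed.

Lemma open_measurable_X3 (U : set X3) : open U -> measurable U.
Proof.
rewrite openE => oU; exact: (measurable_base_open measurable_base_X3 oU).
Qed.

Lemma open_measurable_X4 (U : set X4) : open U -> measurable U.
Proof.
rewrite openE => oU; exact: (measurable_base_open measurable_base_X4 oU).
Qed.

Lemma continuous_measurable_X3 (f : X3 -> R) : continuous f -> measurable_fun setT f.
Proof.
move=> /continuousP cf; apply: (measurability _ (RGenOpens.measurableE R)).
move=> _ [_ [a [b ->] <-]]; rewrite setTI; apply: open_measurable_X3.
exact/cf/interval_open.
Qed.

Lemma continuous_measurable_X4 (f : X4 -> R) : continuous f -> measurable_fun setT f.
Proof.
move=> /continuousP cf; apply: (measurability _ (RGenOpens.measurableE R)).
move=> _ [_ [a [b ->] <-]]; rewrite setTI; apply: open_measurable_X4.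
exact/cf/interval_open.
Qed.

End continuous_measurable_prod.

(* The library equips [m1 \x m2] with two sigma-finite structures, and unification
   picks the one that requires [m1] and [m2] to be subprobabilities. *)
Section sigma_finite_product.
Context d1 d2 (T1 : measurableType d1) (T2 : measurableType d2) (R : realType).
Variables (m1 : {sigma_finite_measure set T1 -> \bar R})
          (m2 : {sigma_finite_measure set T2 -> \bar R}).

Definition prod_mu : set (T1 * T2)%type -> \bar R := (m1 \x m2)%E.

HB.instance Definition _ := Measure.copy prod_mu (m1 \x m2)%E.

Lemma sigma_finite_prod_mu : sigma_finite setT prod_mu.
Proof.
have [F TF hF] := sigma_finiteT m1; have [G TG hG] := sigma_finiteT m2.
pose H n := if unpickle n is Some (i, j) then F i `*` G j else set0.
exists H => [|n].
  apply/seteqP; split=> // -[x y] _.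
  have [i _ Fi] : (\bigcup_i F i) x by rewrite -TF.
  have [j _ Gj] : (\bigcup_j G j) y by rewrite -TG.
  by exists (pickle (i, j)) => //; rewrite /H pickleK.
rewrite /H; case: unpickle => [[i j]|]; last by rewrite measure0.
have [mF fF] := hF i; have [mG fG] := hG j; split; first exact: measurableX.
rewrite /prod_mu product_measure1E//; apply: lte_mul_pinfty => //.
by rewrite ge0_fin_numE.
Qed.

HB.instance Definition _ := Measure_isSigmaFinite.Build _ _ _ prod_mu
  sigma_finite_prod_mu.

End sigma_finite_product.

Section integrals.
Context {R : realType}.
Notation X3 := (R * R * R)%type.
Notation X4 := (R * (R * R * R))%type.
Notation mu := (@lebesgue_measure R).

Lemma continuous_row (T : topologicalType) n (g : T -> 'rV[R]_n) :
  (forall j, continuous (fun x => g x 0 j)) -> continuous g.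
Proof.
move=> cg x A [P nP sP]; apply: filterS sP _.
have : \forall y \near x, forall j, P 0 j (g y 0 j).
  apply: filter_forall => j; exact: cg (nP 0 j).
by apply: filterS => y Py i j; rewrite ord1.
Qed.

Lemma continuous_vec3 : continuous (@vec3 R).
Proof.
apply: continuous_row => j.
have E : (fun x : X3 => vec3 x 0 j) = (fun x : X3 => [:: x.1.1; x.1.2; x.2]`_j).
  by apply/funext => x; rewrite mxE.
rewrite E.
have c1 : continuous (fun x : X3 => x.1.1).
  by move=> x; apply: continuous_comp; exact: cvg_fst.
have c2 : continuous (fun x : X3 => x.1.2).
  by move=> x; apply: continuous_comp; [exact: cvg_fst|exact: cvg_snd].
have c3 : continuous (fun x : X3 => x.2) by move=> x; exact: cvg_snd.
by case: j {E} => -[|[|[|//]]] ?.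
Qed.

Lemma compact_continuous_bounded (X : topologicalType) (K : set X) (f : X -> R) :
  compact K -> continuous f -> exists2 M, 0 < M & forall x, K x -> `|f x| <= M.
Proof.
move=> cK cf.
have /compact_bounded [M [_ hM]] : compact (f @` K).
  by apply: continuous_compact => //; exact: continuous_subspaceT.
exists (`|M| + 1) => [|x Kx]; first by rewrite ltr_wpDl.
by apply: hM; [rewrite (le_lt_trans (ler_norm _))// ltrDl|exists x].
Qed.

Lemma bounded_support_integrable d (T : measurableType d)
    (m : {measure set T -> \bar R}) (K : set T) (f : T -> R) :
  measurable K -> (m K < +oo)%E -> measurable_fun setT f ->
  (exists M, forall x, K x -> `|f x| <= M) -> (forall x, ~ K x -> f x = 0) ->
  m.-integrable setT (EFin \o f).
Proof.
move=> mK fK mf [M hM] f0.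
have : m.-integrable K (EFin \o f).
  apply: measurable_bounded_integrable => //; first exact: measurable_funTS.
  exists M; split; first exact: num_real.
  by move=> N /ltW MN x Kx /=; exact: le_trans (hM _ Kx) MN.
move/(integrable_mkcond _ mK); apply: eq_integrable => // x _.
rewrite /patch; case: ifPn => // /negP; rewrite inE => nK /=.
by rewrite f0.
Qed.

Definition cube (L : R) : set X3 := (`[- L, L] `*` `[- L, L]) `*` `[- L, L].

Lemma cubeP (L : R) (x : X3) : cube L x <-> forall i, `|vec3 x 0 i| <= L.
Proof.
split=> [[[/= h1 h2] h3] i|h].
  rewrite mxE; move: h1 h2 h3; rewrite /= !in_itv /= -!ler_norml.
  by case: i => -[|[|[|//]]] ?.
have := h (Ordinal (isT : (0 < 3)%N)); have := h (Ordinal (isT : (1 < 3)%N)).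
have := h (Ordinal (isT : (2 < 3)%N)); rewrite !mxE /= => h3 h2 h1.
by split; [split|]; rewrite /= in_itv/= -ler_norml.
Qed.

Lemma measurable_cube L : measurable (cube L).
Proof. by apply: measurableX; [apply: measurableX|]. Qed.

Lemma compact_cube L : compact (cube L).
Proof. by apply: compact_setX; [apply: compact_setX|]; exact: segment_compact. Qed.

Definition mu2 := prod_mu mu mu.
Definition mu3 := prod_mu mu2 mu.
Definition mu4 := prod_mu mu mu3.
Lemma mu3_cube (L : R) : 0 <= L -> mu3 (cube L) = ((L *+ 2) ^+ 3)%:E.
Proof.
move=> L0; pose I : set R := `[- L, L]%classic.
have mI : measurable I by exact: measurable_itv.
have LL : mu I = (L *+ 2)%:E.
  rewrite lebesgue_measure_itv/= lte_fin.
  case: ltrP => [_|h]; first by rewrite -EFinD opprK mulr2n.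
  by congr EFin; lra.
have -> : mu3 (cube L) = (mu2 (I `*` I) * mu I)%E.
  by apply: product_measure1E => //; exact: measurableX.
have -> : mu2 (I `*` I) = (mu I * mu I)%E by exact: product_measure1E.
by rewrite !LL -!EFinM -expr2 -exprSr.
Qed.

Lemma mu4_box (a b L : R) : a <= b -> 0 <= L ->
  mu4 (`]a, b[ `*` cube L) = ((b - a) * (L *+ 2) ^+ 3)%:E.
Proof.
move=> ab L0.
have -> : mu4 (`]a, b[ `*` cube L) = (mu `]a, b[%classic%R * mu3 (cube L))%E.
  by apply: product_measure1E => //; exact: measurable_cube.
rewrite mu3_cube// lebesgue_measure_itv/= lte_fin.
case: ltrP => [_|h]; first by rewrite -EFinD -EFinM.
have -> : b = a by apply/eqP; rewrite eq_le ab h.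
by rewrite subrr mul0r mul0e.
Qed.

(** [mu4] is convertible to the measure of the definition; the change of name selects the
    sigma-finite structure under which Fubini applies. *)
Lemma integral_spacetimeE (A : set (spacetime R)) (f : spacetime R -> R) :
  integral_spacetime A f =
  (\int[mu4]_(p in [set p | A (p.1, vec3 p.2)]) (f (p.1, vec3 p.2))%:E)%E.
Proof. by []. Qed.

Lemma integral_spaceE (A : set (space R)) (f : space R -> R) :
  integral_space A f = (\int[mu3]_(x in vec3 @^-1` A) (f (vec3 x))%:E)%E.
Proof. by []. Qed.

Lemma integral_derivative0 (f g : R -> R) (L : R) : 0 < L -> continuous g ->
  (forall s : R, is_derive s 1 f (g s)) ->
  (forall s, L <= `|s| -> f s = 0 /\ g s = 0) ->
  (\int[mu]_s (g s)%:E = 0)%E.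
Proof.
move=> L0 cg dg h0.
have cf : continuous f.
  by move=> s; apply: differentiable_continuous; apply/derivable1_diffP; case: (dg s).
have -> : (\int[mu]_s (g s)%:E = \int[mu]_(s in `[(- L)%R, L]) (g s)%:E)%E.
  rewrite [RHS]integral_mkcond; apply: eq_integral => s _; rewrite patchE.
  case: ifPn => // /negP; rewrite inE /= in_itv /= -ler_norml => /negP.
  by rewrite -ltNge => /ltW /h0 [_ ->].
rewrite (@continuous_FTC2 _ g f).
- have [-> _] := h0 L ltac:(by rewrite ger0_norm// ltW).
  have [-> _] := h0 (- L) ltac:(by rewrite normrN ger0_norm// ltW).
  by rewrite subee.
- lra.
- exact: continuous_subspaceT.
- split => [s _||]; first by case: (dg s).
  + by apply: cvg_at_right_filter; exact: cf.
  + by apply: cvg_at_left_filter; exact: cf.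
- by move=> s _; rewrite derive1E; case: (dg s).
Qed.

Lemma integral_derivative_oo (f g : R -> R) (T : R) : 0 < T -> continuous g ->
  continuous f -> (forall s : R, 0 < s < T -> is_derive s 1 f (g s)) ->
  (\int[mu]_(s in `]0%R, T[) (g s)%:E = (f T)%:E - (f 0)%:E)%E.
Proof.
move=> T0 cg cf dg.
rewrite -(@integral_itv_bndoo _ _ _ _ true false); last first.
  apply/measurable_EFinP; apply: measurable_funTS; exact: continuous_measurable_fun.
apply: continuous_FTC2 => //.
- exact: continuous_subspaceT.
- split => [s||]; first by rewrite in_itv/= => /dg [].
  + by apply: cvg_at_right_filter; exact: cf.
  + by apply: cvg_at_left_filter; exact: cf.
- by move=> s; rewrite in_itv/= => /dg ds; rewrite derive1E; case: ds.
Qed.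

End integrals.

Lemma continuous_pair (T U V : topologicalType) (f : T -> U) (g : T -> V) :
  continuous f -> continuous g -> continuous (fun x => (f x, g x)).
Proof.
move=> cf cg x; apply: (@cvg_pair _ _ _ (nbhs x) (nbhs (f x)) (nbhs (g x))).
  exact: cf.
exact: cg.
Qed.

(** * Integrals of derivatives over a time slab *)

Section slab_integrals.
Context {R : realType}.
Notation X3 := (R * R * R)%type.
Notation X4 := (R * (R * R * R))%type.
Notation mu := (@lebesgue_measure R).

(** Both difference quotients coincide. This lets theorems on functions of one real variable act on
    directional derivatives. *)
Lemma is_derive_line (V W : normedModType R) (F : V -> W) (q v : V) (s : R) (d : W) :
  is_derive (q + s *: v) v F d <-> is_derive s 1 (fun r : R => F (q + r *: v)) d.
Proof.
have E : (fun h : R => h^-1 *: ((F \o shift (q + s *: v)) (h *: v) - F (q + s *: v))) =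
    (fun h : R => h^-1 *: (((fun r : R => F (q + r *: v)) \o shift s) (h *: 1)
       - F (q + s *: v))).
  apply/funext => h /=; congr (_ *: (F _ - _)).
  by rewrite [h *: 1]mulr1 scalerDl addrCA.
split=> -[h1 h2]; apply: DeriveDef.
- by move: h1; rewrite /derivable E.
- by move: h2; rewrite /derive E.
- by move: h1; rewrite /derivable -E.
- by move: h2; rewrite /derive -E.
Qed.

(* Freezing the time outside [0, T] makes a function that is continuous on the
   slab continuous everywhere. *)
Definition clamp (T t : R) : R := Num.max 0 (Num.min T t).
Definition clamp_time (T : R) (p : spacetime R) : spacetime R := (clamp T p.1, p.2).

Lemma clamp_id T t : 0 <= t <= T -> clamp T t = t.
Proof. by case/andP=> t0 tT; rewrite /clamp min_r// max_r. Qed.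

Lemma clamp_slab T t : 0 <= T -> 0 <= clamp T t <= T.
Proof. by move=> T0; rewrite /clamp le_max lexx /= ge_max T0 /= ge_min lexx. Qed.

Lemma continuous_clamp T : continuous (clamp T).
Proof.
move=> t; rewrite /clamp.
apply: (@continuous_max R R (fun=> 0) (fun t => Num.min T t)); first exact: cvg_cst.
by apply: (@continuous_min R R (fun=> T) (fun t => t)); [exact: cvg_cst|exact: cvg_id].
Qed.

Lemma continuous_clamp_time T : continuous (clamp_time T).
Proof.
apply: continuous_pair; last by move=> p; exact: cvg_snd.
move=> p; apply: (@continuous_comp _ _ _ fst (clamp T)); first exact: cvg_fst.
exact: continuous_clamp.
Qed.

Definition slab_cts (T : R) (f : spacetime R -> R) := continuous (f \o clamp_time T).
Definition x_supp (T L : R) (f : spacetime R -> R) :=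
  forall (t : R) (x : space R), 0 <= t <= T -> (exists i, L < `|x 0 i|) -> f (t, x) = 0.

Definition point4 (p : X4) : spacetime R := (p.1, vec3 p.2).
Definition slab4 (T : R) : set X4 := [set p | open_slab T (point4 p)].
Definition slab_int (T : R) (f : spacetime R -> R) : R :=
  \int[mu4]_(p in slab4 T) f (point4 p).
Definition space_int (f : space R -> R) : R := \int[mu3]_x f (vec3 x).

Lemma continuous_point4 : continuous point4.
Proof.
apply: continuous_pair => p; first exact: cvg_fst.
by apply: continuous_comp; [exact: cvg_snd|exact: continuous_vec3].
Qed.

Lemma slab4E T : slab4 T = `]0, T[ `*` setT.
Proof.
by apply/seteqP; split=> [p|p [/= + _]]; rewrite /slab4/open_slab/= ?in_itv.
Qed.

Lemma measurable_slab4 T : measurable (slab4 T : set (measurableTypeR R *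
  (measurableTypeR R * measurableTypeR R * measurableTypeR R))%type).
Proof. by rewrite slab4E; apply: measurableX. Qed.

Lemma slab_integrable T L f : 0 < T -> slab_cts T f -> x_supp T L f ->
  mu4.-integrable (slab4 T) (EFin \o (f \o point4)).
Proof.
move=> T0 cf sf; pose L' := Num.max 0 L.
apply: (@integrable_mkcond _ _ _ mu4 _ _ (measurable_slab4 T)).2.
have ch : continuous (f \o clamp_time T \o point4).
  by move=> p; apply: continuous_comp; [exact: continuous_point4|exact: cf].
have E p : slab4 T p -> f (point4 p) = (f \o clamp_time T \o point4) p.
  move=> /= /andP[h1 h2]; rewrite /clamp_time/= clamp_id//.
  by rewrite (ltW h1) (ltW h2).
rewrite restrict_EFin; apply: (@bounded_support_integrable _ _ _ mu4 (`]0, T[ `*` cube L')).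
- by apply: measurableX => //; exact: measurable_cube.
- have := ltry ((T - 0) * (L' *+ 2) ^+ 3).
  by rewrite -(mu4_box (ltW T0))// /L' le_max lexx.
- apply/(measurable_restrictT _ (measurable_slab4 T)).
  apply: (@eq_measurable_fun _ _ _ _ _ (f \o clamp_time T \o point4)).
    by move=> p; rewrite inE => /E e; rewrite /= -/(point4 p) e.
  by apply: measurable_funTS; exact: continuous_measurable_X4.
- have [M _ hM] := @compact_continuous_bounded R _ (`[0, T] `*` cube L') _
    (compact_setX (@segment_compact _ _ _) (@compact_cube _ _)) ch.
  exists M => p [/= p1 p2]; rewrite patchE; case: ifPn => [|_].
    rewrite inE => /E /= ->; apply: hM; split => //=.
    by move: p1; rewrite !in_itv/= => /andP[/ltW -> /ltW ->].
  (* Where the restriction is 0 the bound needs [0 <= M], which is read off at the origin; this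
     point lies in the cube because [L'] is nonnegative. *)
  rewrite normr0; apply: le_trans (hM (0, 0) _) => //; split=> /=.
    by rewrite in_itv/= lexx ltW.
  apply/cubeP => i; rewrite mxE; case: i => -[|[|[|//]]] ? /=;
  by rewrite normr0 /L' le_max lexx.
- move=> p np; rewrite patchE; case: ifPn => //; rewrite inE => sp.
  apply: sf; first by move: sp => /= /andP[/ltW -> /ltW ->].
  apply: contrapT => nL; apply: np; split; first by rewrite /= in_itv.
  apply/cubeP => i; rewrite leNgt; apply/negP => Li; apply: nL; exists i.
  by apply: le_lt_trans Li; rewrite /L' le_max lexx orbT.
Qed.

Lemma space_integrable L f : continuous f -> (forall x : space R, (exists i, L < `|x 0 i|) -> f x = 0) ->
  mu3.-integrable setT (EFin \o (f \o @vec3 R)).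
Proof.
move=> cf sf; pose L' := Num.max 0 L.
have ch : continuous (f \o @vec3 R).
  by move=> p; apply: continuous_comp; [exact: continuous_vec3|exact: cf].
apply: (@bounded_support_integrable _ _ _ mu3 (cube L')).
- exact: measurable_cube.
- by have := ltry ((L' *+ 2) ^+ 3); rewrite -mu3_cube// /L' le_max lexx.
- exact: continuous_measurable_X3.
- by have [M _ hM] := compact_continuous_bounded (@compact_cube _ L') ch; exists M.
- move=> p np; apply: sf; apply: contrapT => nL; apply: np.
  apply/cubeP => i; rewrite leNgt; apply/negP => Li; apply: nL; exists i.
  by apply: le_lt_trans Li; rewrite /L' le_max lexx orbT.
Qed.

(** Fubini with time innermost leaves the fundamental theorem of calculus on each vertical line. The
    derivative is known at interior times only; clamping supplies continuity up to both ends. *)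
Lemma slab_int_dt (T L : R) (F G : spacetime R -> R) : 0 < T ->
  slab_cts T F -> slab_cts T G -> x_supp T L F -> x_supp T L G ->
  (forall p, open_slab T p -> is_derive p (@dir_t R) F (G p)) ->
  slab_int T G = space_int (fun x => F (T, x)) - space_int (fun x => F (0, x)).
Proof.
move=> T0 cF cG sF sG dF.
have hT : 0 <= T <= T by rewrite lexx ltW.
have h0 : 0 <= (0 : R) <= T by rewrite lexx ltW.
have cFt t : 0 <= t <= T -> continuous (fun x => F (t, x)).
  move=> ht x; have -> : (fun x => F (t, x)) = (F \o clamp_time T) \o (fun x => (t, x)).
    by apply/funext => y /=; rewrite /clamp_time/= clamp_id.
  apply: continuous_comp; last exact: cF.
  by apply: continuous_pair => z; [exact: cst_continuous|exact: cvg_id].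
have iT := space_integrable (cFt _ hT) (fun x => sF _ x hT).
have i0 := space_integrable (cFt _ h0) (fun x => sF _ x h0).
rewrite /space_int -RintegralB// /slab_int /Rintegral; congr fine.
rewrite integral_mkcond.
have iG := slab_integrable T0 cG sG.
have {}iG := (integrable_mkcond _ (measurable_slab4 T)).1 iG.
rewrite -(@integral21_prod_meas1 _ _ _ _ _ mu mu3 _ iG).
apply: eq_integral => y _.
transitivity (\int[mu]_(s in `]0%R, T[) (G (clamp_time T (s, vec3 y)))%:E)%E.
  rewrite [RHS]integral_mkcond; apply: eq_integral => s _; rewrite !patchE.
  have -> : ((s, y) \in slab4 T) = (s \in `]0, T[%classic).
    by apply/idP/idP; rewrite !inE /slab4 /open_slab /= ?in_itv.
  case: ifPn => //; rewrite inE /= in_itv /= => /andP[h1 h2].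
  by rewrite /clamp_time /= clamp_id// (ltW h1) (ltW h2).
have cline f : slab_cts T f -> continuous (fun s : R => f (clamp_time T (s, vec3 y))).
  move=> cf s; apply: (@continuous_comp _ _ _ (fun s : R => (s, vec3 y)) (f \o clamp_time T)).
    by apply: continuous_pair => z; [exact: cvg_id|exact: cst_continuous].
  exact: cf.
have dl (s : R) : 0 < s < T -> is_derive s 1
    (fun r : R => F (clamp_time T (r, vec3 y))) (G (clamp_time T (s, vec3 y))).
  move=> sT; have sT' : 0 <= s <= T by case/andP: sT => /ltW -> /ltW ->.
  rewrite /clamp_time/= clamp_id//.
  have := dF (s, vec3 y) sT.
  have Es : (s, vec3 y) = (0, vec3 y) + s *: (@dir_t R) :> spacetime R.
    by apply/eqP; rewrite xpair_eqE /= add0r [s *: 1]mulr1 scaler0 addr0 !eqxx.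
  rewrite {1}Es => /is_derive_line; apply: near_eq_is_derive.
  have nT : \forall r \near s, 0 < r < T.
    have /near_in_itvoo : s \in `]0, T[ by rewrite in_itv.
    by apply: filterS => r; rewrite in_itv.
  near=> r.
  have rT : 0 < r < T by near: r.
  rewrite /clamp_time/= clamp_id; last by case/andP: rT => /ltW -> /ltW ->.
  by congr F; apply/eqP; rewrite xpair_eqE /= add0r [r *: 1]mulr1 scaler0 addr0 !eqxx.
rewrite (integral_derivative_oo T0 (cline _ cG) (cline _ cF) dl).
by rewrite /clamp_time /= !clamp_id// EFinB.
Unshelve. all: by end_near.
Qed.

End slab_integrals.

Section slab_integrals_dx.
Context {R : realType}.
Notation X3 := (R * R * R)%type.
Notation X4 := (R * (R * R * R))%type.
Notation mu := (@lebesgue_measure R).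

Lemma vec3_line0 (a b c : R) :
  vec3 (a, b, c) = vec3 (0, b, c) + a *: basis (Ordinal (isT : (0 < 3)%N)).
Proof.
apply/rowP => i; rewrite !mxE/=.
by case: i => -[|[|[|//]]] ? /=; rewrite ?mulr1 ?mulr0 ?addr0 ?add0r.
Qed.

Lemma vec3_line1 (a b c : R) :
  vec3 (a, b, c) = vec3 (a, 0, c) + b *: basis (Ordinal (isT : (1 < 3)%N)).
Proof.
apply/rowP => i; rewrite !mxE/=.
by case: i => -[|[|[|//]]] ? /=; rewrite ?mulr1 ?mulr0 ?addr0 ?add0r.
Qed.

Lemma vec3_line2 (a b c : R) :
  vec3 (a, b, c) = vec3 (a, b, 0) + c *: basis (Ordinal (isT : (2 < 3)%N)).
Proof.
apply/rowP => i; rewrite !mxE/=.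
by case: i => -[|[|[|//]]] ? /=; rewrite ?mulr1 ?mulr0 ?addr0 ?add0r.
Qed.

Lemma mu2_square_lty (L : R) : (mu2 (`[(- L)%R, L]%classic `*` `[(- L)%R, L]%classic) < +oo)%E.
Proof.
pose I : set R := `[- L, L]%classic.
have mI : measurable I by exact: measurable_itv.
have -> : mu2 (I `*` I) = (mu I * mu I)%E by exact: product_measure1E.
have fI : mu I \is a fin_num.
  by rewrite /I lebesgue_measure_itv/=; case: ifP.
by rewrite -(fineK fI) -EFinM ltry.
Qed.

Lemma integral_line0 (f g : space R -> R) (L : R) (q v : space R) i :
  v 0 i = 1 -> q 0 i = 0 -> continuous g ->
  (forall x : space R, (exists i, L < `|x 0 i|) -> f x = 0 /\ g x = 0) ->
  (forall x : space R, is_derive x v f (g x)) ->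
  (\int[mu]_s (g (q + s *: v))%:E = 0)%E.
Proof.
move=> v1 q0 cg sfg dg.
have L0 : 0 < Num.max 0 L + 1 by rewrite ltr_pwDr// le_max lexx.
have dl (s : R) : is_derive s 1 (fun s => f (q + s *: v)) (g (q + s *: v)).
  exact: (@is_derive_line _ _ _ f q v s (g (q + s *: v))).1 (dg _).
apply: (integral_derivative0 L0 _ dl).
- move=> s; apply: (@continuous_comp _ _ _ (fun s : R => q + s *: v) g); last exact: cg.
  by apply: continuousD; [exact: cst_continuous|exact: scalel_continuous].
- move=> s Ls; apply: sfg; exists i; rewrite !mxE v1 q0 mulr1 add0r.
  by apply: lt_le_trans Ls; rewrite ltr_pwDr// le_max lexx orbT.
Qed.

(** On each line in direction [j] the integral is the difference of two values outside the support.
    Direction [j] must be innermost, which dictates a different order of iterated integration for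
    each of the three directions. *)
Lemma integral_space_dx (f g : space R -> R) (L : R) j : continuous g ->
  (forall x : space R, (exists i, L < `|x 0 i|) -> f x = 0 /\ g x = 0) ->
  (forall x : space R, is_derive x (basis j) f (g x)) ->
  (\int[mu3]_x (g (vec3 x))%:E = 0)%E.
Proof.
move=> cg sfg dg; pose L' := Num.max 0 L.
have sL' (x : space R) : (exists i, L' < `|x 0 i|) -> g x = 0.
  by move=> [i Li]; apply: (sfg x _).2; exists i; apply: le_lt_trans Li; rewrite le_max lexx orbT.
have ig := space_integrable cg (fun x h => (sfg x h).2).
have ch : continuous (g \o @vec3 R).
  by move=> p; apply: continuous_comp; [exact: continuous_vec3|exact: cg].
have [M M0 hM] : exists2 M, 0 < M & forall p : X3, `|g (vec3 p)| <= M.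
  have [M M0 hM] := compact_continuous_bounded (@compact_cube _ L') ch.
  exists M => // p; have [/hM//|nK] := pselect (cube L' p).
  rewrite sL' ?normr0 ?ltW//; apply: contrapT => nL; apply: nK; apply/cubeP => i.
  by rewrite leNgt; apply/negP => Li; apply: nL; exists i.
(* Fubini gives integrable slices only for almost every [z]; boundedness and compact support give
   them for every [z]. *)
have i2 z : mu2.-integrable setT (fun w : R * R => (g (vec3 (w, z)))%:E).
  apply: (@bounded_support_integrable _ _ _ mu2 (`[- L', L']%classic `*` `[- L', L']%classic)).
  - by apply: measurableX.
  - exact: mu2_square_lty.
  - exact: (@measurable_fun_pair1 _ _ _ _ _ _ (g \o @vec3 R) z (continuous_measurable_X3 ch)).
  - by exists M.
  - move=> [x y] nK; apply: sL'; apply: contrapT => nL; apply: nK.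
    have h i : `|vec3 (x, y, z) 0 i| <= L'.
      by rewrite leNgt; apply/negP => Li; apply: nL; exists i.
    by have /cubeP[] := h.
have b1 : @basis R j 0 j = 1 by rewrite !mxE !eqxx.
have line (q : space R) : q 0 j = 0 -> (\int[mu]_s (g (q + s *: basis j))%:E = 0)%E.
  by move=> q0; exact: integral_line0 b1 q0 cg sfg dg.
case: j dg b1 line => -[|[|[|//]]] hj dg _ line.
- rewrite -(@integral21_prod_meas1 _ _ _ _ _ mu2 mu _ ig).
  apply: integral0_eq => z _; rewrite /fubini_G /=.
  rewrite -(@integral21_prod_meas1 _ _ _ _ _ mu mu _ (i2 z)).
  apply: integral0_eq => y _; rewrite /fubini_G /=.
  under eq_integral do rewrite vec3_line0 (bool_irrelevance isT hj).
  by apply: line; rewrite !mxE.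
- rewrite -(@integral21_prod_meas1 _ _ _ _ _ mu2 mu _ ig).
  apply: integral0_eq => z _; rewrite /fubini_G /=.
  rewrite -(@integral12_prod_meas1 _ _ _ _ _ mu mu _ (i2 z)).
  apply: integral0_eq => x _; rewrite /fubini_F /=.
  under eq_integral do rewrite vec3_line1 (bool_irrelevance isT hj).
  by apply: line; rewrite !mxE.
- rewrite -(@integral12_prod_meas1 _ _ _ _ _ mu2 mu _ ig).
  apply: integral0_eq => -[x y] _; rewrite /fubini_F /=.
  under eq_integral do rewrite vec3_line2 (bool_irrelevance isT hj).
  by apply: line; rewrite !mxE.
Qed.

Lemma is_derive_slice_x (F : spacetime R -> R) t x j d :
  is_derive (t, x) (dir_x j) F d <-> is_derive x (basis j) (fun y => F (t, y)) d.
Proof.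
have E : (fun h : R => h^-1 *: ((F \o shift (t, x)) (h *: dir_x j) - F (t, x))) =
    (fun h : R => h^-1 *: (((fun y => F (t, y)) \o shift x) (h *: basis j) - F (t, x))).
  apply/funext => h /=; congr (_ *: (F _ - _)).
  by apply/eqP; rewrite xpair_eqE /= scaler0 add0r !eqxx.
split=> -[h1 h2]; apply: DeriveDef.
- by move: h1; rewrite /derivable E.
- by move: h2; rewrite /derive E.
- by move: h1; rewrite /derivable -E.
- by move: h2; rewrite /derive -E.
Qed.

Lemma is_derive_slice_t (F : spacetime R -> R) t x d :
  is_derive (t, x) (@dir_t R) F d <-> is_derive t 1 (fun s => F (s, x)) d.
Proof.
have E : (fun h : R => h^-1 *: ((F \o shift (t, x)) (h *: @dir_t R) - F (t, x))) =
    (fun h : R => h^-1 *: (((fun s => F (s, x)) \o shift t) (h *: 1) - F (t, x))).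
  apply/funext => h /=; congr (_ *: (F _ - _)).
  by apply/eqP; rewrite xpair_eqE /= scaler0 add0r !eqxx.
split=> -[h1 h2]; apply: DeriveDef.
- by move: h1; rewrite /derivable E.
- by move: h2; rewrite /derive E.
- by move: h1; rewrite /derivable -E.
- by move: h2; rewrite /derive -E.
Qed.

Lemma slab_int_dx (T L : R) (F G : spacetime R -> R) j : 0 < T ->
  slab_cts T G -> x_supp T L F -> x_supp T L G ->
  (forall p, open_slab T p -> is_derive p (dir_x j) F (G p)) ->
  slab_int T G = 0.
Proof.
move=> T0 cG sF sG dF.
rewrite /slab_int /Rintegral integral_mkcond.
have iG := slab_integrable T0 cG sG.
have {}iG := (integrable_mkcond _ (measurable_slab4 T)).1 iG.
rewrite -(@integral12_prod_meas1 _ _ _ _ _ mu mu3 _ iG) integral0_eq// => t _.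
rewrite /fubini_F.
have [tT|ntT] := pselect (0 < t < T); last first.
  by apply: integral0_eq => y _; rewrite patchE; case: ifPn => //; rewrite inE.
have tT' : 0 <= t <= T by case/andP: tT => /ltW -> /ltW ->.
rewrite -[RHS](@integral_space_dx (fun x => F (t, x)) (fun x => G (t, x)) L j).
- by apply: eq_integral => y _; rewrite patchE; case: ifPn => //; rewrite notin_setE.
- have -> : (fun x => G (t, x)) = (G \o clamp_time T) \o (fun x => (t, x)).
    by apply/funext => y /=; rewrite /clamp_time/= clamp_id.
  move=> x; apply: continuous_comp; last exact: cG.
  by apply: continuous_pair => z; [exact: cst_continuous|exact: cvg_id].
- by move=> x hx; rewrite sF ?sG.
- by move=> x; apply: (is_derive_slice_x _ _ _ _ _).1; exact: dF.
Qed.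

End slab_integrals_dx.

(** * Smooth bump functions *)

Section smooth_bumps.
Context {R : realType}.

Lemma is_derive_comp1 (V : normedModType R) (f : V -> R) (g : R -> R) (x v : V) (df dg : R) :
  is_derive x v f df -> is_derive (f x) 1 g dg -> is_derive x v (g \o f) (dg * df).
Proof.
move=> hf hg; have x0 : x = x + 0 *: v by rewrite scale0r addr0.
rewrite x0; apply/is_derive_line.
move: hf hg; rewrite {1 2}x0 => /is_derive_line hf hg.
exact: is_derive1_comp.
Qed.

(* [expR (- s^-1)] times a polynomial in [s^-1], extended by 0 to [s <= 0]: a family
   of functions closed under differentiation. *)
Definition flat (p : {poly R}) (s : R) : R :=
  if 0 < s then p.[s^-1] * expR (- s^-1) else 0.

Lemma flat_ge0 s : 0 <= flat 1 s.
Proof. by rewrite /flat; case: ifP => // _; rewrite hornerC mul1r expR_ge0. Qed.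

Lemma flat_gt0 s : 0 < s -> 0 < flat 1 s.
Proof. by move=> s0; rewrite /flat s0 hornerC mul1r expR_gt0. Qed.

Lemma flat_eq0 p s : s <= 0 -> flat p s = 0.
Proof. by rewrite /flat ltNge => ->. Qed.

(** The exponential dominates the term of its series of degree [size q + 1], hence beats [q] by a
    further factor [y]. The rate [C / y] becomes [C * h] at [y = h^-1], as the difference quotient
    at 0 requires. *)
Lemma horner_expR_bound (q : {poly R}) :
  exists2 C, 0 <= C & forall y, 1 <= y -> `|q.[y] * expR (- y)| <= C / y.
Proof.
pose n := size q; pose A := \sum_(i < n) `|q`_i|.
have A0 : 0 <= A by apply: sumr_ge0.
exists (A * n.+1`!%:R) => [|y y1]; first by rewrite mulr_ge0.
have y0 : 0 < y by exact: lt_le_trans y1.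
have hq : `|q.[y]| <= A * y ^+ n.
  rewrite horner_coef mulr_suml; apply: le_trans (ler_norm_sum _ _ _) _.
  apply: ler_sum => i _; rewrite normrM ler_wpM2l// normrX ger0_norm ?(ltW y0)//.
  by apply: ler_weXn2l => //; exact: ltnW.
have he : y ^+ n.+1 / n.+1`!%:R <= expR y.
  by apply: (le_trans _) (expR_ge1Dxn n (ltW y0)); rewrite lerDr.
rewrite normrM (ger0_norm (expR_ge0 _)) expRN ler_pdivrMr ?expR_gt0//.
apply: le_trans hq _; rewrite -mulrA -mulrA ler_wpM2l//.
have -> : y ^+ n = n.+1`!%:R * (y^-1 * (y ^+ n.+1 / n.+1`!%:R)).
  have F0 : n.+1`!%:R != 0 :> R by rewrite pnatr_eq0 -lt0n fact_gt0.
  by rewrite exprS -mulrA mulKf ?gt_eqF// mulrC mulfVK.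
by rewrite ler_wpM2l// ler_wpM2l// invr_ge0 ltW.
Qed.

(** The chain rule in the variable [s^-1]: the factor [s^-2] contributes ['X^2], and the signs of
    the derivatives of [s^-1] and of [- s^-1] give [p - p']. *)
Definition flat_deriv (p : {poly R}) : {poly R} := 'X^2 * (p - p^`()).

Lemma is_derive_flat p (s : R) : is_derive s 1 (flat p) (flat (flat_deriv p) s).
Proof.
have [s0|s0|->] := ltgtP s 0.
- rewrite flat_eq0 ?ltW//; apply: (@near_eq_is_derive R R R (cst 0) (flat p)).
  by near=> r; rewrite flat_eq0// ltW//; near: r; exact: lt_nbhsl.
- have -> : flat (flat_deriv p) s = (- s ^- 2 * p^`().[s^-1]) * expR (- s^-1) +
      p.[s^-1] * (expR (- s^-1) * s ^- 2).
    rewrite /flat s0 /flat_deriv hornerM hornerXn hornerD hornerN exprVn; ring.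
  apply: (@near_eq_is_derive R R R (fun r => p.[r^-1] * expR (- r^-1))).
    near=> r; rewrite /flat ifT//; near: r; exact: lt_nbhsr.
  have s00 : s != 0 by rewrite gt_eqF.
  have dV : is_derive s 1 (fun r : R => r^-1) (- s ^- 2).
    have := @is_deriveV R id s 1 1 s00 (is_derive_id s 1).
    by rewrite [X in is_derive _ _ _ X]mulr1.
  have dp := @is_derive_comp1 R _ _ s 1 _ _ dV (is_derive_poly p s^-1).
  have dN : is_derive s 1 (fun r : R => - r^-1) (s ^- 2).
    by have := is_deriveN dV; rewrite opprK.
  have de := @is_derive_comp1 R _ _ s 1 _ _ dN (is_derive_expR (- s^-1)).
  refine (is_derive_eq (is_deriveM dp de) _).
  by rewrite /= /GRing.scale /=; ring.
- rewrite flat_eq0//.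
  (* Division by [h] multiplies the polynomial in [h^-1] by ['X], so the bound is taken for
     ['X * p]. *)
  have [C C0 hC] := horner_expR_bound ('X * p).
  have cv : (fun h : R => h^-1 *: ((flat p \o shift 0) (h *: 1) - flat p 0)) @ 0^' --> 0.
    apply/cvgr0Pnorm_le => e e0; near=> h.
    rewrite /= addr0 [h *: 1]mulr1 [flat p 0]flat_eq0// subr0.
    have [h0|h0] := leP h 0; first by rewrite flat_eq0// scaler0 normr0 ltW.
    have h1 : h <= 1.
      by apply: le_trans (ler_norm _) _; near: h; apply: dnbhs0_le.
    have hC1 : C * h <= e.
      have hC1 : `|h| <= e / (C + 1) by near: h; apply: dnbhs0_le; rewrite divr_gt0// ltr_wpDl.
      apply: le_trans (_ : (C + 1) * h <= e); first by rewrite ler_wpM2r ?(ltW h0)// lerDl.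
      by rewrite mulrC -ler_pdivlMr ?ltr_wpDl// (le_trans (ler_norm _)).
    apply: le_trans hC1; have -> : C * h = C / h^-1 by rewrite invrK.
    apply: le_trans (hC h^-1 _); last by rewrite invf_ge1.
    by rewrite /flat h0 hornerM hornerX /GRing.scale /= mulrA.
  by apply: DeriveDef; [apply/cvg_ex; exists 0|apply: cvg_lim].
Unshelve. all: by end_near.
Qed.

Lemma continuous_flat p : continuous (flat p).
Proof.
by move=> s; apply: differentiable_continuous; apply/derivable1_diffP; case: (is_derive_flat p s).
Qed.

(* The algebra generated by the flat functions of the continuous linear forms is
   stable under every directional derivative. *)
Inductive flat_algebra (V : normedModType R) : (V -> R) -> Prop :=
| flat_algebra_gen p (l : V -> R) a : continuous l -> (forall x v, is_derive x v l (l v)) ->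
    flat_algebra (fun x => flat p (l x + a))
| flat_algebra_cst a : flat_algebra (fun=> a)
| flat_algebra_add f g : flat_algebra f -> flat_algebra g ->
    flat_algebra (fun x => f x + g x)
| flat_algebra_mul f g : flat_algebra f -> flat_algebra g ->
    flat_algebra (fun x => f x * g x).

Lemma flat_algebra_continuous (V : normedModType R) (f : V -> R) :
  flat_algebra f -> continuous f.
Proof.
elim=> {f} [p l a cl dl|a|f g _ cf _ cg|f g _ cf _ cg] x.
- apply: (@continuous_comp _ _ _ (fun x => l x + a) (flat p)); last exact: continuous_flat.
  by apply: continuousD; [exact: cl|exact: cst_continuous].
- exact: cst_continuous.
- by apply: continuousD; [exact: cf|exact: cg].
- by apply: continuousM; [exact: cf|exact: cg].
Qed.

Lemma flat_algebra_derive (V : normedModType R) (f : V -> R) (v : V) :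
  flat_algebra f -> exists2 g, flat_algebra g & forall x, is_derive x v f (g x).
Proof.
elim=> {f} [p l a cl dl|a|f g hf [f' hf' df] hg [g' hg' dg]|f g hf [f' hf' df] hg [g' hg' dg]].
- exists (fun x => flat (flat_deriv p) (l x + a) * l v).
    by apply: flat_algebra_mul; [exact: flat_algebra_gen|exact: flat_algebra_cst].
  move=> x; apply: (@is_derive_comp1 _ (fun x => l x + a) (flat p)); last exact: is_derive_flat.
  by have := is_deriveD (dl x v) (is_derive_cst a x v); rewrite addr0.
- exists (fun=> 0); first exact: flat_algebra_cst.
  by move=> x; exact: is_derive_cst.
- exists (fun x => f' x + g' x); first exact: flat_algebra_add.
  by move=> x; exact: is_deriveD (df x) (dg x).
- exists (fun x => f x * g' x + g x * f' x).
    by apply: flat_algebra_add; exact: flat_algebra_mul.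
  by move=> x; exact: is_deriveM (df x) (dg x).
Qed.

Lemma flat_algebra_smooth (V : normedModType R) (f : V -> R) :
  flat_algebra f -> smooth f.
Proof.
move=> hf s; set h := foldr _ f s.
have {}hh : flat_algebra h.
  rewrite /h; elim: s {h} => //= v s /(flat_algebra_derive v)[g hg dg].
  set F := (X in flat_algebra X); rewrite (_ : F = g)//.
  by apply/funext => x; rewrite /F; case: (dg x).
split; first exact: flat_algebra_continuous.
by move=> x v; have [g _ /(_ x) []] := flat_algebra_derive v hh.
Qed.

Definition bump (a d s : R) : R := flat 1 (s - a + d) * flat 1 (a + d - s).

Lemma bump_ge0 a d s : 0 <= bump a d s.
Proof. by rewrite mulr_ge0// flat_ge0. Qed.

Lemma bump_gt0 a d s : `|s - a| < d -> 0 < bump a d s.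
Proof. by rewrite ltr_norml => /andP[h1 h2]; rewrite mulr_gt0// flat_gt0//; lra. Qed.

Lemma bump_eq0 a d s : d <= `|s - a| -> bump a d s = 0.
Proof.
rewrite ler_normr => /orP[h|h]; rewrite /bump.
- by rewrite [X in _ * X]flat_eq0 ?mulr0//; lra.
- by rewrite flat_eq0 ?mul0r//; lra.
Qed.

Definition box_bump (p0 : spacetime R) (d : R) (p : spacetime R) : R :=
  bump p0.1 d p.1 * \prod_(i < 3) bump (p0.2 0 i) d (p.2 0 i).

Lemma is_derive_dual (V : normedModType R) (l : V -> R) :
  (forall (h : R) v x, l (h *: v + x) = h * l v + l x) ->
  forall x v, is_derive x v l (l v).
Proof.
move=> ll x v.
have cv : (fun h : R => h^-1 *: ((l \o shift x) (h *: v) - l x)) @ 0^' --> l v.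
  apply: (@cvg_trans _ ((fun=> l v) @ 0^')); last exact: cvg_cst.
  apply: near_eq_cvg; near=> h; rewrite /= ll addrK /GRing.scale /= mulrA mulVf ?mul1r//.
  by near: h; exact: nbhs_dnbhs_neq.
by apply: DeriveDef; [apply/cvg_ex; exists (l v)|apply: cvg_lim].
Unshelve. all: by end_near.
Qed.

Lemma box_bump_smooth p0 d : smooth (box_bump p0 d).
Proof.
apply: flat_algebra_smooth.
have gen (l : spacetime R -> R) a e : continuous l ->
    (forall (h : R) v x, l (h *: v + x) = h * l v + l x) ->
    flat_algebra (fun p => bump a e (l p)).
  move=> cl ll; apply: flat_algebra_mul.
    have -> : (fun p => flat 1 (l p - a + e)) = (fun p => flat 1 (l p + (e - a))).
      by apply/funext => p; congr flat; ring.
    by apply: flat_algebra_gen => // x v; exact: is_derive_dual.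
  have -> : (fun p => flat 1 (a + e - l p)) = (fun p => flat 1 (- l p + (a + e))).
    by apply/funext => p; congr flat; ring.
  apply: (@flat_algebra_gen _ 1 (fun p => - l p)).
    by move=> p; apply: continuousN; exact: cl.
  by move=> x v; apply: is_derive_dual => h w y; rewrite ll; ring.
rewrite /box_bump; apply: flat_algebra_mul; first by apply: gen => // p; exact: cvg_fst.
have hi i : flat_algebra (fun p : spacetime R => bump (p0.2 0 i) d (p.2 0 i)).
  apply: (gen (fun p => p.2 0 i)) => [p|h v x]; last by rewrite /= !mxE.
  apply: (@continuous_comp _ _ _ snd (fun x : space R => x 0 i)); first exact: cvg_snd.
  exact: coord_continuous.
have -> : (fun p : spacetime R => \prod_(i < 3) bump (p0.2 0 i) d (p.2 0 i)) =
    (fun p => bump (p0.2 0 0) d (p.2 0 0) * (bump (p0.2 0 1) d (p.2 0 1) *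
       bump (p0.2 0 2) d (p.2 0 2))).
  apply/funext => p; rewrite !big_ord_recl big_ord0 mulr1.
  have -> : lift ord0 (lift ord0 ord0) = 2 :> 'I_3 by exact: val_inj.
  by have -> : lift ord0 ord0 = 1 :> 'I_3 by exact: val_inj.
apply: flat_algebra_mul; first exact: hi.
by apply: flat_algebra_mul; exact: hi.
Qed.

Definition box (p0 : spacetime R) (d : R) : set (spacetime R) :=
  `[p0.1 - d, p0.1 + d] `*` [set x : space R | forall i, `[p0.2 0 i - d, p0.2 0 i + d]%classic (x 0 i)].

Lemma boxP p0 d p : box p0 d p <-> `|p.1 - p0.1| <= d /\ forall i, `|p.2 0 i - p0.2 0 i| <= d.
Proof.
rewrite /box /= in_itv /= -ler_distl; split=> -[h1 h2]; split=> // i.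
  by have := h2 i; rewrite /= in_itv /= -ler_distl.
by rewrite /= in_itv /= -ler_distl.
Qed.

Lemma compact_box p0 d : compact (box p0 d).
Proof.
apply: compact_setX; first exact: segment_compact.
by apply: (@rV_compact R 3 (fun i => `[p0.2 0 i - d, p0.2 0 i + d]%classic)) => i; exact: segment_compact.
Qed.

Lemma box_bump_eq0 p0 d p : ~ box p0 d p -> box_bump p0 d p = 0.
Proof.
move=> nb; rewrite /box_bump.
have [h|/bump_eq0 ->] := ltP `|p.1 - p0.1| d; last by rewrite mul0r.
have [/forallP h2|/existsP[i]] := boolP [forall i : 'I_3, `|p.2 0 i - p0.2 0 i| < d].
  by exfalso; apply: nb; apply/boxP; split; [exact: ltW|move=> i; exact: ltW].
rewrite -leNgt => /bump_eq0 hi; rewrite (bigD1 i)//= hi; ring.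
Qed.

Lemma box_bump_ge0 p0 d p : 0 <= box_bump p0 d p.
Proof. by rewrite mulr_ge0 ?bump_ge0// prodr_ge0// => i _; exact: bump_ge0. Qed.

Lemma box_bump_gt0 p0 d : 0 < d -> 0 < box_bump p0 d p0.
Proof.
by move=> d0; rewrite mulr_gt0 ?prodr_gt0// => [|i _]; rewrite bump_gt0// subrr normr0.
Qed.

Lemma box_bump_test (T : R) p0 d : 0 < d -> d < p0.1 -> p0.1 + d < T ->
  test_function T (box_bump p0 d).
Proof.
move=> d0 d1 d2.
have sb : closure [set p | box_bump p0 d p != 0] `<=` box p0 d.
  have /closure_id -> : closed (box p0 d).
    by apply: compact_closed; [exact: norm_hausdorff|exact: compact_box].
  apply: closureS => p /= /eqP; apply: contra_notP; exact: box_bump_eq0.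
split; first exact: box_bump_smooth.
- by apply: subclosed_compact sb; [exact: closed_closure|exact: compact_box].
- by move=> p /sb /boxP[+ _]; rewrite /open_slab /= ler_distl => /andP[h1 h2]; lra.
Qed.

End smooth_bumps.

(** * From the weak to the pointwise equations *)

Section slab_functions.
Context {R : realType}.
Notation mu := (@lebesgue_measure R).
Variables (T : R) (T0 : 0 < T).
Implicit Types f g : spacetime R -> R.

Lemma slab_cts_continuous f : continuous f -> slab_cts T f.
Proof.
by move=> cf p; apply: continuous_comp; [exact: continuous_clamp_time|exact: cf].
Qed.

Lemma slab_cts_within f : {within slab T, continuous f} -> slab_cts T f.
Proof.
move=> /subspace_continuousP cf p.
have sp q : slab T (clamp_time T q) by exact: clamp_slab (ltW T0).
apply: cvg_trans (cf _ (sp p)) => A /= nA.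
have H : nbhs p [set q | slab T (clamp_time T q) -> A (f (clamp_time T q))].
  exact: (continuous_clamp_time nA).
by apply: filterS H => q /(_ (sp q)).
Qed.

Lemma slab_cts_cst (a : R) : slab_cts T (fun=> a).
Proof. by apply: slab_cts_continuous => p; exact: cst_continuous. Qed.

Lemma slab_ctsD f g : slab_cts T f -> slab_cts T g -> slab_cts T (fun p => f p + g p).
Proof. by move=> cf cg p; apply: continuousD; [exact: cf|exact: cg]. Qed.

Lemma slab_ctsM f g : slab_cts T f -> slab_cts T g -> slab_cts T (fun p => f p * g p).
Proof. by move=> cf cg p; apply: continuousM; [exact: cf|exact: cg]. Qed.

Lemma slab_ctsN f : slab_cts T f -> slab_cts T (fun p => - f p).
Proof. by move=> cf p; apply: continuousN; exact: cf. Qed.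

Lemma slab_cts_sum n (f : 'I_n -> spacetime R -> R) :
  (forall i, slab_cts T (f i)) -> slab_cts T (fun p => \sum_(i < n) f i p).
Proof.
elim: n f => [f _|n IH f cf].
  by rewrite (_ : (fun _ => _) = cst 0); [exact: slab_cts_cst|apply/funext => p; rewrite big_ord0].
rewrite (_ : (fun _ => _) = (fun p => \sum_(i < n) f (widen_ord (leqnSn n) i) p + f ord_max p)).
  by apply: slab_ctsD => //; apply: IH.
by apply/funext => p; rewrite big_ord_recr.
Qed.

Lemma slab_ctsV f : slab_cts T f -> (forall p, slab T p -> f p != 0) ->
  slab_cts T (fun p => (f p)^-1).
Proof.
move=> cf f0 p; apply: cvgV; last exact: cf.
by apply: f0; exact: clamp_slab (ltW T0).
Qed.

Lemma slab_ctsX f n : slab_cts T f -> slab_cts T (fun p => f p ^+ n).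
Proof. by move=> cf p; apply: (@continuous_comp _ _ _ (f \o clamp_time T) (fun x => x ^+ n)); [exact: cf|exact: exprn_continuous]. Qed.

Lemma x_suppD L f g : x_supp T L f -> x_supp T L g -> x_supp T L (fun p => f p + g p).
Proof. by move=> sf sg t x ht hx; rewrite sf// sg// addr0. Qed.

Lemma x_suppMr L f g : x_supp T L g -> x_supp T L (fun p => f p * g p).
Proof. by move=> sg t x ht hx; rewrite sg// mulr0. Qed.

Lemma x_suppMl L f g : x_supp T L f -> x_supp T L (fun p => f p * g p).
Proof. by move=> sf t x ht hx; rewrite sf// mul0r. Qed.

Lemma x_supp_sum L n (f : 'I_n -> spacetime R -> R) :
  (forall i, x_supp T L (f i)) -> x_supp T L (fun p => \sum_(i < n) f i p).
Proof. by move=> sf t x ht hx; rewrite big1// => i _; exact: sf. Qed.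

Lemma slab_intD L f g : slab_cts T f -> x_supp T L f -> slab_cts T g -> x_supp T L g ->
  slab_int T (fun p => f p + g p) = slab_int T f + slab_int T g.
Proof.
move=> cf sf cg sg; rewrite /slab_int RintegralD//; first exact: measurable_slab4.
  exact: slab_integrable T0 cf sf.
exact: slab_integrable T0 cg sg.
Qed.

Lemma slab_intZ L f a : slab_cts T f -> x_supp T L f ->
  slab_int T (fun p => a * f p) = a * slab_int T f.
Proof.
move=> cf sf; rewrite /slab_int RintegralZl//; first exact: measurable_slab4.
exact: slab_integrable T0 cf sf.
Qed.

Lemma slab_int_sum L n (f : 'I_n -> spacetime R -> R) :
  (forall i, slab_cts T (f i)) -> (forall i, x_supp T L (f i)) ->
  slab_int T (fun p => \sum_(i < n) f i p) = \sum_(i < n) slab_int T (f i).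
Proof.
elim: n f => [f _ _|n IH f cf sf].
  rewrite big_ord0 /slab_int (_ : (fun _ => _) = cst 0); last first.
    by apply/funext => p; rewrite /= big_ord0.
  by rewrite Rintegral_cst ?mul0r//; exact: measurable_slab4.
rewrite (_ : (fun _ => _) = (fun p => \sum_(i < n) f (widen_ord (leqnSn n) i) p + f ord_max p)).
  rewrite (@slab_intD L)//; [|exact: slab_cts_sum|exact: x_supp_sum].
  by rewrite IH// big_ord_recr.
by apply/funext => p; rewrite big_ord_recr.
Qed.

Lemma slab_int_eq f g : (forall p, open_slab T p -> f p = g p) -> slab_int T f = slab_int T g.
Proof. by move=> fg; apply: eq_Rintegral => p; rewrite inE => /fg. Qed.

Lemma slab_int_le L f g : slab_cts T f -> x_supp T L f -> slab_cts T g -> x_supp T L g ->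
  (forall p, open_slab T p -> f p <= g p) -> slab_int T f <= slab_int T g.
Proof.
move=> cf sf cg sg fg; apply: le_Rintegral => //; first exact: measurable_slab4.
- exact: slab_integrable T0 cf sf.
- exact: slab_integrable T0 cg sg.
- by move=> p; exact: fg.
Qed.

Lemma mu_oo (a e : R) : 0 < e -> mu `]a - e, a + e[%classic = (e *+ 2)%:E.
Proof.
move=> e0; rewrite lebesgue_measure_itv/= lte_fin ifT; last lra.
by rewrite -EFinD; congr EFin; ring.
Qed.

Lemma mu4_oo (t a b c e : R) : 0 < e ->
  mu4 (`]t - e, t + e[%classic `*`
    (`]a - e, a + e[%classic `*` `]b - e, b + e[%classic `*` `]c - e, c + e[%classic))
  = ((e *+ 2) ^+ 4)%:E.
Proof.
move=> e0; pose I a : set R := `]a - e, a + e[%classic.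
have mI x : measurable (I x) by exact: measurable_itv.
have -> : mu4 (I t `*` (I a `*` I b `*` I c)) = (mu (I t) * mu3 (I a `*` I b `*` I c))%E.
  exact: (product_measure1E mu mu3 (mI t) (measurableX (measurableX (mI a) (mI b)) (mI c))).
have -> : mu3 (I a `*` I b `*` I c) = (mu2 (I a `*` I b) * mu (I c))%E.
  exact: (product_measure1E mu2 mu (measurableX (mI a) (mI b)) (mI c)).
have -> : mu2 (I a `*` I b) = (mu (I a) * mu (I b))%E.
  exact: (product_measure1E mu mu (mI a) (mI b)).
by rewrite !mu_oo// -!EFinM -expr2 -exprSr -exprS.
Qed.

(** By continuity [f] exceeds [f p0 / 2] on an open box around [p0], whose measure is [(2 e)^4]. *)
Lemma slab_int_gt0 L f p0 : slab_cts T f -> x_supp T L f ->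
  (forall p, open_slab T p -> 0 <= f p) -> open_slab T p0 -> 0 < f p0 ->
  0 < slab_int T f.
Proof.
move=> cf sf f0 sp0 fp0.
have cl_id p : open_slab T p -> clamp_time T p = p.
  case: p => t x /= /andP[h1 h2]; rewrite /clamp_time /= clamp_id//.
  by rewrite (ltW h1) (ltW h2).
have : \forall p \near p0, f p0 / 2 < (f \o clamp_time T) p.
  have H : nbhs ((f \o clamp_time T) p0) [set y | f p0 / 2 < y].
    by apply: lt_nbhsr; rewrite /= cl_id//; lra.
  exact: (cf p0 _ H).
move=> /nbhs_ballP[e1 /= e10 he1].
have [h1 h2] := andP sp0.
pose e := Num.min e1 (Num.min p0.1 (T - p0.1)).
have e0 : 0 < e by rewrite !lt_min e10 h1 subr_gt0.
have ee1 : e <= e1 by rewrite ge_min lexx.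
have et : e <= p0.1 by rewrite !ge_min lexx orbT.
have eT : e <= T - p0.1 by rewrite !ge_min lexx !orbT.
pose S := `]p0.1 - e, p0.1 + e[%classic `*`
    (`]p0.2 0 0 - e, p0.2 0 0 + e[%classic `*` `]p0.2 0 1 - e, p0.2 0 1 + e[%classic
     `*` `]p0.2 0 2 - e, p0.2 0 2 + e[%classic).
have mS : measurable S by do ?apply: measurableX.
have SS : S `<=` slab4 T.
  move=> q [/= + _]; rewrite in_itv/= => /andP[q1 q2]; rewrite /slab4 /open_slab /=.
  by apply/andP; split; [apply: le_lt_trans q1|apply: lt_le_trans q2 _]; lra.
have Sb q : S q -> f p0 / 2 <= f (point4 q).
  move=> Sq; have := SS _ Sq => /cl_id <-; apply/ltW/he1.
  case: Sq => /= + [[/= + +] /= +]; rewrite !in_itv /= => q0 qa qb qc.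
  have hh a b : a - e < b < a + e -> `|a - b| < e1.
    by rewrite -ltr_distl distrC => /lt_le_trans; apply.
  split; first exact: hh.
  split => // i j; rewrite ord1 mxE /ball /=.
  case: j => -[|[|[|//]]] hj /=; apply: hh.
  - by have -> : Ordinal hj = 0 by exact: val_inj.
  - by have -> : Ordinal hj = 1 by exact: val_inj.
  - by have -> : Ordinal hj = 2 by exact: val_inj.
have : 0 < f p0 / 2 * (e *+ 2) ^+ 4 by rewrite mulr_gt0 ?exprn_gt0 ?mulrn_wgt0 ?divr_gt0.
move=> /lt_le_trans; apply.
have <- : \int[mu4]_(q in S) (f p0 / 2) = f p0 / 2 * (e *+ 2) ^+ 4.
  by rewrite Rintegral_cst// [X in fine X](mu4_oo _ _ _ _ e0).
rewrite -(setIidr SS) Rintegral_mkcondr.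
apply: le_Rintegral; first exact: measurable_slab4.
- have iS : mu4.-integrable setT (EFin \o (cst (f p0 / 2) \_ S)).
    apply: (@bounded_support_integrable _ _ _ mu4 S).
    + exact: mS.
    + by have := ltry ((e *+ 2) ^+ 4); rewrite -(mu4_oo p0.1 (p0.2 0 0) (p0.2 0 1) (p0.2 0 2) e0).
    + by apply/(measurable_restrictT _ mS); exact: measurable_cst.
    + by exists (`|f p0 / 2|) => q Sq; rewrite patchE mem_set.
    + by move=> q nS; rewrite patchE memNset.
  by apply: integrableS iS => //; exact: measurable_slab4.
- exact: slab_integrable T0 cf sf.
- move=> q hq; rewrite patchE; case: ifPn => [|_]; last exact: f0.
  by rewrite inE; exact: Sb.
Qed.

(** Serves the static case, where a constant loss must be charged only to a fixed cube and not to
    the whole space. *)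
Lemma slab_int_le_box L f (a B : R) : slab_cts T f -> x_supp T L f -> 0 <= a -> 0 <= B ->
  (forall p, open_slab T p -> (forall i, `|p.2 0 i| <= B) -> f p <= a) ->
  (forall p, open_slab T p -> ~ (forall i, `|p.2 0 i| <= B) -> f p <= 0) ->
  slab_int T f <= a * (T * (B *+ 2) ^+ 3).
Proof.
move=> cf sf a0 B0 fa f0; pose S := `]0, T[%classic `*` cube B.
have mS : measurable S by apply: measurableX => //; exact: measurable_cube.
have SS : S `<=` slab4 T by move=> q [/= + _]; rewrite in_itv.
have mu4S : mu4 S = (T * (B *+ 2) ^+ 3)%:E by rewrite mu4_box ?subr0// ltW.
have <- : \int[mu4]_(q in S) a = a * (T * (B *+ 2) ^+ 3).
  by rewrite Rintegral_cst// [X in fine X]mu4S.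
rewrite -(setIidr SS) Rintegral_mkcondr.
apply: le_Rintegral; first exact: measurable_slab4.
- exact: slab_integrable T0 cf sf.
- have iS : mu4.-integrable setT (EFin \o (cst a \_ S)).
    apply: (@bounded_support_integrable _ _ _ mu4 S).
    + exact: mS.
    + by have := ltry (T * (B *+ 2) ^+ 3); rewrite -mu4S.
    + by apply/(measurable_restrictT _ mS); exact: measurable_cst.
    + by exists `|a| => q Sq; rewrite patchE mem_set.
    + by move=> q nS; rewrite patchE memNset.
  by apply: integrableS iS => //; exact: measurable_slab4.
- move=> q hq; rewrite patchE; case: ifPn => [|/negP nq].
    by rewrite inE => -[_ /cubeP hB]; exact: (fa (point4 q) hq hB).
  apply: (f0 (point4 q) hq) => hB; apply: nq; rewrite inE; split; last exact/cubeP.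
  by rewrite /= in_itv.
Qed.

Lemma slab_cts_at f t : slab_cts T f -> 0 <= t <= T -> continuous (fun x => f (t, x)).
Proof.
move=> cf ht x; have -> : (fun x => f (t, x)) = (f \o clamp_time T) \o (fun x => (t, x)).
  by apply/funext => y /=; rewrite /clamp_time/= clamp_id.
apply: continuous_comp; last exact: cf.
by apply: continuous_pair => z; [exact: cst_continuous|exact: cvg_id].
Qed.

End slab_functions.

Section weak_equation.
Context {R : realType}.
Variables (T : R) (T0 : 0 < T).

Lemma derive_near0 (V : normedModType R) (f : V -> R) (x v : V) :
  (\forall y \near x, f y = 0) -> 'D_v f x = 0.
Proof.
move=> f0; have : is_derive x v f 0.
  apply: (@near_eq_is_derive _ _ _ (cst 0)).
  by apply: filterS f0 => y ->.
by case.
Qed.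

Lemma near_norm_coord_gt (L : R) (p : spacetime R) i :
  L < `|p.2 0 i| -> \forall q \near p, L < `|(q : spacetime R).2 0 i|.
Proof.
move=> Lp.
have c : continuous (fun q : spacetime R => `|q.2 0 i|).
  move=> q; apply: (@continuous_comp _ _ _ (fun q : spacetime R => q.2 0 i) Num.norm).
    apply: (@continuous_comp _ _ _ snd (fun x : space R => x 0 i)); first exact: cvg_snd.
    exact: coord_continuous.
  exact: norm_continuous.
have H : nbhs `|p.2 0 i| [set y | L < y] by exact: lt_nbhsr.
exact: (c p _ H).
Qed.

Lemma slab_int_div (L : R) (F0 G0 : spacetime R -> R) (F G : 'I_3 -> spacetime R -> R) :
  slab_cts T F0 -> slab_cts T G0 -> (forall j, slab_cts T (G j)) ->
  x_supp T L F0 -> x_supp T L G0 -> (forall j, x_supp T L (F j)) -> (forall j, x_supp T L (G j)) ->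
  (forall p, open_slab T p -> is_derive p (@dir_t R) F0 (G0 p)) ->
  (forall j p, open_slab T p -> is_derive p (dir_x j) (F j) (G j p)) ->
  slab_int T (fun p => G0 p + \sum_(j < 3) G j p) =
  space_int (fun x => F0 (T, x)) - space_int (fun x => F0 (0, x)).
Proof.
move=> cF0 cG0 cG sF0 sG0 sF sG d0 dj.
rewrite (@slab_intD _ _ T0 L)//; [|exact: slab_cts_sum|exact: x_supp_sum].
rewrite (@slab_int_sum _ _ T0 L)//.
rewrite (slab_int_dt T0 cF0 cG0 sF0 sG0 d0).
rewrite big1 ?addr0// => j _.
exact: (slab_int_dx T0 (cG j) (sF j) (sG j) (dj j)).
Qed.

Section localization.
Variables (F0 G0 : spacetime R -> R) (F G : 'I_3 -> spacetime R -> R).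
Hypotheses (cF0 : slab_cts T F0) (cG0 : slab_cts T G0)
  (cF : forall j, slab_cts T (F j)) (cG : forall j, slab_cts T (G j))
  (d0 : forall p, open_slab T p -> is_derive p (@dir_t R) F0 (G0 p))
  (dj : forall j p, open_slab T p -> is_derive p (dir_x j) (F j) (G j p))
  (weak : forall phi, test_function T phi ->
    integral_spacetime (open_slab T) (fun p => F0 p * 'D_(@dir_t R) phi p
      + \sum_(j < 3) F j p * dx j phi p) = 0%E).
Let g p := G0 p + \sum_(j < 3) G j p.

Lemma box_bump_far (p0 : spacetime R) (d t : R) (x : space R) i :
  \sum_i `|p0.2 0 i| + d < `|x 0 i| -> box_bump p0 d (t, x) = 0.
Proof.
move=> Lp; apply: box_bump_eq0 => /boxP[_ /(_ i) /=]; apply/negP; rewrite -ltNge.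
have h : `|p0.2 0 i| <= \sum_i `|p0.2 0 i| by rewrite (bigD1 i)//= lerDl sumr_ge0.
by have := ler_normD (x 0 i - p0.2 0 i) (p0.2 0 i); rewrite subrK; lra.
Qed.

Lemma box_bump_supp (p0 : spacetime R) (d : R) : x_supp T (\sum_i `|p0.2 0 i| + d) (@box_bump R p0 d).
Proof. by move=> t x _ [i]; exact: box_bump_far. Qed.

(** Integration by parts: the divergence of the fields times the bump integrates to 0 ([E1]), and
    the weak equation removes the terms in which the bump is differentiated ([E2]). *)
Lemma weak_slab_int (p0 : spacetime R) (d : R) : 0 < d -> d < p0.1 -> p0.1 + d < T ->
  slab_int T (fun p => g p * box_bump p0 d p) = 0.
Proof.
move=> dgt0 dlt1 dlt2; pose phi := box_bump p0 d.
have test : test_function T phi by exact: box_bump_test.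
have [sm _ _] := test.
have [cphi dphi] := sm [::].
have cdphi v : continuous ('D_v phi) by have [] := sm [:: v].
pose L := \sum_i `|p0.2 0 i| + d.
have sphi : x_supp T L phi by exact: box_bump_supp.
have sdphi v : x_supp T L ('D_v phi).
  move=> t x _ [i hi]; apply: derive_near0.
  have := @near_norm_coord_gt L (t, x) i hi; apply: filterS => -[s y] /= Ly.
  exact: box_bump_far Ly.
have cps := slab_cts_continuous (T := T) cphi.
have cds v := slab_cts_continuous (T := T) (cdphi v).
have cg : slab_cts T g by apply: slab_ctsD => //; exact: slab_cts_sum.
have dp v p : is_derive p v phi ('D_v phi p) by apply: derivableP; exact: dphi.
have E1 : slab_int T (fun p => (G0 p * phi p + F0 p * 'D_(@dir_t R) phi p) +
    \sum_(j < 3) (G j p * phi p + F j p * dx j phi p)) = 0.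
  have d0' p : open_slab T p -> is_derive p (@dir_t R) (fun p => F0 p * phi p)
      (G0 p * phi p + F0 p * 'D_(@dir_t R) phi p).
    move=> sp; refine (is_derive_eq (is_deriveM (d0 sp) (dp (@dir_t R) p)) _).
    by rewrite /GRing.scale /=; ring.
  have dj' j p : open_slab T p -> is_derive p (dir_x j) (fun p => F j p * phi p)
      (G j p * phi p + F j p * dx j phi p).
    move=> sp; refine (is_derive_eq (is_deriveM (dj j sp) (dp (dir_x j) p)) _).
    by rewrite /GRing.scale /dx /=; ring.
  rewrite (@slab_int_div L (fun p => F0 p * phi p) _ (fun j p => F j p * phi p)
     (fun j p => G j p * phi p + F j p * dx j phi p) _ _ _ _ _ _ _ d0' dj').
  - have z t : (t = 0 \/ t = T) -> (fun x => F0 (t, x) * phi (t, x)) = (fun=> 0).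
      move=> ht; apply/funext => x; rewrite /phi box_bump_eq0 ?mulr0// => /boxP[/= + _].
      by rewrite ler_distl; case: ht => -> /andP[? ?]; lra.
    by rewrite !z ?subrr; auto.
  - exact: slab_ctsM.
  - by apply: slab_ctsD; apply: slab_ctsM => //; exact: cds.
  - by move=> j; apply: slab_ctsD; apply: slab_ctsM => //; exact: cds.
  - exact: x_suppMr.
  - by apply: x_suppD; apply: x_suppMr => //; exact: sdphi.
  - by move=> j; exact: x_suppMr.
  - by move=> j; apply: x_suppD; apply: x_suppMr => //; exact: sdphi.
have E2 : slab_int T (fun p => F0 p * 'D_(@dir_t R) phi p + \sum_(j < 3) F j p * dx j phi p) = 0.
  have := weak test; rewrite integral_spacetimeE => h.
  by rewrite /slab_int /Rintegral [X in fine X]h.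
pose a p := F0 p * 'D_(@dir_t R) phi p + \sum_(j < 3) F j p * dx j phi p.
have ca : slab_cts T a.
  apply: slab_ctsD; first by apply: slab_ctsM => //; exact: cds.
  by apply: slab_cts_sum => j; apply: slab_ctsM => //; exact: cds.
have sa : x_supp T L a.
  apply: x_suppD; first by apply: x_suppMr; exact: sdphi.
  by apply: x_supp_sum => j; apply: x_suppMr; exact: sdphi.
have := E1; rewrite (@slab_int_eq _ _ _ (fun p => g p * phi p + a p)); last first.
  by move=> p _; rewrite /g /a big_split /= mulrDl mulr_suml; ring.
rewrite (slab_intD T0 (L := L))// ?E2 ?addr0//; first exact: slab_ctsM.
exact: x_suppMr.
Qed.

(** Du Bois-Reymond argument: a nonzero value of [g] persists near [p0] and is detected by a bump
    concentrated there. Multiplying by the constant [g p0] treats both signs at once. *)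
Lemma weak_pointwise p0 : open_slab T p0 -> g p0 = 0.
Proof.
move=> sp0; have [h1 h2] := andP sp0; apply: contrapT => /eqP g0.
have cg : slab_cts T g by apply: slab_ctsD => //; exact: slab_cts_sum.
have cl_id : clamp_time T p0 = p0.
  by case: p0 h1 h2 {sp0 g0} => t x /= h1 h2; rewrite /clamp_time /= clamp_id// (ltW h1) (ltW h2).
pose h p := g p0 * g p.
have ch : slab_cts T h by apply: slab_ctsM => //; exact: slab_cts_cst.
have hp0 : 0 < h p0 by rewrite /h -expr2 exprn_even_gt0.
have H : nbhs ((h \o clamp_time T) p0) [set y | 0 < y].
  by apply: lt_nbhsr; rewrite /= cl_id.
have /nbhs_ballP[e /= e0 he] := ch p0 _ H.
(* The box of radius [m / 2] stays where [g p0 * g] is positive and, thanks to the halving, strictly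
   between the times 0 and [T]. *)
pose m := Num.min e (Num.min p0.1 (T - p0.1)).
have m0 : 0 < m by rewrite !lt_min e0 h1 subr_gt0.
have m1 : m <= p0.1 by rewrite !ge_min lexx orbT.
have m2 : m <= T - p0.1 by rewrite !ge_min lexx !orbT.
have me : m <= e by rewrite ge_min lexx.
have dgt0 : 0 < m / 2 by rewrite divr_gt0.
have dlt1 : m / 2 < p0.1 by lra.
have dlt2 : p0.1 + m / 2 < T by lra.
have cphi : slab_cts T (box_bump p0 (m / 2)).
  by apply: slab_cts_continuous; have [] := box_bump_smooth p0 (m / 2) [::].
have : 0 < slab_int T (fun p => g p0 * (g p * box_bump p0 (m / 2) p)).
  apply: (@slab_int_gt0 _ _ T0 (\sum_i `|p0.2 0 i| + m / 2) _ p0) => //.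
  - by apply: slab_ctsM; [exact: slab_cts_cst|exact: slab_ctsM].
  - by apply: x_suppMr; apply: x_suppMr; exact: box_bump_supp.
  - move=> p sp; rewrite mulrA.
    have [/boxP[b1 b2]|nb] := pselect (box p0 (m / 2) p); last first.
      by rewrite box_bump_eq0 ?mulr0.
    rewrite mulr_ge0 ?box_bump_ge0// ltW//.
    have := he p; rewrite /= (_ : clamp_time T p = p); last first.
      by case: p sp {b1 b2} => t x /= /andP[t1 t2]; rewrite /clamp_time /= clamp_id// (ltW t1) (ltW t2).
    apply; split; first by rewrite /ball /= distrC; lra.
    by split=> // i j; rewrite ord1 /ball /= distrC; have := b2 j; lra.
  - by rewrite mulrA mulr_gt0// box_bump_gt0.
rewrite (slab_intZ T0 (L := \sum_i `|p0.2 0 i| + m / 2)).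
- by rewrite weak_slab_int// mulr0 ltxx.
- exact: slab_ctsM.
- by apply: x_suppMr; exact: box_bump_supp.
Qed.

End localization.

End weak_equation.

(** * Continuously differentiable functions on the closed slab *)

Section C1_calculus.
Context {R : realType}.

(** Fermat's rule at an interior minimum: an increment of suitable sign would give a quotient whose
    sign contradicts that of [d]. Applied to the nonnegative density, it makes every first
    derivative vanish at an interior vacuum point. *)
Lemma is_derive_min0 (V : normedModType R) (f : V -> R) (p v : V) (d : R) :
  is_derive p v f d -> f p = 0 -> (\forall q \near p, 0 <= f q) -> d = 0.
Proof.
move=> [df ed] fp f0; apply/eqP; apply: contrapT => /negP dn0.
have nd : 0 < `|d| by rewrite normr_gt0.
have : (fun h : R => h^-1 *: ((f \o shift p) (h *: v) - f p)) @ 0^' --> d.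
  by rewrite -ed; exact: df.
move=> /cvgrPdist_lt /(_ _ nd) H0.
have H1 : \forall h \near (0 : R), h != 0 -> `|d - h^-1 *: (f (h *: v + p) - f p)| < `|d|.
  exact: H0.
have H2 : \forall h \near (0 : R), 0 <= f (h *: v + p).
  have : {for 0, continuous (fun h : R => h *: v + p)}.
    by apply: continuousD; [exact: scalel_continuous|exact: cst_continuous].
  by move=> /(_ (fun q => 0 <= f q)); apply; rewrite /= scale0r add0r.
have H3 : nbhs (0 : R) [set h | (h != 0 -> `|d - h^-1 *: (f (h *: v + p) - f p)| < `|d|)
    /\ 0 <= f (h *: v + p)] by exact: filterI H1 H2.
have /nbhs_ballP[e /= e0 he] := H3.
have e20 : 0 < e / 2 by rewrite divr_gt0.
have key (h : R) : h != 0 -> `|h| < e -> `|d - h^-1 * f (h *: v + p)| < `|d| /\ 0 <= f (h *: v + p).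
  move=> h0 hh; have := he h; rewrite /ball /= sub0r normrN => /(_ hh)[/(_ h0) + h2].
  by rewrite fp subr0 /GRing.scale /=.
have e2n : e / 2 != 0 by rewrite gt_eqF.
have e2e : `|e / 2| < e by rewrite gtr0_norm//; lra.
have [dneg|dpos|d0] := ltgtP d 0; last by rewrite d0 eqxx in dn0.
- have [h1 h2] := key (e / 2) e2n e2e; move: h1; rewrite ltNge => /negP; apply.
  have : 0 <= (e / 2)^-1 * f ((e / 2) *: v + p) by rewrite mulr_ge0// invr_ge0 ltW.
  set z := _ * _ => z0; rewrite (ltr0_norm dneg) ltr0_norm; lra.
- have [h1 h2] := key (- (e / 2)) ltac:(by rewrite oppr_eq0) ltac:(by rewrite normrN).
  move: h1; rewrite ltNge => /negP; apply.
  have : 0 <= (e / 2)^-1 * f ((- (e / 2)) *: v + p) by rewrite mulr_ge0// invr_ge0 ltW.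
  rewrite invrN mulNr; set z := _ * _ => z0; rewrite (gtr0_norm dpos) gtr0_norm; lra.
Qed.

(** The difference quotients of [g] are dominated by those of [f]. This replaces the usual rules
    where they break down: for the pressure law at zero density, and for a field cut off at the
    moving boundary. *)
Lemma is_derive_dominated0 (V : normedModType R) (f g : V -> R) (p v : V) (C : R) :
  is_derive p v f 0 -> f p = 0 -> g p = 0 ->
  (\forall q \near p, `|g q| <= C * `|f q|) -> is_derive p v g 0.
Proof.
move=> [df ed] fp gp gf.
have cf : (fun h : R => h^-1 *: ((f \o shift p) (h *: v) - f p)) @ 0^' --> (0 : R).
  by rewrite -{2}ed; exact: df.
have cv : (fun h : R => h^-1 *: ((g \o shift p) (h *: v) - g p)) @ 0^' --> (0 : R).
  apply/cvgr0Pnorm_lt => e e0.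
  have C0 : 0 < `|C| + 1 by rewrite ltr_wpDl.
  have eC : 0 < e / (`|C| + 1) by rewrite divr_gt0.
  have H2 : \forall h \near (0 : R)^', `|g (h *: v + p)| <= C * `|f (h *: v + p)|.
    apply: cvg_within.
    have : {for 0, continuous (fun h : R => h *: v + p)}.
      by apply: continuousD; [exact: scalel_continuous|exact: cst_continuous].
    by move=> /(_ (fun q => `|g q| <= C * `|f q|)); apply; rewrite /= scale0r add0r.
  move/cvgr0Pnorm_lt : cf => /(_ _ eC) H1.
  apply: filterS2 H1 H2 => h /=; rewrite fp gp !subr0 !normrM => h1 h2.
  apply: le_lt_trans (_ : (`|C| + 1) * (`|h^-1| * `|f (h *: v + p)|) < e); last first.
    by rewrite mulrC -ltr_pdivlMr.
  rewrite mulrCA ler_wpM2l//; apply: le_trans h2 _; rewrite ler_wpM2r//.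
  by rewrite (le_trans (ler_norm C))// lerDl.
by apply: DeriveDef; [apply/cvg_ex; exists 0|apply: cvg_lim].
Qed.

(** For a negative base [powR] takes a default value, so the base is truncated at 0; for the density
    on the slab the truncation changes nothing. *)
Lemma continuous_max_powR (a : R) : 0 <= a -> continuous (fun x : R => (Num.max x 0) `^ a).
Proof.
(* Exponent 0 occurs as [gamma - 1] when [gamma = 1]; the power is then 1 everywhere, at base 0 as
   well. *)
rewrite le_eqVlt => /predU1P[<-|a0 x].
  by rewrite (_ : (fun _ => _) = cst 1); [exact: cst_continuous|apply/funext => x; rewrite powRr0].
have [x0|x0|->] := ltgtP x 0.
- apply: (@cvg_trans _ (cst (Num.max x 0 `^ a) @ x)); last first.
    exact: (@cst_continuous R R (Num.max x 0 `^ a) x).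
  apply: near_eq_cvg; near=> y.
  have y0 : y < 0 by near: y; exact: lt_nbhsl.
  by rewrite /= !max_r// ltW.
- rewrite /continuous_at (max_l (ltW x0)); apply: (@cvg_trans _ ((fun y : R => y `^ a) @ x)).
    apply: near_eq_cvg; near=> y.
    have y0 : 0 < y by near: y; exact: lt_nbhsr.
    by rewrite /= max_l// ltW.
  apply: (@differentiable_continuous R R R x (fun y : R => y `^ a)); apply/derivable1_diffP.
  by case: (is_derive1_powR a x0).
- rewrite /continuous_at maxxx powR0 ?gt_eqF//; apply/cvgr0Pnorm_le => e e0.
  have ye0 : \forall y \near (0 : R), `|y| <= e `^ a^-1 by apply: nbhs0_le; rewrite powR_gt0.
  near=> y; rewrite ger0_norm ?powR_ge0//.
  have ye : `|y| <= e `^ a^-1.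
    by near: y.
  have -> : e = (e `^ a^-1) `^ a by rewrite -powRrM mulVf ?gt_eqF// powRr1// ltW.
  apply: ge0_ler_powR; first exact: ltW.
  - by rewrite nnegrE le_max lexx orbT.
  - by rewrite nnegrE powR_ge0.
  by rewrite ge_max powR_ge0 andbT (le_trans (ler_norm _)).
Unshelve. all: by end_near.
Qed.

Variables (T : R) (T0 : 0 < T).

(* [None] is the time direction. *)
Definition dir (o : option 'I_3) : spacetime R := oapp (@dir_x R) (@dir_t R) o.

(** The derivatives are carried as explicit data, so that algebraic rules compose. Differentiability
    is required at interior times only; behaviour at times 0 and [T] is encoded by continuity of [D]
    on the closed slab. *)
Definition C1_with (f : spacetime R -> R) (D : option 'I_3 -> spacetime R -> R) :=
  [/\ slab_cts T f, forall o, slab_cts T (D o) &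
      forall o p, open_slab T p -> is_derive p (dir o) f (D o p)].

Lemma C1_with_cst a : C1_with (fun=> a) (fun _ _ => 0).
Proof.
split=> [|o|o p _]; [exact: slab_cts_cst|exact: slab_cts_cst|exact: is_derive_cst].
Qed.

Lemma C1_with_D f g Df Dg : C1_with f Df -> C1_with g Dg ->
  C1_with (fun p => f p + g p) (fun o p => Df o p + Dg o p).
Proof.
move=> [cf cDf df] [cg cDg dg]; split=> [|o|o p sp]; try exact: slab_ctsD.
exact: is_deriveD (df o p sp) (dg o p sp).
Qed.

Lemma C1_with_N f Df : C1_with f Df -> C1_with (fun p => - f p) (fun o p => - Df o p).
Proof.
move=> [cf cDf df]; split=> [|o|o p sp]; try exact: slab_ctsN.
exact: is_deriveN (df o p sp).
Qed.

Lemma C1_with_M f g Df Dg : C1_with f Df -> C1_with g Dg ->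
  C1_with (fun p => f p * g p) (fun o p => Df o p * g p + f p * Dg o p).
Proof.
move=> [cf cDf df] [cg cDg dg]; split=> [|o|o p sp]; first exact: slab_ctsM.
  by apply: slab_ctsD; exact: slab_ctsM.
refine (is_derive_eq (is_deriveM (df o p sp) (dg o p sp)) _).
by rewrite /GRing.scale /=; ring.
Qed.

Lemma C1_with_V f Df : (forall p, slab T p -> f p != 0) -> C1_with f Df ->
  C1_with (fun p => (f p)^-1) (fun o p => - (f p) ^- 2 * Df o p).
Proof.
move=> f0 [cf cDf df]; split=> [|o|o p sp]; first exact: slab_ctsV.
  apply: slab_ctsM => //; apply: slab_ctsN; apply: slab_ctsV => //.
    exact: slab_ctsX.
  by move=> p sp; rewrite expf_neq0// f0.
have fp : f p != 0 by apply: f0; case/andP: sp => h1 h2; rewrite /slab /= (ltW h1) (ltW h2).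
have [h1 h2] := df o p sp; apply: DeriveDef; first exact: derivableV.
by rewrite deriveV// h2.
Qed.

Lemma C1_with_sum n (f : 'I_n -> spacetime R -> R) D :
  (forall i, C1_with (f i) (D i)) ->
  C1_with (fun p => \sum_(i < n) f i p) (fun o p => \sum_(i < n) D i o p).
Proof.
elim: n f D => [f D _|n IH f D hf].
  have -> : (fun p => \sum_(i < 0) f i p) = fun=> 0 by apply/funext => p; rewrite big_ord0.
  have -> : (fun o p => \sum_(i < 0) D i o p) = fun _ _ => 0.
    by apply/funext => o; apply/funext => p; rewrite big_ord0.
  exact: C1_with_cst.
have -> : (fun p => \sum_(i < n.+1) f i p) =
    (fun p => \sum_(i < n) f (widen_ord (leqnSn n) i) p + f ord_max p).
  by apply/funext => p; rewrite big_ord_recr.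
have -> : (fun o p => \sum_(i < n.+1) D i o p) =
    (fun o p => \sum_(i < n) D (widen_ord (leqnSn n) i) o p + D ord_max o p).
  by apply/funext => o; apply/funext => p; rewrite big_ord_recr.
by apply: C1_with_D => //; exact: (IH _ (fun i => D (widen_ord (leqnSn n) i))).
Qed.

Lemma near_open_slab p : open_slab T p -> \forall q \near p, open_slab T q.
Proof.
case: p => t x /= tT.
have nT : \forall s \near t, 0 < s < T.
  have /near_in_itvoo : t \in `]0, T[ by rewrite in_itv.
  by apply: filterS => r; rewrite in_itv.
exact: (@cvg_fst _ _ (nbhs t) (nbhs x) _ _ nT).
Qed.

Lemma open_slabW p : open_slab T p -> slab T p.
Proof. by case/andP=> h1 h2; rewrite /slab /= (ltW h1) (ltW h2). Qed.

Lemma slab_cts_eq f g : (forall p, slab T p -> f p = g p) -> slab_cts T f -> slab_cts T g.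
Proof.
move=> fg; rewrite /slab_cts (_ : f \o clamp_time T = g \o clamp_time T)//.
by apply/funext => p /=; apply: fg; exact: clamp_slab (ltW T0).
Qed.

Lemma C1_with_eq f g D E : (forall p, slab T p -> f p = g p) ->
  (forall o p, slab T p -> D o p = E o p) -> C1_with f D -> C1_with g E.
Proof.
move=> fg DE [cf cD df]; split=> [|o|o p sp]; first exact: slab_cts_eq cf.
  by apply: slab_cts_eq (cD o); exact: DE.
rewrite -DE; last exact: open_slabW.
apply: near_eq_is_derive (df o p sp); apply: filterS (near_open_slab sp) => q /open_slabW.
exact: fg.
Qed.

(** At an interior time, [[0, T]] is a neighbourhood, so the derivative relative to it is the
    ordinary two-sided one. *)
Lemma C1_slab_with f : C1_slab T f ->
  C1_with f (fun o => oapp (@dx R ^~ f) (dt T f) o).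
Proof.
move=> [cf df cdt dfx cdx]; split=> [|[j|]|[j|] p sp] /=.
- by apply: slab_cts_within.
- by apply: (@slab_cts_within _ _ T0 (dx j f)); exact: cdx.
- by apply: slab_cts_within.
- by apply: derivableP; apply: dfx; exact: open_slabW.
- case: p sp => t x sp; apply/is_derive_slice_t; rewrite /dt /=.
  have := df (t, x) (open_slabW sp); rewrite /derivable_in /derive_in /=.
  set phi := fun s => f (s, x); set l := lim _ => cvl.
  have Q : quotient phi t @ t^' --> l.
    move=> A /cvl; rewrite /within /= => H.
    have nT : \forall s \near t, s \in `[0, T].
      have /near_in_itvoo : t \in `]0, T[ by rewrite in_itv.
      by apply: filterS => r; rewrite !in_itv /= => /andP[/ltW -> /ltW ->].
    have {}H : \forall s \near t, s != t -> s \in `[0, T] -> A (quotient phi t s) by exact: H.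
    by apply: filterS2 H nT => s h1 h2 h3; exact: h1.
  have cv : (fun h : R => h^-1 *: ((phi \o shift t) (h *: 1) - phi t)) @ 0^' --> l.
    move=> A /Q H; have {}H : \forall s \near (0 + t), s != t -> A (quotient phi t s).
      by rewrite add0r; exact: H.
    have c : {for 0, continuous (fun h : R => h + t)}.
      by apply: continuousD; [exact: cvg_id|exact: cst_continuous].
    have {}H : \forall h \near (0 : R), h + t != t -> A (quotient phi t (h + t)) by exact: c H.
    suff : \forall h \near (0 : R), h != 0 -> A (h^-1 *: ((phi \o shift t) (h *: 1) - phi t)) by [].
    apply: filterS H => h hA h0.
    have := hA; rewrite -subr_eq0 addrK => /(_ h0).
    by rewrite /quotient addrK mulrC /= [h *: 1]mulr1.
  by apply: DeriveDef; [apply/cvg_ex; exists l|apply: cvg_lim].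
Qed.

Lemma weak_pointwise_C1 F0 D0 (F : 'I_3 -> spacetime R -> R) D :
  C1_with F0 D0 -> (forall j, C1_with (F j) (D j)) ->
  (forall phi, test_function T phi ->
    integral_spacetime (open_slab T) (fun p => F0 p * 'D_(@dir_t R) phi p
      + \sum_(j < 3) F j p * dx j phi p) = 0%E) ->
  forall p, open_slab T p -> D0 None p + \sum_(j < 3) D j (Some j) p = 0.
Proof.
move=> [c0 cD0 d0] hF weak p sp.
have cF j : slab_cts T (F j) by have [] := hF j.
have cD j : slab_cts T (D j (Some j)) by have [_ + _] := hF j; apply.
have dF j q : open_slab T q -> is_derive q (dir_x j) (F j) (D j (Some j) q).
  by move=> sq; have [_ _ /(_ (Some j) q sq)] := hF j.
exact: (weak_pointwise T0 c0 (cD0 None) cF cD (d0 None) dF weak).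
Qed.

End C1_calculus.

(** * The pointwise Euler equations *)

Section pointwise_equations.
Context {R : realType}.
Variables (k gamma c : R) (hk : 0 < k) (hgamma : 1 <= gamma) (hc : 0 < c).
Variables (T : R) (T0 : 0 < T) (rho0 : space R -> R) (u0 : space R -> space R).
Variables (rho : spacetime R -> R) (u : spacetime R -> space R).
Hypothesis rs : regular_solution k gamma c rho0 u0 T rho u.

Definition partials (f : spacetime R -> R) (o : option 'I_3) : spacetime R -> R :=
  oapp (@dx R ^~ f) (dt T f) o.

Local Notation Dr := (partials rho).
Local Notation U i := (fun p => u p 0 i).
Local Notation Du i := (partials (fun p => u p 0 i)).
Local Notation P := (fun p => pressure k gamma (rho p)).
Definition DP o p := k ^+ 2 * gamma * rho p `^ (gamma - 1) * Dr o p.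
Definition lorentz p := 1 - sqnorm (u p) / c ^+ 2.
Local Notation Q := lorentz.
Definition DQ o p := - (2 * (\sum_(i < 3) u p 0 i * Du i o p)) / c ^+ 2.
Definition enthalpy p := rho p + pressure k gamma (rho p) / c ^+ 2.
Local Notation w := enthalpy.
Local Notation S := (fun p => rho_tilde k gamma c (rho p) (u p)).
Definition DS o p := ((Dr o p + DP o p / c ^+ 2) - S p * DQ o p) / Q p.

Let ge0 p : slab T p -> 0 <= rho p. Proof. exact: (rs_rho_ge0 rs). Qed.

Lemma C1_rho : C1_with T rho Dr.
Proof. exact: (C1_slab_with T0 (rs_rho_C1 rs)). Qed.

Lemma C1_u i : C1_with T (U i) (Du i).
Proof. exact: (C1_slab_with T0 (rs_u_C1 rs i)). Qed.

Lemma vacuum_partials o p : open_slab T p -> rho p = 0 -> Dr o p = 0.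
Proof.
move=> sp r0; have [_ _ d] := C1_rho; apply: is_derive_min0 (d o p sp) r0 _.
by apply: filterS (near_open_slab sp) => q /open_slabW; exact: ge0.
Qed.

Lemma slab_cts_rho_powR a : 0 <= a -> slab_cts T (fun p => rho p `^ a).
Proof.
move=> a0; apply: (@slab_cts_eq _ _ T0 (fun p => Num.max (rho p) 0 `^ a)).
  by move=> p /ge0 rp; rewrite max_l.
move=> p; apply: (@continuous_comp _ _ _ (rho \o clamp_time T) (fun x => Num.max x 0 `^ a)).
  by have [cr _ _] := C1_rho; exact: cr.
exact: continuous_max_powR.
Qed.

(** The chain rule applies where [rho > 0]. At a vacuum point the power need not be differentiable,
    but [gamma >= 1] gives [P <= k^2 rho] as soon as [rho < 1], and [rho] already has zero
    derivatives there. *)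
Lemma C1_pressure : C1_with T P DP.
Proof.
have [cr cDr dr] := C1_rho.
have g0 : gamma != 0 by rewrite gt_eqF// (lt_le_trans _ hgamma).
split=> [|o|o p sp].
- apply: slab_ctsM; first exact: slab_cts_cst.
  by apply: slab_cts_rho_powR; exact: le_trans hgamma.
- apply: slab_ctsM => //; apply: slab_ctsM; first exact: slab_cts_cst.
  by apply: slab_cts_rho_powR; rewrite subr_ge0.
have [r0|r0|r0] := ltgtP (rho p) 0.
- by have := ge0 (open_slabW sp); rewrite leNgt r0.
- have dp := @is_derive_comp1 R _ rho (fun x => x `^ gamma) p (dir o) _ _ (dr o p sp)
    (is_derive1_powR gamma r0).
  refine (is_derive_eq (is_deriveZ (k ^+ 2) dp) _).
  by rewrite /DP /GRing.scale /=; ring.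
- rewrite /DP (vacuum_partials _ sp r0) mulr0.
  have dr0 := dr o p sp; rewrite (vacuum_partials _ sp r0) in dr0.
  apply: (is_derive_dominated0 (C := k ^+ 2) dr0 r0).
    by rewrite /pressure r0 powR0// mulr0.
  have cp : {for p, continuous rho}.
    apply: (@cvg_trans _ ((rho \o clamp_time T) @ p)).
      apply: near_eq_cvg; apply: filterS (near_open_slab sp) => -[t x] /andP[/= t1 t2].
      by rewrite /clamp_time /= clamp_id// (ltW t1) (ltW t2).
    have := cr p; rewrite /continuous_at /=.
    by case: p sp {dr0 r0} => t x /andP[/= t1 t2]; rewrite /clamp_time /= clamp_id// (ltW t1) (ltW t2).
  have n1 : \forall q \near p, rho q < 1.
    have H : nbhs (rho p) [set y | y < 1] by apply: lt_nbhsl; rewrite r0.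
    exact: cp _ H.
  apply: filterS2 n1 (near_open_slab sp) => q q1 /open_slabW/ge0 q0.
  rewrite /pressure normrM ger0_norm ?exprn_ge0 ?(ltW hk)//.
  rewrite ler_wpM2l ?exprn_ge0 ?(ltW hk)// !ger0_norm ?powR_ge0//.
  move: q0; rewrite le_eqVlt => /predU1P[<-|q0]; first by rewrite powR0.
  by apply: ge1r_powR => //; rewrite q0 ltW.
Qed.

Lemma lorentz_gt0 p : slab T p -> 0 < Q p.
Proof.
move=> sp; have [hu _] := rs_subluminal rs sp.
rewrite /Q subr_gt0 ltr_pdivrMr ?exprn_gt0// mul1r.
have s0 : 0 <= sqnorm (u p) by apply: sumr_ge0 => i _; exact: sqr_ge0.
by rewrite -(sqr_sqrtr s0) ltr_pXn2r ?nnegrE ?sqrtr_ge0 ?(ltW hc).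
Qed.

Lemma C1_lorentz : C1_with T Q DQ.
Proof.
have h := C1_with_sum (fun i => C1_with_M (C1_u i) (C1_u i)).
have := C1_with_D (C1_with_cst T 1) (C1_with_N (C1_with_M h (C1_with_cst T (c ^- 2)))).
apply: (C1_with_eq T0) => [p _|o p _].
  by rewrite /Q /sqnorm; congr (_ - _ / _); apply: eq_bigr => i _; rewrite expr2.
rewrite /DQ mulr0 addr0 add0r mulNr; congr (- (_ / _)).
by rewrite mulr_sumr; apply: eq_bigr => i _; ring.
Qed.

Lemma C1_rho_tilde : C1_with T S DS.
Proof.
have Q0 p : slab T p -> Q p != 0 by move=> /lorentz_gt0; apply: lt0r_neq0.
have hw := C1_with_D C1_rho (C1_with_M C1_pressure (C1_with_cst T (c ^- 2))).
have := C1_with_M hw (C1_with_V T0 Q0 C1_lorentz).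
apply: (C1_with_eq T0) => [//|o p sp].
rewrite /DS /rho_tilde -/(Q p).
have := Q0 p sp; have c0 : c != 0 by rewrite gt_eqF.
by move=> q0; field; rewrite q0 c0.
Qed.

Lemma rho_tilde_ge0 p : slab T p -> 0 <= S p.
Proof.
move=> sp; rewrite /rho_tilde divr_ge0//; last exact: ltW (lorentz_gt0 sp).
by rewrite addr_ge0 ?ge0// divr_ge0 ?exprn_ge0 ?(ltW hc)// mulr_ge0 ?powR_ge0// exprn_ge0// ltW.
Qed.

(** In this form the derivatives of the energy reduce to those of [S] and [P], as the elimination of
    the pressure expects. *)
Lemma mass_energyE p : slab T p ->
  mass_energy k gamma c (rho p) (u p) = S p - P p / c ^+ 2.
Proof.
move=> sp; have := lorentz_gt0 sp; rewrite /mass_energy /rho_tilde /lorentz => q0.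
have c0 : c != 0 by rewrite gt_eqF.
have cN : c ^+ 2 - sqnorm (u p) != 0.
  apply: contraTneq q0 => /eqP; rewrite subr_eq0 => /eqP <-.
  by rewrite divff ?expf_neq0// subrr ltxx.
by field; rewrite cN c0.
Qed.

(** Rest mass plus a kinetic part: the form that shows the energy to dominate the density, and that
    lets [S |u|^2] control the excess of energy over density. *)
Lemma mass_energyE2 p : slab T p ->
  mass_energy k gamma c (rho p) (u p) = rho p + S p * sqnorm (u p) / c ^+ 2.
Proof.
move=> sp; have := lorentz_gt0 sp; rewrite /mass_energy /rho_tilde /lorentz => q0.
have c0 : c != 0 by rewrite gt_eqF.
have cN : c ^+ 2 - sqnorm (u p) != 0.
  apply: contraTneq q0 => /eqP; rewrite subr_eq0 => /eqP <-.
  by rewrite divff ?expf_neq0// subrr ltxx.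
by field; rewrite cN c0.
Qed.

Local Notation E := (fun p => mass_energy k gamma c (rho p) (u p)).
Definition DE o p := DS o p - DP o p / c ^+ 2.

Lemma C1_mass_energy : C1_with T E DE.
Proof.
have := C1_with_D C1_rho_tilde (C1_with_N (C1_with_M C1_pressure (C1_with_cst T (c ^- 2)))).
by apply: (C1_with_eq T0) => [q sq|o q _]; rewrite ?mass_energyE// mulr0 addr0.
Qed.

Lemma C1_momentum i :
  C1_with T (fun p => S p * u p 0 i) (fun o p => DS o p * u p 0 i + S p * Du i o p).
Proof. exact: C1_with_M C1_rho_tilde (C1_u i). Qed.

Definition stress i j p := S p * u p 0 i * u p 0 j + (i == j)%:R * P p.
Definition Dstress i j o p := (DS o p * u p 0 i + S p * Du i o p) * u p 0 j
  + S p * u p 0 i * Du j o p + (i == j)%:R * DP o p.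

Lemma C1_stress i j : C1_with T (stress i j) (Dstress i j).
Proof.
have := C1_with_D (C1_with_M (C1_momentum i) (C1_u j))
  (C1_with_M (C1_with_cst T (i == j)%:R) C1_pressure).
by apply: (C1_with_eq T0) => [//|o q _]; rewrite mul0r add0r.
Qed.

Lemma energy_eq p : open_slab T p ->
  DE None p + \sum_(j < 3) (DS (Some j) p * u p 0 j + S p * Du j (Some j) p) = 0.
Proof. exact: (weak_pointwise_C1 T0 C1_mass_energy C1_momentum (rs_mass rs)). Qed.

Lemma momentum_eq i p : open_slab T p ->
  (DS None p * u p 0 i + S p * Du i None p) + \sum_(j < 3) Dstress i j (Some j) p = 0.
Proof.
apply: (weak_pointwise_C1 T0 (C1_momentum i) (C1_stress i)).
move=> phi tphi; rewrite -[RHS](rs_momentum rs i tphi).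
congr integral_spacetime; apply/funext => q; rewrite -addrA; congr (_ + _).
rewrite /stress; under eq_bigr do rewrite mulrDl.
rewrite big_split /=; congr (_ + _).
rewrite (bigD1 i)//= eqxx mul1r big1 ?addr0// => j /negbTE ji.
by rewrite eq_sym ji !mul0r.
Qed.

(* Eliminating the pressure between the energy equation and the momentum equations
   contracted with [u] leaves the transport equation for the mass density. *)
Definition transport_coef p : R :=
  - (1 + k ^+ 2 * rho p `^ (gamma - 1) / c ^+ 2) *
  ((\sum_(i < 3) u p 0 i * (Du i None p + \sum_(j < 3) u p 0 j * Du i (Some j) p))
     / (c ^+ 2 * Q p) + \sum_(j < 3) Du j (Some j) p).

Lemma slab_cts_transport_coef : slab_cts T transport_coef.
Proof.
have cu i : slab_cts T (U i) by have [] := C1_u i.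
have cDu i o : slab_cts T (Du i o) by have [_ + _] := C1_u i; apply.
apply: slab_ctsM.
  apply: slab_ctsN; apply: slab_ctsD; first exact: slab_cts_cst.
  apply: slab_ctsM; last exact: slab_cts_cst.
  apply: slab_ctsM; first exact: slab_cts_cst.
  by apply: slab_cts_rho_powR; rewrite subr_ge0.
apply: slab_ctsD; last exact: slab_cts_sum.
apply: slab_ctsM.
  apply: slab_cts_sum => i; apply: slab_ctsM => //; apply: slab_ctsD => //.
  by apply: slab_cts_sum => j; exact: slab_ctsM.
apply: slab_ctsV => //.
  by apply: slab_ctsM; [exact: slab_cts_cst|have [] := C1_lorentz].
by move=> p /lorentz_gt0 q0; rewrite gt_eqF// mulr_gt0// exprn_gt0.
Qed.

(** The eliminated equation has the factors [S] and [S * Q] on the right. Writing [P] as [rho] times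
    a power of exponent [gamma - 1] exhibits both as multiples of [rho], which is what a Gronwall
    estimate starting from zero density needs. *)
Lemma transport_eq p : open_slab T p ->
  Dr None p + \sum_(j < 3) u p 0 j * Dr (Some j) p = rho p * transport_coef p.
Proof.
move=> sp; have E := energy_eq sp; have M i := momentum_eq i sp.
have q0 := lorentz_gt0 (open_slabW sp).
have c0 : c != 0 by rewrite gt_eqF.
have pE : pressure k gamma (rho p) = k ^+ 2 * (rho p * rho p `^ (gamma - 1)).
  by rewrite (mulr_powRB1 (ge0 (open_slabW sp)) (lt_le_trans ltr01 hgamma)).
have SQ : S p * Q p = rho p * (1 + k ^+ 2 * rho p `^ (gamma - 1) / c ^+ 2).
  by rewrite /rho_tilde -/(Q p) mulfVK ?gt_eqF// pE; ring.
have X o : Q p * DS o p - (Dr o p + DP o p / c ^+ 2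
    + S p * (2 * (\sum_(i < 3) u p 0 i * Du i o p)) / c ^+ 2) = 0.
  by rewrite /DS mulrCA mulfV ?gt_eqF// mulr1 /DQ; ring.
have Qdef : Q p = 1 - (\sum_(i < 3) u p 0 i ^+ 2) / c ^+ 2 by [].
have -> : rho p * transport_coef p = - (S p * (\sum_(i < 3) u p 0 i *
      (Du i None p + \sum_(j < 3) u p 0 j * Du i (Some j) p)) / c ^+ 2
    + S p * Q p * \sum_(j < 3) Du j (Some j) p).
  by rewrite SQ /transport_coef mulrA mulrN -SQ; field; rewrite c0 gt_eqF.
exact: (@transport_elimination _ (S p) (Q p) (c ^- 2) (fun i => u p 0 i)
  (Dr ^~ p) (DP ^~ p) (DS ^~ p) (fun i o => Du i o p) Qdef E M X).
Qed.

End pointwise_equations.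

(** * Straight vacuum lines *)

Section uniform.
Context {R : realType}.

(** Heine-Cantor in the form where only one of the two points has to lie in [K]: the intermediate
    points of a mean value argument may leave the compact set. *)
Lemma compact_unif_continuous (X : pseudoMetricType R) (K : set X) (f : X -> R) (e : R) :
  compact K -> continuous f -> 0 < e ->
  exists2 d, 0 < d & forall p q, K p -> ball p d q -> `|f q - f p| < e.
Proof.
move=> /compact_near_coveringP cK cf e0.
have e20 : 0 < e / 2 by rewrite divr_gt0.
pose P (d : R) (p : X) := forall q, ball p d q -> `|f q - f p| < e.
have : \forall d \near 0^'+, K `<=` P d.
  apply: (cK R (at_right (0 : R)) P) => p Kp.
  have /nbhs_ballP[r /= r0 hr] : nbhs p [set q | `|f p - f q| < e / 2].
    by have /cvgrPdist_lt /(_ _ e20) := cf p.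
  have r20 : 0 < r / 2 by rewrite divr_gt0.
  exists (ball p (r / 2), [set d : R | d < r / 2]).
    split; first exact: nbhsx_ballx.
    by apply: nbhs_right_lt.
  move=> [p' d] [/= pp' dr] q p'q.
  have h1 : `|f p - f p'| < e / 2 by apply: hr; apply: le_ball pp'; lra.
  have h2 : `|f p - f q| < e / 2.
    apply: hr; rewrite [r]splitr; apply: ball_triangle pp' _.
    by apply: le_ball p'q; exact: ltW.
  rewrite [e]splitr (le_lt_trans (ler_distD (f p) _ _))// ltrD//.
  by rewrite distrC.
move=> nd; have [d [d0 hd]] : exists d, 0 < d /\ K `<=` P d.
  near (0 : R)^'+ => d; exists d; split; first by near: d; exact: nbhs_right_gt.
  by near: d.
by exists d => // p q Kp; exact: hd.
Unshelve. all: by end_near.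
Qed.

(** Near a point of [K] either [g] is already small or [f] is bounded away from 0; compactness makes
    the alternative uniform. It turns vanishing acceleration in the vacuum into small acceleration
    at small density. *)
Lemma compact_small (X : topologicalType) (K : set X) (f g : X -> R) (e : R) :
  compact K -> continuous f -> continuous g -> (forall p, 0 <= f p) ->
  (forall p, f p = 0 -> g p = 0) -> 0 < e ->
  exists2 d, 0 < d & forall p, K p -> f p < d -> `|g p| < e.
Proof.
move=> /compact_near_coveringP cK cf cg f0 fg e0.
pose P (d : R) (p : X) := f p < d -> `|g p| < e.
have : \forall d \near 0^'+, K `<=` P d.
  apply: (cK R (at_right (0 : R)) P) => p Kp.
  have [gp|gp] := ltP `|g p| e.
    exists ([set q | `|g q| < e], setT); last by move=> [q d] [/= gq _] _.
    split; last exact: filterT.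
    have cn : {for p, continuous (fun q => `|g q|)}.
      by apply: (@continuous_comp _ _ _ g Num.norm); [exact: cg|exact: norm_continuous].
    have H : nbhs `|g p| [set y | y < e] by exact: lt_nbhsl.
    exact: cn _ H.
  have fp : 0 < f p.
    rewrite lt_neqAle f0 andbT; apply/eqP => /esym /fg gp0.
    by move: gp; rewrite gp0 normr0 leNgt e0.
  have fp2 : 0 < f p / 2 by rewrite divr_gt0.
  exists ([set q | f p / 2 < f q], [set d : R | d < f p / 2]).
    split; last exact: nbhs_right_lt.
    have fp3 : f p / 2 < f p by rewrite [ltRHS]splitr ltrDl.
    have H : nbhs (f p) [set y | f p / 2 < y] by exact: lt_nbhsr.
    exact: cf _ H.
  by move=> [q d] [/= h1 h2] /lt_trans /(_ h2) /(lt_trans h1); rewrite ltxx.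
move=> nd; have [d [d0 hd]] : exists d, 0 < d /\ K `<=` P d.
  near (0 : R)^'+ => d; exists d; split; first by near: d; exact: nbhs_right_gt.
  by near: d.
by exists d => // p Kp; exact: hd.
Unshelve. all: by end_near.
Qed.

Variables (T : R) (T0 : 0 < T).

Lemma clamp_time_id p : slab T p -> clamp_time T p = p.
Proof. by case: p => t x /= tT; rewrite /clamp_time /= clamp_id. Qed.

Lemma slab_cts_closure f g : slab_cts T f -> slab_cts T g ->
  (forall p, open_slab T p -> f p = g p) -> forall p, slab T p -> f p = g p.
Proof.
move=> cf cg fg [t x] sp; apply/eqP; rewrite -subr_eq0; apply: contrapT => /negP n0.
pose h s := f (clamp_time T (s, x)) - g (clamp_time T (s, x)).
have ch : continuous h.
  move=> s; apply: (@continuous_comp _ _ _ (fun s : R => (s, x))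
      (fun p => f (clamp_time T p) - g (clamp_time T p))).
    by apply: continuous_pair => z; [exact: cvg_id|exact: cst_continuous].
  by apply: continuousB; [exact: cf|exact: cg].
have ht : 0 < `|h t| by rewrite normr_gt0 /h clamp_time_id.
have /cvgrPdist_lt /(_ _ ht) /nbhs_ballP[e /= e0 he] := ch t.
have [/= t0 tT] := andP sp.
(* [s] is [t] moved towards the midpoint [T / 2] by at most [e / 2], hence interior even if [t] is 0
   or [T]. *)
pose s := if t < T / 2 then Num.min (t + e / 2) (T / 2) else Num.max (t - e / 2) (T / 2).
have T20 : 0 < T / 2 by rewrite divr_gt0.
have [sT st] : 0 < s < T /\ `|t - s| < e.
  have tri (r : R) : 0 < r -> r < T -> t - e < r -> r < t + e -> 0 < r < T /\ `|t - r| < e.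
    by move=> r1 r2 r3 r4; rewrite ltr_distlC r1 r2 r3 r4.
  rewrite /s; have [tT2|tT2] := ltP t (T / 2).
    by have [h1|h1] := leP (t + e / 2) (T / 2); apply: tri; lra.
  by have [h1|h1] := leP (t - e / 2) (T / 2); apply: tri; lra.
have := he s st; rewrite /= {2}/h clamp_time_id; last exact: open_slabW.
by rewrite fg// subrr subr0 ltxx.
Qed.

End uniform.

(** * Uniform first-order expansion along a straight step *)

Section increments.
Context {R : realType}.
Variables (T : R) (T0 : 0 < T).

Lemma space_increment f D (t : R) (y : space R) j (s : R) : C1_with T f D -> 0 < t < T ->
  exists2 th : R, 0 <= th <= 1 & f (t, y + s *: basis j) - f (t, y) =
    s * D (Some j) (t, y + (th * s) *: basis j).
Proof.
move=> [_ _ df] tT.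
pose phi (r : R) := f (t, y + (r * s) *: basis j).
have dphi (r : R) : is_derive r 1 phi (s * D (Some j) (t, y + (r * s) *: basis j)).
  have h := df (Some j) (t, y + (r * s) *: basis j) tT.
  have {}h := (is_derive_slice_x _ _ _ _ _).1 h.
  have {}h := (is_derive_line _ _ _ _ _).1 h.
  have dm : is_derive r 1 (fun r : R => r * s) s.
    refine (is_derive_eq (is_deriveM (is_derive_id r 1) (is_derive_cst s r 1)) _).
    by rewrite /GRing.scale /=; ring.
  have := @is_derive1_comp R (fun r => f (t, y + r *: basis j)) (fun r => r * s) r _ _ h dm.
  by rewrite mulrC.
have cphi : {within `[0, 1], continuous phi}.
  apply: continuous_subspaceT => r; apply: (@differentiable_continuous R R R r phi).
  by apply/derivable1_diffP; case: (dphi r).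
have [th] := MVT ltr01 (fun r _ => dphi r) cphi.
rewrite in_itv /= => /andP[h1 h2]; rewrite /phi mul1r mul0r scale0r addr0 subr0 mulr1 => E.
by exists th => //; rewrite (ltW h1) (ltW h2).
Qed.

Lemma time_increment f D (t h : R) (y : space R) : C1_with T f D -> 0 <= t -> 0 < h -> t + h <= T ->
  exists2 th : R, 0 <= th <= h & f (t + h, y) - f (t, y) = h * D None (t + th, y).
Proof.
move=> [cf _ df] t0 h0 hT.
pose phi (s : R) := f (clamp_time T (s, y)).
have dphi (s : R) : s \in `]t, t + h[ -> is_derive s 1 phi (D None (s, y)).
  rewrite in_itv /= => /andP[h1 h2].
  have sT : 0 < s < T by apply/andP; split; lra.
  have := (is_derive_slice_t _ _ _ _).1 (df None (s, y) sT).
  apply: near_eq_is_derive.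
  have : s \in `]0, T[ by rewrite in_itv.
  move=> /near_in_itvoo; apply: filterS => r; rewrite in_itv /= => /andP[r1 r2].
  by rewrite /phi clamp_time_id// /slab /= (ltW r1) (ltW r2).
have cphi : {within `[t, t + h], continuous phi}.
  apply: continuous_subspaceT => s.
  apply: (@continuous_comp _ _ _ (fun s : R => (s, y)) (f \o clamp_time T)); last exact: cf.
  by apply: continuous_pair => z; [exact: cvg_id|exact: cst_continuous].
have tth : t < t + h by rewrite ltrDl.
have [s] := MVT tth dphi cphi.
rewrite in_itv /= => /andP[h1 h2]; rewrite /phi !clamp_time_id /slab /=; first last.
- by apply/andP; split; lra.
- by apply/andP; split; lra.
move=> E; exists (s - t); first by apply/andP; split; lra.
by rewrite E addrCA subrr addr0 mulrC; congr (_ * _); ring.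
Qed.

Lemma spacetime_ball (t t' d : R) (x x' : space R) : 0 < d -> `|t - t'| < d ->
  (forall i, `|x 0 i - x' 0 i| < d) -> ball ((t, x) : spacetime R) d (t', x').
Proof. by move=> d0 h1 h2; split=> //; split=> // i j; rewrite ord1; exact: h2. Qed.

Definition sum_basis (x a : space R) (h : R) :=
  x + (h * a 0 0) *: basis 0 + (h * a 0 1) *: basis 1 + (h * a 0 2) *: basis 2.

Lemma sum_basisE (x a : space R) (h : R) : sum_basis x a h = x + h *: a.
Proof.
apply/rowP => i; rewrite !mxE /=.
by case: i => -[|[|[|//]]] hi /=; rewrite ?mulr1 ?mulr0 ?addr0;
  congr (_ + _ * a 0 _); exact: val_inj.
Qed.

(** Only partial derivatives are available, so the step is split into one time step and three
    coordinate steps with a mean value theorem on each; uniform continuity on [K] brings the four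
    derivatives back to the starting point. *)
Lemma increment f D (K : set (spacetime R)) (c e : R) : compact K -> C1_with T f D ->
  0 < c -> 0 < e -> exists2 d, 0 < d & forall t (x a : space R) h, K (t, x) ->
    0 <= t -> 0 < h -> h < d -> t + h < T -> (forall i, `|a 0 i| <= c) ->
    `|f (t + h, x + h *: a) - f (t, x)
      - h * (D None (t, x) + \sum_(j < 3) a 0 j * D (Some j) (t, x))| <= h * e.
Proof.
move=> cK hf c0 e0; have [_ cD _] := hf.
(* The time step contributes [e1] and each coordinate step [c * e1], for a total of
   [(1 + 3 c) e1 = e]. *)
have e10 : 0 < e / (1 + 3 * c) by rewrite divr_gt0// ltr_wpDr// mulr_ge0// ltW.
set e1 := e / (1 + 3 * c) in e10.
have unif o := compact_unif_continuous cK (cD o) e10.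
have [dt0 dt0P hdt] := unif None.
have [d0 d0P hd0] := unif (Some 0).
have [d1 d1P hd1] := unif (Some 1).
have [d2 d2P hd2] := unif (Some 2).
pose m := Num.min (Num.min dt0 d0) (Num.min d1 d2).
have m0 : 0 < m by rewrite !lt_min dt0P d0P d1P d2P.
(* This makes the displacements [h] in time and [h * c] in space both smaller than [m]. *)
exists (m / (1 + c)); first by rewrite divr_gt0// addr_gt0.
move=> t x a h Kx t0 h0 hd hT ha.
have hm : h * (1 + c) < m by rewrite -ltr_pdivlMr// addr_gt0.
have hc0 : 0 < h * c by rewrite mulr_gt0.
have near o (q : spacetime R) dd : m <= dd ->
    (forall p q, K p -> ball p dd q -> `|(D o \o clamp_time T) q - (D o \o clamp_time T) p| < e1) ->
    0 <= q.1 - t <= h -> q.1 <= T -> (forall i, `|x 0 i - q.2 0 i| <= h * c) ->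
    `|D o q - D o (t, x)| <= e1.
  move=> mdd hh /andP[q1 q2] qT q3.
  have := hh (t, x) q Kx; rewrite /= !clamp_time_id; first last.
  - by rewrite /slab /= qT andbT (le_trans t0)// -subr_ge0.
  - by rewrite /slab /= t0 (le_trans _ (ltW hT))// lerDl ltW.
  move=> H; apply/ltW/H; case: q q1 q2 qT q3 {H hh} => s y /= q1 q2 qT q3.
  apply: spacetime_ball; first by lra.
    by rewrite distrC ger0_norm//; lra.
  by move=> i; apply: le_lt_trans (q3 i) _; lra.
(* The time step comes first: [t] may be 0, whereas the spatial steps need an interior time, which
   [t + h] is. *)
have tT : 0 < t + h < T by rewrite hT ltr_wpDl.
have [th th1 Et] := time_increment x hf t0 h0 (ltW hT).
pose y1 := x + (h * a 0 0) *: basis 0.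
pose y2 := y1 + (h * a 0 1) *: basis 1.
have [s0 s01 E0] := space_increment x 0 (h * a 0 0) hf tT.
have [s1 s11 E1] := space_increment y1 1 (h * a 0 1) hf tT.
have [s2 s21 E2] := space_increment y2 2 (h * a 0 2) hf tT.
have ha' i : `|h * a 0 i| <= h * c by rewrite normrM gtr0_norm// ler_wpM2l// ltW.
have hs (s : R) i : 0 <= s <= 1 -> `|s * (h * a 0 i)| <= h * c.
  case/andP=> s1' s2'; rewrite normrM ger0_norm//; apply: le_trans (ha' i).
  by rewrite ler_piMl.
have m1 : m <= dt0 by rewrite !ge_min lexx.
have m2 : m <= d0 by rewrite !ge_min lexx orbT.
have m3 : m <= d1 by rewrite !ge_min lexx !orbT.
have m4 : m <= d2 by rewrite !ge_min lexx !orbT.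
have Bt : `|D None (t + th, x) - D None (t, x)| <= e1.
  apply: near m1 hdt _ _ _ => /=.
  - by rewrite addrAC subrr add0r.
  - by case/andP: th1 => _ ?; rewrite (le_trans _ (ltW hT))// lerD2l.
  - by move=> i; rewrite subrr normr0 ltW.
have side (q : R) : q = t + h -> 0 <= q - t <= h /\ q <= T by move=> ->; rewrite addrAC subrr add0r (ltW h0) lexx (ltW hT).
have [sd1 sd2] := side (t + h) erefl.
have hx (z y : R) : y - (y + z) = - z by ring.
have B0 : `|D (Some 0) (t + h, x + (s0 * (h * a 0 0)) *: basis 0) - D (Some 0) (t, x)| <= e1.
  apply: (near _ _ _ m2 hd0) => // i /=; rewrite !mxE hx normrN.
  by case: (ord3_cases i) => -> /=; rewrite ?mulr1 ?mulr0 ?normr0 ?(ltW hc0)// hs.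
have B1 : `|D (Some 1) (t + h, y1 + (s1 * (h * a 0 1)) *: basis 1) - D (Some 1) (t, x)| <= e1.
  apply: (near _ _ _ m3 hd1) => // i /=; rewrite !mxE -addrA hx normrN.
  by case: (ord3_cases i) => -> /=; rewrite ?mulr1 ?mulr0 ?addr0 ?add0r ?normr0 ?(ltW hc0)// ?ha' ?hs.
have B2 : `|D (Some 2) (t + h, y2 + (s2 * (h * a 0 2)) *: basis 2) - D (Some 2) (t, x)| <= e1.
  apply: (near _ _ _ m4 hd2) => // i /=; rewrite !mxE -!addrA hx normrN.
  by case: (ord3_cases i) => -> /=; rewrite ?mulr1 ?mulr0 ?addr0 ?add0r ?normr0 ?(ltW hc0)// ?ha' ?hs.
rewrite sum3E -sum_basisE /sum_basis -/y1 -/y2.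
set Zt := D None (t + th, x) in Et Bt.
set Z0 := D (Some 0) (t + h, _) in E0 B0.
set Z1 := D (Some 1) (t + h, _) in E1 B1.
set Z2 := D (Some 2) (t + h, _) in E2 B2.
set W := f (t + h, _); rewrite -/y2 -/W in E2.
have -> : W - f (t, x) - h * (D None (t, x) +
      (a 0 0 * D (Some 0) (t, x) + a 0 1 * D (Some 1) (t, x) + a 0 2 * D (Some 2) (t, x))) =
    h * ((Zt - D None (t, x)) + a 0 0 * (Z0 - D (Some 0) (t, x)) + a 0 1 * (Z1 - D (Some 1) (t, x))
      + a 0 2 * (Z2 - D (Some 2) (t, x))).
  have -> : W - f (t, x) = (f (t + h, x) - f (t, x)) + (f (t + h, y1) - f (t + h, x))
      + (f (t + h, y2) - f (t + h, y1)) + (W - f (t + h, y2)) by ring.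
  rewrite Et E0 E1 E2; ring.
rewrite normrM (gtr0_norm h0) ler_wpM2l ?(ltW h0)//.
have hp i z : `|z| <= e1 -> `|a 0 i * z| <= c * e1.
  by move=> hz; rewrite normrM ler_pM.
have -> : e = e1 + c * e1 + c * e1 + c * e1.
  have n0 : 1 + 3 * c != 0 by rewrite gt_eqF// ltr_wpDr// mulr_ge0// ltW.
  by rewrite /e1; field.
apply: le_trans (ler_normD _ _) _; apply: lerD; last exact: hp.
apply: le_trans (ler_normD _ _) _; apply: lerD; last exact: hp.
by apply: le_trans (ler_normD _ _) _; apply: lerD; last exact: hp.
Qed.

End increments.

(** * Propagation of the vacuum along straight lines *)

Section vacuum.
Context {R : realType}.
Variables (k gamma c : R) (hk : 0 < k) (hgamma : 1 <= gamma) (hc : 0 < c).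
Variables (T : R) (T0 : 0 < T) (rho0 : space R -> R) (u0 : space R -> space R).
Variables (rho : spacetime R -> R) (u : spacetime R -> space R).
Hypothesis rs : regular_solution k gamma c rho0 u0 T rho u.

Local Notation Dr := (partials T rho).
Local Notation Du i := (partials T (fun p => u p 0 i)).

Lemma u_coord_le p i : slab T p -> `|u p 0 i| <= c.
Proof.
move=> /(rs_subluminal rs)[/ltW uc _].
apply: le_trans uc; rewrite -sqrtr_sqr ler_sqrt ?sumr_ge0// => [|j _]; last exact: sqr_ge0.
by rewrite /sqnorm (bigD1 i)//= lerDl sumr_ge0// => j _; exact: sqr_ge0.
Qed.

Definition accel i p := Du i None p + \sum_(j < 3) u p 0 j * Du i (Some j) p.

Lemma slab_cts_accel i : slab_cts T (accel i).
Proof.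
have cu j : slab_cts T (fun p => u p 0 j) by have [] := C1_u T0 rs j.
have [_ cD _] := C1_u T0 rs i.
by apply: slab_ctsD => //; apply: slab_cts_sum => j; exact: slab_ctsM.
Qed.

Lemma accel_vacuum i p : slab T p -> rho p = 0 -> accel i p = 0.
Proof. by move=> sp r0; exact: (rs_vacuum rs sp r0 i). Qed.

(* Euler polygons stand in for the particle path: along them rho and the variation
   of u tend to 0 with the mesh, so in the limit the path is a straight vacuum line. *)
Lemma vacuum_line_lt (x0 v : space R) (t : R) : rho (0, x0) = 0 -> u (0, x0) = v ->
  0 < t < T -> rho (t, x0 + t *: v) = 0.
Proof.
move=> r0 uv /andP[t0 tT].
have lin (z r a b f : R) : z - r - a <= f -> a <= b -> z <= r + b + f by lra.
have [cr cDr _] := C1_rho T0 rs.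
(* Each velocity component is at most [c], so polygons issuing from [x0] remain in [K] up to time
   [T]. *)
pose K : set (spacetime R) := `[0, T] `*` [set x : space R | forall i, `[x0 0 i - c * T, x0 0 i + c * T]%classic (x 0 i)].
have cK : compact K.
  apply: compact_setX; first exact: segment_compact.
  apply: (@rV_compact R 3 (fun i => `[x0 0 i - c * T, x0 0 i + c * T]%classic)) => i.
  exact: segment_compact.
have KP (s : R) (y : space R) : 0 <= s <= T -> (forall i, `|y 0 i - x0 0 i| <= c * T) -> K (s, y).
  by move=> sT hy; split; [rewrite /= in_itv|move=> i; rewrite /= in_itv /= -ler_distl].
pose B := transport_coef k gamma c T rho u.
have cB : slab_cts T B := slab_cts_transport_coef hgamma hc T0 rs.
have [M M0 hM] := compact_continuous_bounded cK cB.
have TE p : slab T p -> Dr None p + \sum_(j < 3) u p 0 j * Dr (Some j) p = rho p * B p.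
  apply: (@slab_cts_closure _ T T0
    (fun p => Dr None p + \sum_(j < 3) u p 0 j * Dr (Some j) p) (fun p => rho p * B p)).
  - apply: slab_ctsD => //; apply: slab_cts_sum => j; apply: slab_ctsM => //.
    by have [] := C1_u T0 rs j.
  - exact: slab_ctsM.
  - by move=> q sq; exact (transport_eq hk hgamma hc T0 rs sq).
have rge0 p : slab T p -> 0 <= rho p by exact: (rs_rho_ge0 rs).
apply: contrapT => /eqP rn0.
set pt := (t, x0 + t *: v) in rn0.
have spt : slab T pt by rewrite /slab /= (ltW t0) (ltW tT).
have rpt : 0 < rho pt by rewrite lt_neqAle eq_sym rn0 rge0.
have rpt2 : 0 < rho pt / 2 by rewrite divr_gt0.
have /cvgrPdist_lt /(_ _ rpt2) /nbhs_ballP[d /= d0 hd] := cr pt.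
(* The velocity will drift by at most [2 * eta] per unit of time, hence the position by at most
   [T * (T * (2 * eta)) = d / 2] from the straight line. *)
pose eta := d / (4 * (T * T)).
have eta0 : 0 < eta by rewrite divr_gt0// !mulr_gt0.
have scl (q : spacetime R) : slab T (clamp_time T q) by exact: clamp_slab (ltW T0).
have small i := compact_small cK cr (@slab_cts_accel i) (fun q => rge0 _ (scl q))
  (fun q => @accel_vacuum i _ (scl q)) eta0.
have [k0 k0P hk0] := small 0; have [k1 k1P hk1] := small 1; have [k2 k2P hk2] := small 2.
pose kap := Num.min k0 (Num.min k1 k2).
have kap0 : 0 < kap by rewrite !lt_min k0P k1P k2P.
have hkap i p : K p -> slab T p -> rho p < kap -> `|accel i p| < eta.
  move=> Kp sp; rewrite !lt_min => /and3P[h0 h1 h2].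
  have := hk0 p Kp; have := hk1 p Kp; have := hk2 p Kp.
  rewrite /= clamp_time_id// => /(_ h2) a2 /(_ h1) a1 /(_ h0) a0.
  by case: (ord3_cases i) => ->.
pose C := T * expR (M * T).
have C0 : 0 < C by rewrite mulr_gt0// expR_gt0.
(* [C] is the Gronwall factor and [e * C] bounds the density along the polygon. Below [kap] it keeps
   the acceleration under [eta] at every node; below [rho pt / 2] it contradicts the density assumed
   at [pt]. *)
pose e := Num.min eta (Num.min kap (rho pt / 2) / (2 * C)).
have mm0 : 0 < Num.min kap (rho pt / 2) by rewrite lt_min kap0.
have e0 : 0 < e by rewrite lt_min eta0 divr_gt0// mulr_gt0.
have eeta : e <= eta by rewrite ge_min lexx.
have eC : e * C < Num.min kap (rho pt / 2).
  have h2 : e * (2 * C) <= Num.min kap (rho pt / 2).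
    rewrite -ler_pdivlMr; last by rewrite mulr_gt0.
    by rewrite ge_min lexx orbT.
  have h3 : 0 < e * C := mulr_gt0 e0 C0.
  apply: lt_le_trans h2; have -> : e * (2 * C) = e * C + e * C by ring.
  by rewrite ltrDl.
have [eCk eCr] : e * C < kap /\ e * C < rho pt / 2 by move: eC; rewrite lt_min => /andP.
have [dr drP hdr] := increment cK (C1_rho T0 rs) hc e0.
have hdu i := increment cK (C1_u T0 rs i) hc e0.
have [du0 du0P hdu0] := hdu 0; have [du1 du1P hdu1] := hdu 1; have [du2 du2P hdu2] := hdu 2.
pose dm := Num.min dr (Num.min du0 (Num.min du1 du2)).
have dm0 : 0 < dm by rewrite !lt_min drP du0P du1P du2P.
have [N [N0 Ndm]] : exists N : nat, 0 < N%:R :> R /\ t / dm < N%:R.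
  by exists (Num.truncn (t / dm)).+1; rewrite ltr0n truncnS_gt.
have [h hE] : exists h, h = t / N%:R by exists (t / N%:R).
have h0 : 0 < h by rewrite hE divr_gt0.
have hdm : h < dm.
  by rewrite hE ltr_pdivrMr// mulrC -ltr_pdivrMr.
have [hr [h1 [h2 h3]]] : h < dr /\ h < du0 /\ h < du1 /\ h < du2.
  by move: hdm; rewrite !lt_min => /and4P[].
have Nh : N%:R * h = t by rewrite hE mulrCA mulfV ?mulr1// gt_eqF.
pose X := fix X n := if n is m.+1 then X m + h *: u (m%:R * h, X m) else x0.
pose p n : spacetime R := (n%:R * h, X n).
have tn n : (n <= N)%N -> 0 <= n%:R * h <= t.
  by move=> nN; rewrite mulr_ge0 ?(ltW h0)//= -Nh ler_wpM2r ?(ltW h0)// ler_nat.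
have stn n : (n <= N)%N -> slab T (p n).
  by move=> /tn /andP[a1 a2]; rewrite /slab /= a1 (le_trans a2 (ltW tT)).
have growth n : (n <= N)%N -> (1 + h * M) ^+ n <= expR (M * T).
  move=> nN; apply: (@le_trans _ _ (expR (h * M) ^+ n)).
    by apply: lerXn2r; rewrite ?nnegrE ?expR_ge0 ?expR_ge1Dx// addr_ge0// mulr_ge0// ltW.
  rewrite -expRM_natr ler_expR mulrAC mulrC ler_wpM2l ?(ltW M0)// mulrC.
  by have /andP[_ a2] := tn n nN; rewrite (le_trans a2 (ltW tT)).
have gn n : 0 <= (1 + h * M) ^+ n by rewrite exprn_ge0// addr_ge0// mulr_ge0// ltW.
(* The bounds feed each other: the first keeps the node in [K], the second is the discrete Gronwall
   estimate, its smallness controls the acceleration and so the third, and summing velocities gives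
   the fourth. *)
have main n : (n <= N)%N -> [/\ forall i, `|X n 0 i - x0 0 i| <= n%:R * h * c,
    rho (p n) <= e * (n%:R * h) * (1 + h * M) ^+ n,
    forall i, `|u (p n) 0 i - v 0 i| <= n%:R * h * (2 * eta) &
    forall i, `|X n 0 i - x0 0 i - n%:R * h * v 0 i| <= n%:R * h * (T * (2 * eta))].
  elim: n => [_|n IH nN].
    rewrite /p /= mul0r r0 uv; split=> [i||i|i].
    + by rewrite subrr normr0 mul0r.
    + by rewrite mulr0 mul0r.
    + by rewrite subrr normr0 mul0r.
    + by rewrite !mul0r subr0 subrr normr0.
  have nN' : (n <= N)%N by exact: ltnW.
  have [I1 I2 I3 I4] := IH nN'.
  have /andP[tn0 tnt] := tn n nN'.
  have /andP[_ tn1] := tn n.+1 nN.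
  have tnT : n%:R * h <= T by exact: le_trans tnt (ltW tT).
  have nS : n.+1%:R * h = n%:R * h + h by rewrite -natr1 mulrDl mul1r.
  have hT : n%:R * h + h < T by rewrite -nS (le_lt_trans tn1).
  have Kp : K (p n).
    apply: KP; first by rewrite tn0 tnT.
    by move=> i; apply: le_trans (I1 i) _; rewrite mulrC ler_wpM2l// ltW.
  have sp := stn n nN'.
  have ua i : `|u (p n) 0 i| <= c by exact: u_coord_le.
  have rp0 := rge0 _ sp.
  have rk : rho (p n) < kap.
    apply: le_lt_trans eCk; apply: le_trans I2 _; rewrite /C -mulrA ler_wpM2l ?(ltW e0)//.
    by apply: ler_pM => //; exact: growth.
  have Rinc := hdr _ _ (u (p n)) _ Kp tn0 h0 hr hT ua.
  have Uinc i : `|u (p n.+1) 0 i - u (p n) 0 i - h * accel i (p n)| <= h * e.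
    rewrite {1}/p nS /=; case: (ord3_cases i) => ->.
    - exact: hdu0 Kp tn0 h0 h1 hT ua.
    - exact: hdu1 Kp tn0 h0 h2 hT ua.
    - exact: hdu2 Kp tn0 h0 h3 hT ua.
  split=> [i||i|i].
  - rewrite /= !mxE addrAC nS mulrDl; apply: le_trans (ler_normD _ _) _.
    by rewrite lerD// normrM (gtr0_norm h0) ler_wpM2l ?(ltW h0).
  - move: Rinc; rewrite -/(p n) TE// => /ler_normlP[_ Rinc].
    have rB : rho (p n) * B (p n) <= rho (p n) * M.
      rewrite ler_wpM2l// (le_trans (ler_norm _))//.
      by have := hM _ Kp; rewrite /= clamp_time_id.
    have step : rho (p n.+1) <= (1 + h * M) * rho (p n) + h * e.
      rewrite {1}/p nS /=.
      have : h * (rho (p n) * B (p n)) <= h * (rho (p n) * M) by rewrite ler_wpM2l ?(ltW h0).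
      move: Rinc; rewrite /p /= => Rinc {}/(lin _ _ _ _ _ Rinc).
      by congr (_ <= _); ring.
    apply: le_trans step _; rewrite nS.
    have g1 : 1 <= (1 + h * M) ^+ n.+1 by rewrite exprn_ege1// lerDl mulr_ge0// ltW.
    have g0 : 0 <= 1 + h * M by rewrite addr_ge0// mulr_ge0// ltW.
    have q1 : (1 + h * M) * rho (p n) <= (1 + h * M) * (e * (n%:R * h) * (1 + h * M) ^+ n).
      by rewrite ler_wpM2l.
    have q2 : h * e * 1 <= h * e * (1 + h * M) ^+ n.+1 by rewrite ler_wpM2l// mulr_ge0// ltW.
    have -> : e * (n%:R * h + h) * (1 + h * M) ^+ n.+1 =
      (1 + h * M) * (e * (n%:R * h) * (1 + h * M) ^+ n) + h * e * (1 + h * M) ^+ n.+1.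
      by rewrite exprS; ring.
    by apply: lerD => //; rewrite -[leLHS]mulr1.
  - have aeta := hkap i _ Kp sp rk.
    have -> : u (p n.+1) 0 i - v 0 i = (u (p n) 0 i - v 0 i)
       + ((u (p n.+1) 0 i - u (p n) 0 i - h * accel i (p n)) + h * accel i (p n)) by ring.
    apply: le_trans (ler_normD _ _) _; rewrite nS mulrDl; apply: lerD => //.
    apply: le_trans (ler_normD _ _) _; have -> : h * (2 * eta) = h * eta + h * eta by ring.
    apply: lerD.
      by apply: le_trans (Uinc i) _; rewrite ler_wpM2l ?(ltW h0).
    by rewrite normrM (gtr0_norm h0) ler_wpM2l ?(ltW h0)// ltW.
  - have -> : X n.+1 0 i - x0 0 i - n.+1%:R * h * v 0 i = (X n 0 i - x0 0 i - n%:R * h * v 0 i)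
       + h * (u (p n) 0 i - v 0 i).
      by rewrite nS /= !mxE; ring.
    apply: le_trans (ler_normD _ _) _; rewrite nS mulrDl; apply: lerD => //.
    rewrite normrM (gtr0_norm h0) ler_wpM2l ?(ltW h0)//; apply: le_trans (I3 i) _.
    by rewrite ler_wpM2r// mulr_ge0// ltW.
(* The last node has time exactly [t] and lies within [d] of [pt], where the density must exceed
   [rho pt / 2]. *)
have [_ Hr _ HX] := main N (leqnn N).
have rN : rho (p N) < rho pt / 2.
  apply: le_lt_trans eCr; apply: le_trans Hr _; rewrite /C -mulrA ler_wpM2l ?(ltW e0)//.
  by rewrite Nh; apply: ler_pM => //; [exact: ltW|exact: ltW|exact: growth].
have : ball pt d (p N).
  rewrite /p Nh; apply: spacetime_ball => //; first by rewrite subrr normr0.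
  move=> i; rewrite !mxE distrC opprD addrA; apply: le_lt_trans (_ : T * (T * (2 * eta)) < d).
    have := HX i; rewrite Nh => HXi; apply: le_trans HXi _; rewrite ler_wpM2r ?(ltW tT)//.
    by apply: mulr_ge0; [exact: ltW|apply: mulr_ge0 => //; exact: ltW].
  have -> : T * (T * (2 * eta)) = d / 2 by rewrite /eta; field; rewrite gt_eqF.
  by rewrite ltr_pdivrMr// ltr_pMr// ltr1n.
move=> /hd /=; rewrite !clamp_time_id//; last exact: stn.
rewrite ltr_distlC => /andP[+ _]; rewrite ltrBlDr => h4.
have h5 : rho (p N) + rho pt / 2 < rho pt / 2 + rho pt / 2 by rewrite ltrD2r.
by have := lt_trans h4 h5; rewrite -splitr ltxx.
Qed.

Lemma slab_cts_line (f : spacetime R -> R) (x0 v : space R) : slab_cts T f ->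
  (forall t, 0 < t < T -> f (t, x0 + t *: v) = 0) ->
  forall t, 0 <= t <= T -> f (t, x0 + t *: v) = 0.
Proof.
(* The restriction to the line is viewed as a spacetime function independent of position, so that
   passage from the open to the closed slab applies to it. *)
move=> cf f0 t tT; pose g (p : spacetime R) := f (clamp_time T (p.1, x0 + p.1 *: v)).
have cg : slab_cts T g.
  apply: slab_cts_continuous => p.
  apply: (@continuous_comp _ _ _ (fun p : spacetime R => (p.1, x0 + p.1 *: v)) (f \o clamp_time T)); last exact: cf.
  apply: continuous_pair => q; first exact: cvg_fst.
  apply: (@continuousD R _ _ (fun=> x0) (fun p : spacetime R => p.1 *: v)); first exact: cst_continuous.
  by apply: (@continuous_comp _ _ _ fst (fun s : R => s *: v)); [exact: cvg_fst|exact: scalel_continuous].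
have g0 p : open_slab T p -> g p = 0.
  case: p => s y sT; rewrite /g clamp_time_id; last exact: (@open_slabW _ T (s, x0 + s *: v) sT).
  exact: f0.
have := slab_cts_closure T0 cg (@slab_cts_cst _ T 0) g0 (p := (t, 0)) tT.
by rewrite /g clamp_time_id.
Qed.

Lemma vacuum_line (x0 v : space R) (t : R) : rho (0, x0) = 0 -> u (0, x0) = v ->
  0 <= t <= T -> rho (t, x0 + t *: v) = 0.
Proof.
move=> r0 uv; apply: slab_cts_line => [|s]; first by have [] := C1_rho T0 rs.
exact: vacuum_line_lt.
Qed.

(** The minimum argument works at interior times; at times 0 and [T] no full neighbourhood with
    [rho >= 0] is available, and continuity of the derivatives takes over. *)
Lemma vacuum_line_partials (x0 v : space R) (t : R) o : rho (0, x0) = 0 -> u (0, x0) = v ->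
  0 <= t <= T -> Dr o (t, x0 + t *: v) = 0.
Proof.
move=> r0 uv; apply: slab_cts_line => [|s sT]; first by have [_ + _] := C1_rho T0 rs; apply.
by apply: (vacuum_partials T0 rs) => //; exact: vacuum_line_lt.
Qed.

End vacuum.

(** * Conservation laws on the moving region *)

Section mask.
Context {R : realType}.
Variables (T : R) (T0 : 0 < T) (A : set (space R)) (v : space R) (oA : open A).

Definition moving : set (spacetime R) := [set p | A (p.2 - p.1 *: v)].
Definition comoving_boundary (p : spacetime R) := (closure A `\` A) (p.2 - p.1 *: v).
Definition mask (f : spacetime R -> R) (p : spacetime R) : R := \1_moving p * f p.

Lemma continuous_comoving : continuous (fun p : spacetime R => p.2 - p.1 *: v).
Proof.
move=> p; apply: (@continuousB R _ _ snd (fun p : spacetime R => p.1 *: v)); first exact: cvg_snd.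
by apply: (@continuous_comp _ _ _ fst (fun s : R => s *: v)); [exact: cvg_fst|exact: scalel_continuous].
Qed.

Lemma mask_in f p : moving p -> mask f p = f p.
Proof. by move=> Ap; rewrite /mask indicE mem_set// mul1r. Qed.

Lemma mask_out f p : ~ moving p -> mask f p = 0.
Proof. by move=> Ap; rewrite /mask indicE memNset// mul0r. Qed.

Lemma mask_abs_le f p : `|mask f p| <= `|f p|.
Proof.
have [h|h] := pselect (moving p); first by rewrite mask_in.
by rewrite mask_out// normr0.
Qed.

Lemma open_moving : open moving.
Proof. by move: oA; apply: open_comp => p _; exact: continuous_comoving. Qed.

Lemma near_moving p : moving p -> \forall q \near p, moving q.
Proof. by move=> mp; exact: open_nbhs_nbhs (conj open_moving mp). Qed.

Lemma near_not_moving p : ~ moving p -> ~ comoving_boundary p -> \forall q \near p, ~ moving q.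
Proof.
move=> nm nb.
have oc : open [set q : spacetime R | (~` closure A) (q.2 - q.1 *: v)].
  have : open (~` closure A) by exact/closed_openC/closed_closure.
  by apply: open_comp => q _; exact: continuous_comoving.
have pc : [set q : spacetime R | (~` closure A) (q.2 - q.1 *: v)] p by move=> cA; apply: nb.
have := open_nbhs_nbhs (conj oc pc).
by apply: filterS => q /= nc mq; apply: nc; exact: subset_closure.
Qed.

Lemma mask_cts f : slab_cts T f -> (forall p, slab T p -> comoving_boundary p -> f p = 0) ->
  slab_cts T (mask f).
Proof.
move=> cf f0 p.
have scl q : slab T (clamp_time T q) by exact: clamp_slab (ltW T0).
have ccl := continuous_clamp_time (T := T) (x := p).
have [h|h] := pselect (moving (clamp_time T p)).
  apply: (@cvg_trans _ ((f \o clamp_time T) @ p)); last by rewrite /continuous_at /= mask_in//; exact: cf.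
  have H : \forall q \near p, moving (clamp_time T q) by exact: (ccl _ (near_moving h)).
  by apply: near_eq_cvg; apply: filterS H => q /= mq; rewrite mask_in.
have [hb|hb] := pselect (comoving_boundary (clamp_time T p)); last first.
  rewrite /continuous_at /= mask_out//.
  apply: (@cvg_trans _ ((fun=> 0) @ p)); last exact: (@cst_continuous _ R 0 p).
  have H : \forall q \near p, ~ moving (clamp_time T q) by exact: (ccl _ (near_not_moving h hb)).
  by apply: near_eq_cvg; apply: filterS H => q /= mq; rewrite mask_out.
rewrite /continuous_at /= mask_out//; apply/cvgr0Pnorm_lt => e e0.
have := cf p; rewrite /continuous_at /= f0// => /cvgr0Pnorm_lt /(_ e e0).
by apply: filterS => q /=; apply: le_lt_trans; exact: mask_abs_le.
Qed.

(** Away from the moving boundary the cut-off field is locally [f] or 0. On that boundary [f] and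
    its derivatives vanish and [|mask f| <= |f|], so the cut-off field has zero derivatives as well,
    whatever the shape of the boundary. *)
Lemma C1_with_mask f D : C1_with T f D ->
  (forall p, slab T p -> comoving_boundary p -> f p = 0 /\ forall o, D o p = 0) ->
  C1_with T (mask f) (fun o => mask (D o)).
Proof.
move=> [cf cD df] f0; split=> [|o|o p sp].
- by apply: mask_cts => // p sp /(f0 _ sp)[].
- by apply: mask_cts => // p sp /(f0 _ sp)[].
have [h|h] := pselect (moving p).
  rewrite mask_in//; apply: near_eq_is_derive (df o p sp).
  by apply: filterS (near_moving h) => q mq; rewrite mask_in.
rewrite mask_out//.
have [hb|hb] := pselect (comoving_boundary p); last first.
  apply: (@near_eq_is_derive _ _ _ (cst 0)).
  by apply: filterS (near_not_moving h hb) => q mq; rewrite mask_out.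
have [fp Dp] := f0 p (open_slabW sp) hb.
have dfp := df o p sp; rewrite Dp in dfp.
apply: (is_derive_dominated0 (C := 1) dfp fp); first by rewrite mask_out.
by near=> q; rewrite mul1r mask_abs_le.
Unshelve. all: by end_near.
Qed.

Lemma mask_supp (L : R) f : (forall x, A x -> forall i, `|x 0 i| <= L) ->
  x_supp T (L + T * \sum_i `|v 0 i|) (mask f).
Proof.
move=> bA t x /andP[t0 tT] [i hi]; apply: mask_out => /bA /(_ i); rewrite !mxE => h.
have : `|x 0 i| <= L + T * `|v 0 i|.
  rewrite -[x 0 i](subrK (t * v 0 i)); apply: le_trans (ler_normD _ _) _.
  by rewrite lerD// normrM ger0_norm// ler_wpM2r.
rewrite leNgt => /negP; apply; apply: le_lt_trans hi; rewrite lerD2l ler_wpM2l ?(ltW T0)//.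
by rewrite (bigD1 i)//= lerDl sumr_ge0.
Qed.

Definition pairing F0 (F : 'I_3 -> spacetime R -> R) (Dphi : option 'I_3 -> spacetime R -> R) p :=
  mask F0 p * Dphi None p + \sum_(j < 3) mask (F j) p * Dphi (Some j) p.

(* As the fields vanish on the comoving boundary, [phi] needs no compact support. *)
Lemma conservation_pairing (L : R) F0 D0 (F : 'I_3 -> spacetime R -> R) D phi Dphi :
  (forall x, A x -> forall i, `|x 0 i| <= L) ->
  C1_with T F0 D0 -> (forall j, C1_with T (F j) (D j)) -> C1_with T phi Dphi ->
  (forall p, open_slab T p -> D0 None p + \sum_(j < 3) D j (Some j) p = 0) ->
  (forall p, slab T p -> comoving_boundary p -> F0 p = 0 /\ forall o, D0 o p = 0) ->
  (forall j p, slab T p -> comoving_boundary p -> F j p = 0 /\ forall o, D j o p = 0) ->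
  [/\ slab_cts T (pairing F0 F Dphi),
      x_supp T (L + T * \sum_i `|v 0 i|) (pairing F0 F Dphi) &
      slab_int T (pairing F0 F Dphi) = space_int (fun x => mask F0 (T, x) * phi (T, x)) -
        space_int (fun x => mask F0 (0, x) * phi (0, x))].
Proof.
move=> bA hF0 hF hphi pde z0 z.
have [c0 cD0 d0] := C1_with_M (C1_with_mask hF0 z0) hphi.
have hj j := C1_with_M (C1_with_mask (hF j) (z j)) hphi.
have cj j : slab_cts T (fun p => mask (D j (Some j)) p * phi p + mask (F j) p * Dphi (Some j) p).
  by have [_ /(_ (Some j))] := hj j.
have dj j p : open_slab T p -> is_derive p (dir_x j) (fun p => mask (F j) p * phi p)
    (mask (D j (Some j)) p * phi p + mask (F j) p * Dphi (Some j) p).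
  by move=> sp; have [_ _ /(_ (Some j) p sp)] := hj j.
have sm f := @mask_supp L f bA.
have cm f Df : C1_with T f Df ->
    (forall p, slab T p -> comoving_boundary p -> f p = 0 /\ forall o, Df o p = 0) ->
    slab_cts T (mask f).
  by move=> hf zf; have [] := C1_with_mask hf zf.
have cphi o : slab_cts T (Dphi o) by have [_ + _] := hphi; apply.
split.
- apply: slab_ctsD; first by apply: slab_ctsM => //; exact: cm hF0 z0.
  by apply: slab_cts_sum => j; apply: slab_ctsM => //; exact: cm (hF j) (z j).
- by apply: x_suppD; [exact: x_suppMl|apply: x_supp_sum => j; exact: x_suppMl].
have := @slab_int_div _ T T0 (L + T * \sum_i `|v 0 i|) (fun p => mask F0 p * phi p)
  (fun p => mask (D0 None) p * phi p + mask F0 p * Dphi None p)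
  (fun j p => mask (F j) p * phi p)
  (fun j p => mask (D j (Some j)) p * phi p + mask (F j) p * Dphi (Some j) p)
  c0 (cD0 None) cj (x_suppMl _ (sm _)) _ (fun j => x_suppMl _ (sm _)) _ (d0 None) dj.
move=> <-.
- apply: slab_int_eq => p sp; rewrite /pairing big_split /=.
  (* The terms containing [phi] undifferentiated add up to the masked pointwise equation. *)
  have E : mask (D0 None) p + \sum_(j < 3) mask (D j (Some j)) p = 0.
    by rewrite /mask -mulr_sumr -mulrDr pde// mulr0.
  rewrite addrACA -mulr_suml -mulrDl E mul0r add0r//.
- by apply: x_suppD; exact: x_suppMl.
- by move=> j; apply: x_suppD; exact: x_suppMl.
Qed.

End mask.

(** * The virial identity and the bound on the lifespan *)

Section test_factors.
Context {R : realType}.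
Variable T : R.

Lemma C1_linear (l : spacetime R -> R) : continuous l ->
  (forall (h : R) v x, l (h *: v + x) = h * l v + l x) ->
  C1_with T l (fun o _ => l (dir o)).
Proof.
move=> cl ll; split=> [|o|o p _]; first exact: slab_cts_continuous.
  exact: slab_cts_cst.
exact: is_derive_dual.
Qed.

Lemma C1_time_poly (q : {poly R}) :
  C1_with T (fun p => q.[p.1]) (fun o p => if o is None then q^`().[p.1] else 0).
Proof.
have cq (r : {poly R}) : continuous (fun p : spacetime R => r.[p.1]).
  move=> p; apply: (@continuous_comp _ _ _ fst (horner r)); first exact: cvg_fst.
  exact: continuous_horner.
split=> [|o|o p _].
- exact: slab_cts_continuous.
- by case: o => [j|]; [exact: slab_cts_cst|exact: slab_cts_continuous].
have d1 := @is_derive_dual R _ (fst : spacetime R -> R) (fun h v x => erefl) p (dir o).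
have := @is_derive_comp1 R _ fst (horner q) p (dir o) _ _ d1 (is_derive_poly q p.1).
by case: o {d1} => [j|] /=; rewrite ?mulr1 ?mulr0.
Qed.

Variable v : space R.
Definition comoving i (p : spacetime R) : R := p.2 0 i - p.1 * v 0 i.

Lemma C1_comoving i :
  C1_with T (comoving i) (fun o _ => if o is Some j then (i == j)%:R else - v 0 i).
Proof.
have cl : continuous (comoving i).
  move=> p; apply: (@continuousB R _ _ (fun p : spacetime R => p.2 0 i) (fun p : spacetime R => p.1 * v 0 i)).
    by apply: (@continuous_comp _ _ _ snd (fun x : space R => x 0 i)); [exact: cvg_snd|exact: coord_continuous].
  by apply: continuousM; [exact: cvg_fst|exact: cst_continuous].
have ll (h : R) w x : comoving i (h *: w + x) = h * comoving i w + comoving i x.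
  rewrite /comoving /= !mxE (_ : h *: w.1 + x.1 = h * w.1 + x.1 :> R)//; ring.
have [c1 c2 c3] := C1_linear cl ll.
have E o : comoving i (dir o) = if o is Some j then (i == j)%:R else - v 0 i.
  by case: o => [j|]; rewrite /comoving /= !mxE ?mul0r ?subr0 ?mul1r ?sub0r ?eqxx.
by split=> [//|o|o p sp]; rewrite -E; [exact: c2|exact: c3].
Qed.

Definition half_sq (p : spacetime R) : R := (\sum_(i < 3) comoving i p ^+ 2) / 2.
Definition drift (p : spacetime R) : R := \sum_(i < 3) v 0 i * comoving i p.

Lemma C1_drift : C1_with T drift (fun o _ => if o is Some j then v 0 j else - sqnorm v).
Proof.
have := C1_with_sum (fun i => C1_with_M (C1_with_cst T (v 0 i)) (C1_comoving i)).
move=> [c1 c2 c3].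
have E o p : \sum_(i < 3) (0 * comoving i p + v 0 i * (if o is Some j then (i == j)%:R else - v 0 i))
    = (if o is Some j then v 0 j else - sqnorm v).
  case: o => [j|].
    rewrite (bigD1 j)//= eqxx mul0r add0r mulr1 big1 ?addr0// => i /negbTE ->.
    by rewrite mul0r mulr0 add0r.
  by rewrite /sqnorm -sumrN; apply: eq_bigr => i _; rewrite mul0r add0r mulrN expr2.
split=> [//|o|o p sp].
  by move: (c2 o); congr slab_cts; apply/funext => p; exact: E.
by have := c3 o p sp; rewrite E.
Qed.

Lemma C1_half_sq :
  C1_with T half_sq (fun o p => if o is Some j then comoving j p else - drift p).
Proof.
have := C1_with_M (C1_with_sum (fun i => C1_with_M (C1_comoving i) (C1_comoving i))) (C1_with_cst T 2^-1).
move=> [c1 c2 c3].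
have E0 : (fun p => (\sum_(i < 3) comoving i p * comoving i p) / 2) = half_sq.
  by apply/funext => p; congr (_ / _); apply: eq_bigr => i _; rewrite expr2.
have E o p : (\sum_(i < 3) ((if o is Some j then (i == j)%:R else - v 0 i) * comoving i p +
     comoving i p * (if o is Some j then (i == j)%:R else - v 0 i))) / 2 +
     (\sum_(i < 3) comoving i p * comoving i p) * 0
    = (if o is Some j then comoving j p else - drift p).
  rewrite mulr0 addr0; case: o => [j|].
    rewrite (bigD1 j)//= eqxx mul1r mulr1 big1 ?addr0 => [|i /negbTE ->].
      by field.
    by rewrite mul0r mulr0 add0r.
  rewrite /drift -sumrN mulr_suml; apply: eq_bigr => i _.
  by field.
rewrite E0 in c1 c3.
split=> [//|o|o p sp].
  by move: (c2 o); congr slab_cts; apply/funext => p; exact: E.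
by have := c3 o p sp; rewrite E.
Qed.

(* The antiderivative of [t^2 (T - t)^2] that vanishes at [T]. *)
Definition eta : {poly R} :=
  (T ^+ 2 / 3) *: 'X^3 - (T / 2) *: 'X^4 + 5^-1 *: 'X^5 - (T ^+ 5 / 30)%:P.

Lemma eta_T : eta.[T] = 0.
Proof. by rewrite /eta !(hornerD, hornerN, hornerZ, hornerMn, hornerXn, hornerX, hornerC); field. Qed.

(** The number [T^5 / 30] is the Beta integral of [t^2 (T - t)^2] over [[0, T]]. *)
Lemma eta_0 : eta.[0] = - (T ^+ 5 / 30).
Proof. by rewrite /eta !(hornerD, hornerN, hornerZ, hornerMn, hornerXn, hornerX, hornerC); ring. Qed.

Lemma eta1E : eta^`() = T ^+ 2 *: 'X^2 - (2 * T) *: 'X^3 + 'X^4.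
Proof.
rewrite /eta derivB derivD derivB !derivZ !derivXn derivC subr0 /=.
rewrite -!scalerMnr !scalerMnl.
by rewrite -['X^4 in RHS]scale1r; congr (_ *: _ - _ *: _ + _ *: _); rewrite /GRing.scale/=; field.
Qed.

Lemma eta2E : eta^`()^`() = (2 * T ^+ 2) *: 'X - (6 * T) *: 'X^2 + 4 *: 'X^3.
Proof.
rewrite eta1E derivD derivB !derivZ !derivXn /=.
rewrite -!scalerMnr !scalerMnl -['X^3 *+ 4]scaler_nat.
by congr (_ *: _ - _ *: _ + _); rewrite ?/GRing.scale/=; ring.
Qed.

Lemma eta3E : eta^`()^`()^`() = (2 * T ^+ 2)%:P - (12 * T) *: 'X + 12 *: 'X^2.
Proof.
rewrite eta2E derivD derivB !derivZ !derivXn derivX /=.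
rewrite -!scalerMnr !scalerMnl alg_polyC.
by congr (_ - _ *: _ + _ *: _); rewrite ?/GRing.scale/=; ring.
Qed.

Lemma eta1_horner t : eta^`().[t] = t ^+ 2 * (T - t) ^+ 2.
Proof. by rewrite eta1E !(hornerD, hornerN, hornerZ, hornerXn); ring. Qed.

(** This shape of [chi''] shows the bound [2 T^2] on [[0, T]]. *)
Lemma eta3_horner t : eta^`()^`()^`().[t] = 2 * T ^+ 2 - 12 * t * (T - t).
Proof. by rewrite eta3E !(hornerD, hornerN, hornerZ, hornerXn, hornerX, hornerC); ring. Qed.

End test_factors.

(** * Balance laws for the moving mass group *)

Section moving_group.
Context {R : realType}.
Variables (k gamma c : R) (hk : 0 < k) (hgamma : 1 <= gamma) (hc : 0 < c).
Variables (T : R) (T0 : 0 < T) (rho0 : space R -> R) (u0 : space R -> space R).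
Variables (rho : spacetime R -> R) (u : spacetime R -> space R).
Hypothesis rs : regular_solution k gamma c rho0 u0 T rho u.
Variables (A : set (space R)) (v : space R) (L : R).
Hypothesis oA : open A.
Hypothesis bA : forall x, A x -> forall i, `|x 0 i| <= L.
Hypothesis vacA : forall x, (closure A `\` A) x -> rho0 x = 0 /\ u0 x = v.

Local Notation P := (fun p => pressure k gamma (rho p)).
Local Notation S := (fun p => rho_tilde k gamma c (rho p) (u p)).
Local Notation E := (fun p => mass_energy k gamma c (rho p) (u p)).
Local Notation m i := (fun p => rho_tilde k gamma c (rho p) (u p) * u p 0 i).
Local Notation F i j := (stress k gamma c rho u i j).
Local Notation msk := (mask A v).
Local Notation Lv := (L + T * \sum_i `|v 0 i|).

Lemma boundary_vacuum p : slab T p -> comoving_boundary A v p ->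
  rho p = 0 /\ forall o, partials T rho o p = 0.
Proof.
case: p => t x sp hb; have [r0 uv] := vacA hb; have [i1 i2] := rs_initial rs (x - t *: v).
have E0 : x = (x - t *: v) + t *: v by rewrite subrK.
rewrite /= in r0 uv; rewrite r0 in i1; rewrite uv in i2.
by split=> [|o]; rewrite E0; [exact: (vacuum_line hk hgamma hc T0 rs i1 i2)|
  exact: (vacuum_line_partials hk hgamma hc T0 rs o i1 i2)].
Qed.

Lemma boundary_fields p : slab T p -> comoving_boundary A v p ->
  [/\ P p = 0, forall o, DP k gamma T rho o p = 0, S p = 0 &
      forall o, DS k gamma c T rho u o p = 0].
Proof.
move=> sp hb; have [r0 dr] := boundary_vacuum sp hb.
have g0 : gamma != 0 by rewrite gt_eqF// (lt_le_trans _ hgamma).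
have p0 : P p = 0 by rewrite /pressure r0 powR0// mulr0.
have dp o : DP k gamma T rho o p = 0 by rewrite /DP dr mulr0.
have s0 : S p = 0 by rewrite /rho_tilde p0 r0 mul0r addr0 mul0r.
by split=> // o; rewrite /DS dr dp s0 !mul0r subr0 addr0 mul0r.
Qed.

Lemma boundary_energy p : slab T p -> comoving_boundary A v p ->
  E p = 0 /\ forall o, DE k gamma c T rho u o p = 0.
Proof.
move=> sp hb; have [p0 dp s0 ds] := boundary_fields sp hb.
split=> [|o]; last by rewrite /DE ds dp mul0r subr0.
by rewrite (mass_energyE hc rs sp) s0 p0 mul0r subr0.
Qed.

Lemma boundary_momentum i p : slab T p -> comoving_boundary A v p ->
  m i p = 0 /\ forall o, DS k gamma c T rho u o p * u p 0 i
    + S p * partials T (fun q => u q 0 i) o p = 0.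
Proof.
move=> sp hb; have [p0 dp s0 ds] := boundary_fields sp hb.
by split=> [|o]; rewrite s0 ?ds !mul0r ?addr0.
Qed.

Lemma boundary_stress i j p : slab T p -> comoving_boundary A v p ->
  F i j p = 0 /\ forall o, Dstress k gamma c T rho u i j o p = 0.
Proof.
move=> sp hb; have [p0 dp s0 ds] := boundary_fields sp hb.
by split=> [|o]; rewrite /stress /Dstress s0 ?p0 ?ds ?dp !(mul0r, mulr0, addr0).
Qed.

Definition energy_pairing := pairing A v E (fun j p => m j p).
Definition momentum_pairing i := pairing A v (m i) (fun j p => F i j p).

Lemma energy_pairingP phi Dphi : C1_with T phi Dphi ->
  [/\ slab_cts T (energy_pairing Dphi), x_supp T Lv (energy_pairing Dphi) &
      slab_int T (energy_pairing Dphi) = space_int (fun x => msk E (T, x) * phi (T, x)) -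
        space_int (fun x => msk E (0, x) * phi (0, x))].
Proof.
move=> hphi; apply: (conservation_pairing T0 oA bA (C1_mass_energy hk hgamma hc T0 rs)
  (C1_momentum hk hgamma hc T0 rs) hphi (energy_eq hk hgamma hc T0 rs)).
- exact: boundary_energy.
- exact: boundary_momentum.
Qed.

Lemma momentum_pairingP i phi Dphi : C1_with T phi Dphi ->
  [/\ slab_cts T (momentum_pairing i Dphi), x_supp T Lv (momentum_pairing i Dphi) &
      slab_int T (momentum_pairing i Dphi) = space_int (fun x => msk (m i) (T, x) * phi (T, x)) -
        space_int (fun x => msk (m i) (0, x) * phi (0, x))].
Proof.
move=> hphi; apply: (conservation_pairing T0 oA bA (C1_momentum hk hgamma hc T0 rs i)
  (C1_stress hk hgamma hc T0 rs i) hphi (momentum_eq hk hgamma hc T0 rs i)).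
- exact: boundary_momentum.
- exact: boundary_stress.
Qed.

Lemma initial_mask_integrable f : slab_cts T f ->
  (forall p, slab T p -> comoving_boundary A v p -> f p = 0) ->
  mu3.-integrable setT (EFin \o ((fun x => msk f (0, x)) \o @vec3 R)).
Proof.
move=> cf f0; have t0 : (0 : R) <= 0 <= T by rewrite lexx ltW.
apply: (@space_integrable _ Lv).
  by apply: (slab_cts_at (T := T)) => //; exact: mask_cts.
by move=> x hx; exact: (mask_supp T0 f bA t0 hx).
Qed.

Lemma initial_maskE f g : (forall x, f (0, x) = g x) ->
  (fun x => msk f (0, x)) = (fun x => \1_A x * g x).
Proof.
move=> fg; apply/funext => x; rewrite /mask fg; congr (_ * _).
have mE : moving A v (0, x) = A x by rewrite /moving /= scale0r subr0.
by rewrite !indicE; congr (nat_of_bool (asbool _))%:R.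
Qed.

Lemma integral_space_mask (g : space R -> R) :
  integral_space A g = (\int[mu3]_x (\1_A (vec3 x) * g (vec3 x))%:E)%E.
Proof.
rewrite integral_spaceE [LHS]integral_mkcond; apply: eq_integral => x _.
rewrite /patch indicE; have [h|h] := pselect (A (vec3 x)).
  by rewrite !mem_set// mul1r.
by rewrite !memNset// mul0r.
Qed.

Hypothesis momA : forall i, integral_space A
  (fun x => rho_tilde k gamma c (rho0 x) (u0 x) * u0 x 0 i) = 0%E.
Hypothesis massA : (0 < integral_space A rho0)%E.

(** Built from the initial data alone, so that bounds expressed through it are common to all
    solutions and all [T]. *)
Definition initial_energy : R :=
  space_int (fun x => \1_A x * mass_energy k gamma c (rho0 x) (u0 x)).

Lemma initial_energyE : space_int (fun x => msk E (0, x)) = initial_energy.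
Proof.
rewrite (@initial_maskE _ (fun x => mass_energy k gamma c (rho0 x) (u0 x)))// => x.
by have [-> ->] := rs_initial rs x.
Qed.

Lemma initial_momentumE i : space_int (fun x => msk (m i) (0, x)) = 0.
Proof.
rewrite (@initial_maskE _ (fun x => rho_tilde k gamma c (rho0 x) (u0 x) * u0 x 0 i)).
  by have := integral_space_mask (fun x => rho_tilde k gamma c (rho0 x) (u0 x) * u0 x 0 i); rewrite momA => h; exact: (congr1 fine (esym h)).
by move=> x; have [-> ->] := rs_initial rs x.
Qed.

Lemma slab_initial x : slab T (0, x).
Proof. by rewrite /slab /= lexx ltW. Qed.

Lemma energy_ge p : slab T p -> rho p <= E p.
Proof.
move=> sp; rewrite /= (mass_energyE2 hc rs sp) lerDl divr_ge0 ?exprn_ge0 ?(ltW hc)//.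
by rewrite mulr_ge0 ?(rho_tilde_ge0 hk hc rs)// sumr_ge0// => i _; exact: sqr_ge0.
Qed.

Lemma initial_energy_gt0 : 0 < initial_energy.
Proof.
have [cr _ _] := C1_rho T0 rs; have [cE _ _] := C1_mass_energy hk hgamma hc T0 rs.
have ir := @initial_mask_integrable rho cr (fun p sp hb => (boundary_vacuum sp hb).1).
have iE := @initial_mask_integrable E cE (fun p sp hb => (boundary_energy sp hb).1).
rewrite -initial_energyE; apply: (@lt_le_trans _ _ (space_int (fun x => msk rho (0, x)))).
  have h := massA; rewrite integral_space_mask in h.
  have rE : (fun x => msk rho (0, x)) = (fun x => \1_A x * rho0 x).
    by apply: initial_maskE => x; have [-> _] := rs_initial rs x.
  rewrite rE /space_int /Rintegral; rewrite rE in ir.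
  (* A positive mass could still be [+oo], which [fine] sends to 0; integrability of the masked
     density excludes this. *)
  by apply: fine_gt0; rewrite h /= ltey_eq; have -> := integrable_fin_num measurableT ir.
apply: le_Rintegral => // x _; rewrite /mask ler_wpM2l ?indicE//.
by apply: energy_ge; exact: slab_initial.
Qed.

End moving_group.

(** * The weighted second moment of the energy *)

Section virial.
Context {R : realType}.
Variables (k gamma c : R) (hk : 0 < k) (hgamma : 1 <= gamma) (hc : 0 < c).
Variables (T : R) (T0 : 0 < T) (rho0 : space R -> R) (u0 : space R -> space R).
Variables (rho : spacetime R -> R) (u : spacetime R -> space R).
Hypothesis rs : regular_solution k gamma c rho0 u0 T rho u.
Variables (A : set (space R)) (v : space R) (L : R).
Hypothesis oA : open A.
Hypothesis bA : forall x, A x -> forall i, `|x 0 i| <= L.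
Hypothesis vacA : forall x, (closure A `\` A) x -> rho0 x = 0 /\ u0 x = v.
Hypothesis momA : forall i, integral_space A
  (fun x => rho_tilde k gamma c (rho0 x) (u0 x) * u0 x 0 i) = 0%E.

Local Notation P := (fun p => pressure k gamma (rho p)).
Local Notation S := (fun p => rho_tilde k gamma c (rho p) (u p)).
Local Notation E := (fun p => mass_energy k gamma c (rho p) (u p)).
Local Notation m i := (fun p => rho_tilde k gamma c (rho p) (u p) * u p 0 i).
Local Notation F i j := (stress k gamma c rho u i j).
Local Notation msk := (mask A v).
Local Notation Lv := (L + T * \sum_i `|v 0 i|).
Local Notation E0 := (initial_energy k gamma c rho0 u0 A).

Lemma space_int_cst0 (f : space R -> R) : (forall x, f x = 0) -> space_int f = 0.
Proof.
by move=> f0; rewrite /space_int /Rintegral integral0_eq// => x _; rewrite f0.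
Qed.

(** Conservation of the total energy in integrated form: the test function depends on time only, so
    no flux appears, and [q.[T] = 0] discards the final time. *)
Lemma energy_time (q : {poly R}) : q.[T] = 0 ->
  [/\ slab_cts T (fun p => msk E p * q^`().[p.1]), x_supp T Lv (fun p => msk E p * q^`().[p.1]) &
      slab_int T (fun p => msk E p * q^`().[p.1]) = - q.[0] * E0].
Proof.
move=> qT; have := energy_pairingP hk hgamma hc T0 rs oA bA vacA (C1_time_poly T q).
have -> : energy_pairing k gamma c rho u A v
    (fun o p => if o is None then q^`().[p.1] else 0) = (fun p => msk E p * q^`().[p.1]).
  by apply/funext => p; rewrite /energy_pairing /pairing big1 ?addr0// => j _; rewrite mulr0.
case=> c1 s1 ->; split=> //=.
rewrite space_int_cst0 => [|x]; last by rewrite qT mulr0.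
rewrite sub0r mulNr; congr (- _).
rewrite -(initial_energyE (k := k) (gamma := gamma) (c := c) rs A v) /space_int mulrC.
rewrite -RintegralZr//.
have [cE _ _] := C1_mass_energy hk hgamma hc T0 rs.
exact: (initial_mask_integrable T0 oA bA cE (fun p sp hb => (boundary_energy hk hgamma hc T0 rs vacA sp hb).1)).
Qed.

Lemma momentum_time i (q : {poly R}) : q.[T] = 0 ->
  [/\ slab_cts T (fun p => msk (m i) p * q^`().[p.1]), x_supp T Lv (fun p => msk (m i) p * q^`().[p.1]) &
      slab_int T (fun p => msk (m i) p * q^`().[p.1]) = 0].
Proof.
move=> qT; have := momentum_pairingP hk hgamma hc T0 rs oA bA vacA i (C1_time_poly T q).
have -> : momentum_pairing k gamma c rho u A v i
    (fun o p => if o is None then q^`().[p.1] else 0) = (fun p => msk (m i) p * q^`().[p.1]).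
  by apply/funext => p; rewrite /momentum_pairing /pairing big1 ?addr0// => j _; rewrite mulr0.
case=> c1 s1 ->; split=> //=.
rewrite space_int_cst0 => [|x]; last by rewrite qT mulr0.
rewrite sub0r; apply/eqP; rewrite oppr_eq0; apply/eqP.
have := initial_momentumE rs v momA i.
rewrite /space_int => h.
rewrite RintegralZr// ?h ?mul0r//.
have [cm _ _] := C1_momentum hk hgamma hc T0 rs i.
exact: (initial_mask_integrable T0 oA bA cm (fun p sp hb => (boundary_momentum hk hgamma hc T0 rs vacA i sp hb).1)).
Qed.

Lemma energy_pairing0 phi Dphi : C1_with T phi Dphi ->
  (forall x, phi (0, x) = 0) -> (forall x, phi (T, x) = 0) ->
  [/\ slab_cts T (energy_pairing k gamma c rho u A v Dphi),
      x_supp T Lv (energy_pairing k gamma c rho u A v Dphi) &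
      slab_int T (energy_pairing k gamma c rho u A v Dphi) = 0].
Proof.
move=> hphi h0 hT; have [c1 s1 ->] := energy_pairingP hk hgamma hc T0 rs oA bA vacA hphi.
split=> //; rewrite !space_int_cst0 ?subrr// => x; first by rewrite h0 mulr0.
by rewrite hT mulr0.
Qed.

Lemma momentum_pairing0 i phi Dphi : C1_with T phi Dphi ->
  (forall x, phi (0, x) = 0) -> (forall x, phi (T, x) = 0) ->
  [/\ slab_cts T (momentum_pairing k gamma c rho u A v i Dphi),
      x_supp T Lv (momentum_pairing k gamma c rho u A v i Dphi) &
      slab_int T (momentum_pairing k gamma c rho u A v i Dphi) = 0].
Proof.
move=> hphi h0 hT; have [c1 s1 ->] := momentum_pairingP hk hgamma hc T0 rs oA bA vacA i hphi.
split=> //; rewrite !space_int_cst0 ?subrr// => x; first by rewrite h0 mulr0.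
by rewrite hT mulr0.
Qed.

Local Notation chi := (fun p : spacetime R => (eta T)^`().[p.1]).
Local Notation chi' := (fun p : spacetime R => (eta T)^`()^`().[p.1]).
Local Notation chi'' := (fun p : spacetime R => (eta T)^`()^`()^`().[p.1]).

Definition virial p := msk E p * (chi'' p * half_sq v p - chi p * sqnorm v)
  - chi p * \sum_(i < 3) msk (F i i) p.

(* With [y = x - t v], the energy equation is tested with [chi' |y|^2 / 2] and [chi y.v],
   the momentum equations with [chi y_i] and [v_i eta]. *)
Lemma virial_identity : [/\ slab_cts T virial, x_supp T Lv virial & slab_int T virial = 0].
Proof.
(* The factored forms show that [chi] and [chi'] vanish at times 0 and [T], so the pairings below
   have no boundary terms. *)
have e1 x : (eta T)^`().[x] = x ^+ 2 * (T - x) ^+ 2 by exact: eta1_horner.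
have e2 x : (eta T)^`()^`().[x] = 2 * x * (T - x) * (T - 2 * x).
  by rewrite eta2E !(hornerD, hornerN, hornerZ, hornerXn, hornerX); ring.
have [c1 s1 i1] := energy_pairing0 (C1_with_M (C1_time_poly T (eta T)^`()^`()) (C1_half_sq T v))
  (fun x => ltac:(by rewrite /= e2 mulr0 !mul0r)) (fun x => ltac:(by rewrite /= e2 subrr mulr0 !mul0r)).
have [c2 s2 i2] := energy_pairing0 (C1_with_M (C1_time_poly T (eta T)^`()) (C1_drift T v))
  (fun x => ltac:(by rewrite /= e1 expr0n/= !mul0r)) (fun x => ltac:(by rewrite /= e1 subrr expr0n/= mulr0 !mul0r)).
have H3 i := momentum_pairing0 i (C1_with_M (C1_time_poly T (eta T)^`()) (C1_comoving T v i))
  (fun x => ltac:(by rewrite /= e1 expr0n/= !mul0r)) (fun x => ltac:(by rewrite /= e1 subrr expr0n/= mulr0 !mul0r)).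
have H4 i := momentum_time i (eta_T T).
set f1 := energy_pairing _ _ _ _ _ _ _ _ in c1 s1 i1.
set f2 := energy_pairing _ _ _ _ _ _ _ _ in c2 s2 i2.
pose f3 i := momentum_pairing k gamma c rho u A v i
   (fun o p => (if o is None then chi' p else 0) * comoving v i p +
      chi p * (if o is Some j then (i == j)%:R else - v 0 i)).
pose f4 i p := msk (m i) p * chi p.
have cf3 i : slab_cts T (f3 i) by have [] := H3 i.
have sf3 i : x_supp T Lv (f3 i) by have [] := H3 i.
have if3 i : slab_int T (f3 i) = 0 by have [] := H3 i.
have cf4 i : slab_cts T (f4 i) by have [] := H4 i.
have sf4 i : x_supp T Lv (f4 i) by have [] := H4 i.
have if4 i : slab_int T (f4 i) = 0 by have [] := H4 i.
clear H3 H4.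
have cc a : slab_cts T (fun=> a) by exact: slab_cts_cst.
(* In [f1 + f2] minus the sum of the [f3 i] all terms with [chi'] cancel, but [2 chi] times the
   momentum along [v] is left over; [f4], of integral 0 because the initial momentum is 0, removes
   it. *)
pose g i p := (-1) * f3 i p + (- 2 * v 0 i) * f4 i p.
have cg i : slab_cts T (g i).
  by apply: slab_ctsD; apply: slab_ctsM.
have sg i : x_supp T Lv (g i).
  by apply: x_suppD; apply: x_suppMr.
have ig i : slab_int T (g i) = 0.
  rewrite (@slab_intD _ _ T0 Lv); [|exact: slab_ctsM|exact: x_suppMr|exact: slab_ctsM|exact: x_suppMr].
  by rewrite !(slab_intZ (T := T) T0 (L := Lv))// if3 if4 !mulr0 addr0.
have -> : virial = (fun p => (f1 p + f2 p) + \sum_(i < 3) g i p).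
  apply/funext => p; rewrite /virial /f1 /f2 /g /f3 /f4 /energy_pairing /momentum_pairing /pairing.
  rewrite !sum3E /=.
  rewrite /drift /sqnorm !sum3E.
  move: (comoving v 0 p) => ?.
  by ring.
split.
- by apply: slab_ctsD; [exact: slab_ctsD|exact: slab_cts_sum].
- by apply: x_suppD; [exact: x_suppD|exact: x_supp_sum].
rewrite (@slab_intD _ _ T0 Lv); [|exact: slab_ctsD|exact: x_suppD|exact: slab_cts_sum|exact: x_supp_sum].
rewrite (@slab_intD _ _ T0 Lv)// i1 i2 (@slab_int_sum _ _ T0 Lv)// big1 ?addr0//.
Qed.

End virial.

(** * Bounds on the lifespan in terms of the data *)

Section lifespan.
Context {R : realType}.
Variables (k gamma c : R) (hk : 0 < k) (hgamma : 1 <= gamma) (hc : 0 < c).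
Variables (T : R) (T0 : 0 < T) (rho0 : space R -> R) (u0 : space R -> space R).
Variables (rho : spacetime R -> R) (u : spacetime R -> space R).
Hypothesis rs : regular_solution k gamma c rho0 u0 T rho u.
Variables (A : set (space R)) (v : space R) (R0 : R).
Hypothesis R0_gt0 : 0 < R0.
Hypothesis oA : open A.
Hypothesis bA : forall x, A x -> enorm x < R0.
Hypothesis vacA : forall x, (closure A `\` A) x -> rho0 x = 0 /\ u0 x = v.
Hypothesis momA : forall i, integral_space A
  (fun x => rho_tilde k gamma c (rho0 x) (u0 x) * u0 x 0 i) = 0%E.
Hypothesis massA : (0 < integral_space A rho0)%E.

Local Notation P := (fun p => pressure k gamma (rho p)).
Local Notation S := (fun p => rho_tilde k gamma c (rho p) (u p)).
Local Notation E := (fun p => mass_energy k gamma c (rho p) (u p)).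
Local Notation F i j := (stress k gamma c rho u i j).
Local Notation msk := (mask A v).
Local Notation Lv := (R0 + T * \sum_i `|v 0 i|).
Local Notation E0 := (initial_energy k gamma c rho0 u0 A).
Local Notation chi := (fun p : spacetime R => (eta T)^`().[p.1]).

Lemma sqnorm_ge0 (x : space R) : 0 <= sqnorm x.
Proof. by rewrite sumr_ge0// => i _; exact: sqr_ge0. Qed.

Lemma sqnorm_ball x : A x -> sqnorm x <= R0 ^+ 2.
Proof.
move=> /bA/ltW; rewrite -(ler_pXn2r (n := 2))// ?nnegrE ?sqrtr_ge0 ?(ltW R0_gt0)//.
by rewrite /enorm sqr_sqrtr ?sqnorm_ge0.
Qed.

Lemma coord_ball x : A x -> forall i, `|x 0 i| <= R0.
Proof.
move=> Ax i; rewrite -(ler_pXn2r (n := 2))// ?nnegrE ?(ltW R0_gt0)//.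
apply: le_trans (sqnorm_ball Ax); rewrite real_normK ?num_real//.
by rewrite /sqnorm (bigD1 i)//= lerDl sumr_ge0// => j _; exact: sqr_ge0.
Qed.

Lemma total_energy : [/\ slab_cts T (msk E), x_supp T Lv (msk E) & slab_int T (msk E) = T * E0].
Proof.
(* The polynomial with derivative 1 that vanishes at [T]; its value [- T] at 0 produces the factor
   [T]. *)
have h0 : ('X - T%:P).[T] = 0 :> R by rewrite !(hornerD, hornerN, hornerX, hornerC) subrr.
have := energy_time hk hgamma hc T0 rs oA coord_ball vacA h0.
have -> : (fun p => msk E p * ('X - T%:P)^`().[p.1]) = msk E.
  by apply/funext => p; rewrite derivB derivX derivC subr0 hornerC mulr1.
by rewrite !(hornerD, hornerN, hornerX, hornerC) sub0r opprK.
Qed.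

Lemma weighted_energy : [/\ slab_cts T (fun p => msk E p * chi p),
  x_supp T Lv (fun p => msk E p * chi p) &
  slab_int T (fun p => msk E p * chi p) = T ^+ 5 / 30 * E0].
Proof.
have := energy_time hk hgamma hc T0 rs oA coord_ball vacA (eta_T T).
by rewrite eta_0 opprK.
Qed.

Lemma E_ge0 p : slab T p -> 0 <= E p.
Proof. by move=> sp; apply: le_trans (energy_ge hk hc rs sp); exact: (rs_rho_ge0 rs). Qed.

Lemma chi_ge0 p : 0 <= chi p.
Proof. by rewrite /= eta1_horner mulr_ge0// sqr_ge0. Qed.

Lemma chi_le p : slab T p -> chi p <= T ^+ 4.
Proof.
case/andP=> t0 tT; rewrite /= eta1_horner (_ : T ^+ 4 = T ^+ 2 * T ^+ 2); last by rewrite -exprD.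
by apply: ler_pM; rewrite ?sqr_ge0// ler_pXn2r// ?nnegrE ?subr_ge0 ?(ltW T0)// gerBl.
Qed.

Lemma moving_sqnorm p : moving A v p -> 0 <= half_sq v p <= R0 ^+ 2 / 2.
Proof.
move=> mp; have := sqnorm_ball mp.
have -> : sqnorm (p.2 - p.1 *: v) = \sum_(i < 3) comoving v i p ^+ 2.
  by apply: eq_bigr => i _; rewrite !mxE.
move=> h; rewrite /half_sq ler_pM2r ?invr_gt0// h andbT divr_ge0// sumr_ge0// => i _.
exact: sqr_ge0.
Qed.

(** On the moving region [|y|^2 / 2 <= R0^2 / 2], and [chi'' <= 2 T^2]. *)
Lemma virial_le p : slab T p -> moving A v p ->
  virial k gamma c T rho u A v p <=
    T ^+ 2 * R0 ^+ 2 * E p - chi p * sqnorm v * E p - chi p * (S p * sqnorm (u p) + 3 * P p).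
Proof.
move=> sp mp; rewrite /virial !mask_in//.
have -> : \sum_(i < 3) msk (F i i) p = S p * sqnorm (u p) + 3 * P p.
  under eq_bigr do rewrite mask_in// /stress eqxx mul1r.
  by rewrite /sqnorm !sum3E; ring.
rewrite lerD2r mulrBr [E p * (_ * sqnorm v)]mulrC lerD2r.
rewrite [E p * _]mulrC; apply: ler_wpM2r; first exact: E_ge0.
have /andP[h0 h1] := moving_sqnorm mp; case/andP: sp => t0 tT; rewrite /= eta3_horner.
set h := half_sq v p in h0 h1 *.
apply: (@le_trans _ _ (2 * T ^+ 2 * h)).
  by rewrite ler_wpM2r// gerBl -mulrA mulr_ge0// mulr_ge0// subr_ge0.
rewrite mulrAC [T ^+ 2 * _]mulrC; apply: ler_wpM2r; first exact: sqr_ge0.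
by move: h1; rewrite ler_pdivlMr// mulrC.
Qed.

Lemma stress_trace_ge0 p : slab T p -> 0 <= S p * sqnorm (u p) + 3 * P p.
Proof.
move=> sp; apply: addr_ge0.
  by apply: mulr_ge0; [exact: (rho_tilde_ge0 hk hc rs)|exact: sqnorm_ge0].
by rewrite mulr_ge0// mulr_ge0 ?powR_ge0// exprn_ge0// ltW.
Qed.

(** Dropping the nonnegative stress trace and integrating gives
    [|v|^2 (T^5 / 30) E0 <= T^2 R0^2 (T E0)]; dividing by the positive [T^3 E0] leaves the bound. *)
Lemma lifespan_moving : 0 < sqnorm v -> T ^+ 2 <= 30 * R0 ^+ 2 / sqnorm v.
Proof.
move=> v0.
have [cX sX iX] := virial_identity hk hgamma hc T0 rs oA coord_ball vacA momA.
have [cE sE iE] := total_energy.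
have [cW sW iW] := weighted_energy.
have E0_gt0 := initial_energy_gt0 hk hgamma hc T0 rs oA coord_ball vacA massA.
have cc a : slab_cts T (fun=> a) by exact: slab_cts_cst.
have c1 : slab_cts T (fun p => T ^+ 2 * R0 ^+ 2 * msk E p) by exact: slab_ctsM.
have s1 : x_supp T Lv (fun p => T ^+ 2 * R0 ^+ 2 * msk E p) by exact: x_suppMr.
have c2 : slab_cts T (fun p => - sqnorm v * (msk E p * chi p)) by exact: slab_ctsM.
have s2 : x_supp T Lv (fun p => - sqnorm v * (msk E p * chi p)) by exact: x_suppMr.
have : slab_int T (virial k gamma c T rho u A v) <=
    slab_int T (fun p => T ^+ 2 * R0 ^+ 2 * msk E p + - sqnorm v * (msk E p * chi p)).
  apply: (@slab_int_le _ _ T0 Lv) => //; [exact: slab_ctsD|exact: x_suppD|].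
  move=> p /open_slabW sp; have [mp|mp] := pselect (moving A v p); last first.
    rewrite /virial !mask_out// big1 => [|i _]; last by rewrite mask_out.
    by rewrite !mulr0 !mul0r mulr0 subr0 addr0.
  apply: le_trans (virial_le sp mp) _; rewrite !mask_in// mulNr.
  rewrite [sqnorm v * _]mulrC -[E p * _ * _]mulrA [E p * _]mulrC gerBl.
  by rewrite mulr_ge0 ?chi_ge0 ?stress_trace_ge0.
rewrite iX (@slab_intD _ _ T0 Lv)// !(slab_intZ (T := T) T0 (L := Lv))// iE iW => H.
have {}H : T ^+ 3 * E0 * (T ^+ 2 * sqnorm v) <= T ^+ 3 * E0 * (30 * R0 ^+ 2).
  move: H; rewrite -(ler_pM2l (_ : 0 < 30))// mulr0 => H; rewrite -subr_ge0.
  apply: le_trans H _; rewrite le_eqVlt; apply/orP; left; apply/eqP; by field.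
by move: H; rewrite ler_pM2l ?mulr_gt0 ?exprn_gt0// ler_pdivlMr.
Qed.

(* If [rho > eps] then [P >= k^2 eps^(gamma-1) rho]. *)
Lemma stress_trace_ge p (kap eps : R) : slab T p -> 0 < eps -> 0 <= kap -> kap <= c ^+ 2 ->
  kap <= 3 * (k ^+ 2 * eps `^ (gamma - 1)) ->
  kap * (E p - eps) <= S p * sqnorm (u p) + 3 * P p.
Proof.
move=> sp e0 k0 kc kP; have r0 := rs_rho_ge0 rs sp.
have -> : E p - eps = S p * sqnorm (u p) / c ^+ 2 + (rho p - eps).
  by rewrite /= (mass_energyE2 hc rs sp); ring.
rewrite mulrDr; apply: lerD.
  have s0 : 0 <= S p * sqnorm (u p).
    by apply: mulr_ge0; [exact: (rho_tilde_ge0 hk hc rs)|exact: sqnorm_ge0].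
  by rewrite mulrCA ler_piMr// ler_pdivrMr ?exprn_gt0// mul1r.
have P0 : 0 <= 3 * P p by rewrite mulr_ge0// mulr_ge0 ?powR_ge0// exprn_ge0// ltW.
have [re|er] := leP (rho p) eps.
  by apply: le_trans P0; rewrite mulr_ge0_le0// subr_le0.
have -> : 3 * P p = 3 * (k ^+ 2 * rho p `^ (gamma - 1)) * rho p.
  by rewrite /pressure -(mulr_powRB1 r0 (lt_le_trans ltr01 hgamma)); ring.
apply: (@le_trans _ _ (kap * rho p)); first by rewrite ler_wpM2l// gerBl ltW.
apply: ler_wpM2r => //; apply: le_trans kP _.
rewrite ler_wpM2l// ler_wpM2l ?exprn_ge0 ?(ltW hk)//.
by apply: ge0_ler_powR; rewrite ?subr_ge0 ?nnegrE ?(ltW e0) ?(ltW er).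
Qed.

(** With [v = 0] the group stays in a fixed cube of side [2 R0]. As [eps * (2 R0)^3 = E0 / 60], the
    low-density loss is at most [kap T^5 E0 / 60], half of the main term [kap (T^5 / 30) E0]. *)
Lemma lifespan_static kap eps : sqnorm v = 0 -> 0 < kap -> kap <= c ^+ 2 ->
  kap <= 3 * (k ^+ 2 * eps `^ (gamma - 1)) -> eps = E0 / (60 * (R0 *+ 2) ^+ 3) ->
  T ^+ 2 <= 60 * R0 ^+ 2 / kap.
Proof.
move=> v0 k0 kc kP epsE.
have [cX sX iX] := virial_identity hk hgamma hc T0 rs oA coord_ball vacA momA.
have [cE sE iE] := total_energy.
have [cW sW iW] := weighted_energy.
have E0_gt0 := initial_energy_gt0 hk hgamma hc T0 rs oA coord_ball vacA massA.
have D0 : 0 < (R0 *+ 2) ^+ 3 by rewrite exprn_gt0// mulrn_wgt0.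
have e0 : 0 < eps by rewrite epsE divr_gt0// mulr_gt0.
have vz i : v 0 i = 0.
  apply/eqP; rewrite -sqrf_eq0; apply/eqP.
  by apply: (psumr_eq0P (fun i _ => sqr_ge0 (v 0 i)) v0).
have cc a : slab_cts T (fun=> a) by exact: slab_cts_cst.
have c1 : slab_cts T (fun p => - (T ^+ 2 * R0 ^+ 2) * msk E p) by exact: slab_ctsM.
have s1 : x_supp T Lv (fun p => - (T ^+ 2 * R0 ^+ 2) * msk E p) by exact: x_suppMr.
have c2 : slab_cts T (fun p => kap * (msk E p * chi p)) by exact: slab_ctsM.
have s2 : x_supp T Lv (fun p => kap * (msk E p * chi p)) by exact: x_suppMr.
have : slab_int T (fun p => virial k gamma c T rho u A v p +
    (- (T ^+ 2 * R0 ^+ 2) * msk E p + kap * (msk E p * chi p)))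
    <= kap * eps * T ^+ 4 * (T * (R0 *+ 2) ^+ 3).
  have out p : ~ moving A v p -> virial k gamma c T rho u A v p +
      (- (T ^+ 2 * R0 ^+ 2) * msk E p + kap * (msk E p * chi p)) = 0.
    move=> mp; rewrite /virial !mask_out// big1 => [|i _]; last by rewrite mask_out.
    by rewrite !(mulr0, mul0r) subr0 !addr0.
  have pos : 0 <= kap * eps * T ^+ 4.
    by rewrite !mulr_ge0 ?exprn_ge0 ?(ltW k0) ?(ltW e0) ?(ltW T0).
  apply: (@slab_int_le_box _ _ T0 Lv) => //; rewrite ?(ltW R0_gt0)//.
  - by apply: slab_ctsD => //; exact: slab_ctsD.
  - by apply: x_suppD => //; exact: x_suppD.
  - move=> p /open_slabW sp _; have [mp|mp] := pselect (moving A v p); last by rewrite out.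
    (* The first summand is nonpositive by [stress_trace_ge]; only the loss [kap * eps * chi]
       remains, with [chi <= T^4]. *)
    apply: (@le_trans _ _ (chi p * (kap * (E p - eps) - (S p * sqnorm (u p) + 3 * P p))
        + kap * eps * chi p)).
      rewrite !mask_in//; move: (virial_le sp mp); rewrite v0 mulr0 mul0r subr0 => H.
      by rewrite -lerBrDr; apply: le_trans H _; rewrite le_eqVlt; apply/orP; left; apply/eqP; ring.
    rewrite -[leRHS]add0r lerD//; last by rewrite ler_wpM2l ?chi_le// mulr_ge0// ltW.
    by rewrite mulr_ge0_le0 ?chi_ge0// subr_le0 stress_trace_ge// ltW.
  - move=> p _ hp; rewrite out// => mp; apply: hp => i.
    by have := coord_ball mp i; rewrite !mxE vz mulr0 subr0.
rewrite (@slab_intD _ _ T0 Lv (virial k gamma c T rho u A v))//; [|exact: slab_ctsD|exact: x_suppD].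
rewrite iX add0r (@slab_intD _ _ T0 Lv)// !(slab_intZ (T := T) T0 (L := Lv))// iE iW => H.
have eD : 60 * (eps * (R0 *+ 2) ^+ 3) = E0.
  by rewrite epsE; field; rewrite gt_eqF.
have {}H : T ^+ 3 * E0 * (T ^+ 2 * kap) <= T ^+ 3 * E0 * (60 * R0 ^+ 2).
  move: H; rewrite -(ler_pM2l (_ : 0 < 60))// => H; rewrite -subr_ge0.
  have -> : T ^+ 3 * E0 * (60 * R0 ^+ 2) - T ^+ 3 * E0 * (T ^+ 2 * kap)
    = T ^+ 5 * kap * (60 * (eps * (R0 *+ 2) ^+ 3)) -
      60 * (- (T ^+ 2 * R0 ^+ 2) * (T * E0) + kap * (T ^+ 5 / 30 * E0)).
    by rewrite eD; field.
  by rewrite subr_ge0; apply: le_trans H _; rewrite le_eqVlt; apply/orP; left; apply/eqP; ring.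
by move: H; rewrite ler_pM2l ?mulr_gt0 ?exprn_gt0// ler_pdivlMr.
Qed.

End lifespan.

Theorem theorem3p3 (R : realType) (k gamma c : R)
    (hk : 0 < k) (hgamma : 1 <= gamma) (hc : 0 < c)
    (rho0 : 'rV[R]_3 -> R) (u0 : 'rV[R]_3 -> 'rV[R]_3)
    (A0 B0 : set 'rV[R]_3)
    (hiso : isolated_mass_group k gamma c rho0 u0 A0 B0) :
  (max_existence_time k gamma c rho0 u0 < +oo)%E.
Proof.
have [[[oA _] _ _] _ nested [R0 R0_gt0 ball] vac mass [v bdry] mom] := hiso.
have bA x : A0 x -> enorm x < R0.
  by move=> Ax; apply: ball; apply: nested; exact: subset_closure.
have vacA x : (closure A0 `\` A0) x -> rho0 x = 0 /\ u0 x = v.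
  move=> [cA nA]; split; first by apply: vac; split=> //; exact: nested.
  by apply: bdry; split=> //; rewrite (interior_id _).1.
pose eps := initial_energy k gamma c rho0 u0 A0 / (60 * (R0 *+ 2) ^+ 3).
(* The first entry of the minimum serves the kinetic part of the energy, the second the pressure at
   densities above [eps]. *)
pose kap := Num.min (c ^+ 2) (3 * (k ^+ 2 * eps `^ (gamma - 1))).
pose K := if sqnorm v == 0 then 60 * R0 ^+ 2 / kap else 30 * R0 ^+ 2 / sqnorm v.
apply: (@le_lt_trans _ _ (1 + K)%:E); last exact: ltry.
apply: ge_ereal_sup => _ [T [T0 [rho [u rs]]] <-]; rewrite lee_fin.
have TK : T ^+ 2 <= K.
  rewrite /K; case: eqVneq => [v0|v0].
    have E_gt0 := initial_energy_gt0 hk hgamma hc T0 rs oA (coord_ball R0_gt0 bA) vacA mass.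
    have eps0 : 0 < eps.
      by rewrite divr_gt0// mulr_gt0// exprn_gt0// mulrn_wgt0.
    apply: (lifespan_static hk hgamma hc T0 rs R0_gt0 oA bA vacA mom mass v0 (eps := eps)) => //.
    - by rewrite lt_min exprn_gt0//= mulr_gt0// mulr_gt0 ?exprn_gt0 ?powR_gt0.
    - by rewrite ge_min lexx.
    - by rewrite ge_min lexx orbT.
  apply: (lifespan_moving hk hgamma hc T0 rs R0_gt0 oA bA vacA mom mass).
  by rewrite lt0r v0 sqnorm_ge0.
(* From [T^2 <= K] to [T <= 1 + K] without a square root: for [T > 1] one has [T <= T^2]. *)
have [T1|T1] := leP T 1.
  by rewrite (le_trans T1)// lerDl (le_trans _ TK)// sqr_ge0.
apply: le_trans (_ : K <= 1 + K); last by rewrite lerDr.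
by apply: le_trans TK; rewrite expr2 ler_peMr ?ltW.
Qed.
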